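(* Let $A,B,C$ be analytic functions of $(t,x)$ with $A\ne0$, and let $L=\partial_t-A\partial_{xx}-B\partial_x-C$. The nonlinear $(1+2)$-dimensional equation for $\eta=\eta(t,x,u)$, $$\eta_t=A(\eta_{xx}+2\eta\eta_{xu}+\eta^2\eta_{uu})+A_x(\eta_x+\eta\eta_u)+(B\eta)_x+C(\eta-u\eta_u)+C_xu,$$ is reduced by the composition of the nonlocal substitution $\eta=-\Phi_x/\Phi_u$, where $\Phi=\Phi(t,x,u)$ with $\Phi_u\neq0$, and the hodograph transformation with new independent variables $\tilde t=t$, $\tilde x=x$, $\varkappa=\Phi$ and new dependent variable $\tilde u=u$, to the equation $L\tilde u=0$ for the function $\tilde u=\tilde u(\tilde t,\tilde x,\varkappa)$, in which $\varkappa$ plays the role of a parameter. That is: if $\tilde u(t,x,\varkappa)$ with $\tilde u_\varkappa\ne0$ satisfies $L\tilde u=0$ for each $\varkappa$ and $\varkappa=\Phi(t,x,u)$ is obtained by solving $u=\tilde u(t,x,\varkappa)$ for $\varkappa$, then $\eta=-\Phi_x/\Phi_u$ solves the nonlinear equation; and every solution $\eta$ of the nonlinear equation is (locally) obtained in this way.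
   Context: All considerations are local: functions are smooth (or analytic) on a suitable domain, which may be shrunk where needed. *)

(* Defs.v *)
From Stdlib Require Import Reals.
From Coquelicot Require Import Coquelicot.
Open Scope R_scope.

(** Functions are total and curried; domains are
    open subsets of [R * R] or [R * R * R], and every condition is imposed on
    the domain only.  [Derive] is total as well, so a differential equation on
    an open set is always paired with smoothness there. *)

Definition d1 (f : R -> R -> R) (t x : R) : R := Derive (fun s => f s x) t.
Definition d2 (f : R -> R -> R) (t x : R) : R := Derive (fun y => f t y) x.

(** The third variable is [u] or the parameter [k], according to context. *)
Definition dt (f : R -> R -> R -> R) (t x u : R) : R :=
  Derive (fun s => f s x u) t.
Definition dx (f : R -> R -> R -> R) (t x u : R) : R :=
  Derive (fun y => f t y u) x.
Definition du (f : R -> R -> R -> R) (t x u : R) : R :=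
  Derive (fun v => f t x v) u.

(** Near [(t0, x0)], [f] is the sum of an absolutely convergent double power
    series; the terms are grouped by total degree, which is immaterial because
    of the absolute convergence. *)
Definition analytic_at (f : R -> R -> R) (t0 x0 : R) : Prop :=
  exists (a : nat -> nat -> R) (r : R), 0 < r /\
    forall t x : R, Rabs (t - t0) < r -> Rabs (x - x0) < r ->
      let term i j := a i j * (t - t0) ^ i * (x - x0) ^ j in
      ex_series (fun n => sum_n (fun i => Rabs (term i (n - i)%nat)) n) /\
      is_series (fun n => sum_n (fun i => term i (n - i)%nat) n) (f t x).

Definition analytic (Omega : R * R -> Prop) (f : R -> R -> R) : Prop :=
  forall t x : R, Omega (t, x) -> analytic_at f t x.

(** Three-variable counterpart of Coquelicot's [ex_diff_n]: the iterated
    partial derivatives up to order [n], in every order of differentiation,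
    exist and are continuous at the given point. *)
Fixpoint ex_diff_n3 (f : R -> R -> R -> R) (n : nat) (t x u : R) : Prop :=
  continuous (fun p : R * R * R => f (fst (fst p)) (snd (fst p)) (snd p))
    (t, x, u) /\
  match n with
  | O => True
  | S m =>
      ex_derive (fun s => f s x u) t /\
      ex_derive (fun y => f t y u) x /\
      ex_derive (fun v => f t x v) u /\
      ex_diff_n3 (dt f) m t x u /\
      ex_diff_n3 (dx f) m t x u /\
      ex_diff_n3 (du f) m t x u
  end.

Definition smooth (D : R * R * R -> Prop) (f : R -> R -> R -> R) : Prop :=
  forall (n : nat) (t x u : R), D (t, x, u) -> ex_diff_n3 f n t x u.

Definition lies_over (Omega : R * R -> Prop) (D : R * R * R -> Prop) : Prop :=
  forall t x u : R, D (t, x, u) -> Omega (t, x).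

Definition Lop (A B C : R -> R -> R) (v : R -> R -> R) (t x : R) : R :=
  d1 v t x - A t x * d2 (d2 v) t x - B t x * d2 v t x - C t x * v t x.

Definition linear_solution (A B C : R -> R -> R) (W : R * R * R -> Prop)
    (w : R -> R -> R -> R) : Prop :=
  smooth W w /\
  forall t x k : R, W (t, x, k) -> Lop A B C (fun s y => w s y k) t x = 0.

Definition nonlinear_solution (A B C : R -> R -> R) (D : R * R * R -> Prop)
    (eta : R -> R -> R -> R) : Prop :=
  smooth D eta /\
  forall t x u : R, D (t, x, u) ->
    dt eta t x u =
      A t x * (dx (dx eta) t x u
               + 2 * eta t x u * du (dx eta) t x u
               + eta t x u ^ 2 * du (du eta) t x u)
      + d2 A t x * (dx eta t x u + eta t x u * du eta t x u)
      + dx (fun s y v => B s y * eta s y v) t x u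
      + C t x * (eta t x u - u * du eta t x u)
      + d2 C t x * u.

(** [k = Phi t x u] on [D] and [u = w t x k] on [W] have the same graph: the map
    [(t, x, k) |-> (t, x, w t x k)] is a bijection from [W] onto [D], with inverse
    [(t, x, u) |-> (t, x, Phi t x u)].  A local branch of solutions of
    [u = w t x k] is covered by shrinking [W] to the image of that branch. *)
Definition hodograph (D W : R * R * R -> Prop) (Phi w : R -> R -> R -> R)
    : Prop :=
  forall t x u k : R,
    (D (t, x, u) /\ k = Phi t x u) <-> (W (t, x, k) /\ u = w t x k).

Definition nonlocal_subst (Phi : R -> R -> R -> R) (t x u : R) : R :=
  - dx Phi t x u / du Phi t x u.

(* Main.v *)
(** Differentiating [w_x = eta(t, x, w)] along the graph of [w] turns [L w = 0] and its
    [x]-derivative into the nonlinear equation, since [d/dx (g(t, x, w)) = g_x + eta g_u].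

    Conversely, [w] has to solve the overdetermined system [w_x = eta(t, x, w)],
    [w_t = zeta(t, x, w)] with [zeta = A (eta_x + eta eta_u) + B eta + C u], whose integrability
    condition is the nonlinear equation.  It is integrated first in [t] along [x = x0] with
    initial value [k], then in [x]; the defect [w_t - zeta(t, x, w)] vanishes at [x0] and
    satisfies a homogeneous linear equation in [x].  This needs the smooth dependence of scalar
    flows on parameters: the flow [Y] of [y' = f(p, s, y)] has
    [Y_c = exp (int f_y)] and [Y_p = Y_c int (f_p / Y_c)], so that each order of
    differentiability of [Y] yields the next one. *)

Require Import Defs.
From Stdlib Require Import Reals Ranalysis5 Lra Lia Psatz Classical ClassicalEpsilon.
From Coquelicot Require Import Coquelicot.
(* [Reals] shadows [d1] and [d2]. *)
Import Defs.
Open Scope R_scope.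

(** * Differential calculus of functions of three variables *)

(** [hodograph] is a purely set-theoretic bijection, so the continuity of [Phi] has itself to be
    proved; it comes from strict monotonicity of [w] in [k] and the intermediate value theorem.
    After that the partial derivatives of [Phi] are smooth expressions in [(t, x, Phi)], and - Phi_x
    / Phi_u = w_x because the factors w_k cancel. This identity holds on an open set, which is what
    permits differentiating it along the graph. In the converse, integrating the [t]-equation on a
    single line only makes w_x = eta true by construction, so one scalar defect is left. Smoothness
    of all orders always comes from the same bootstrap: the partial derivatives are exhibited as
    expressions of the class already known for the function. Hence the classes [Ck n], shown closed
    under sums, products, composition, inverses, exponentials and integrals with parameters.
    Analytic coefficients enter this calculus through termwise differentiation of a double power
    series, where the factor lost by differentiating is paid for by shrinking the radius to a
    quarter. *)

Definition cube (t0 x0 u0 d : R) (p : R * R * R) : Prop :=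
  Rabs (fst (fst p) - t0) < d /\ Rabs (snd (fst p) - x0) < d /\
  Rabs (snd p - u0) < d.

Lemma is_derive_eps (f : R -> R) (x l : R) :
  is_derive f x l <->
  forall eps, 0 < eps -> exists d, 0 < d /\
    forall y, Rabs (y - x) < d -> Rabs (f y - f x - l * (y - x)) <= eps * Rabs (y - x).
Proof.
  rewrite is_derive_Reals. split.
  - intros H eps He. destruct (H eps He) as [d Hd].
    exists d. split. { apply cond_pos. }
    intros y Hy. destruct (Req_dec y x) as [->|Hn].
    + replace (f x - f x - l * (x - x)) with 0 by ring.
      replace (x - x) with 0 by ring. rewrite Rabs_R0. lra.
    + assert (Hh : y - x <> 0) by lra.
      specialize (Hd (y - x) Hh Hy). replace (x + (y - x)) with y in Hd by ring.
      replace (f y - f x - l * (y - x)) with (((f y - f x) / (y - x) - l) * (y - x))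
        by (field; lra).
      rewrite Rabs_mult. apply Rmult_le_compat_r. apply Rabs_pos. lra.
  (* The standard definition demands a strict inequality, the form used here a weak one; halving
     [eps] bridges the two. *)
  - intros H eps He. destruct (H (eps / 2)) as [d [Hd Hb]]. lra.
    exists (mkposreal d Hd). intros h Hh Hhd. simpl in Hhd.
    specialize (Hb (x + h)). replace (x + h - x) with h in Hb by ring.
    specialize (Hb Hhd).
    replace ((f (x + h) - f x) / h - l) with ((f (x + h) - f x - l * h) / h)
      by (field; assumption).
    unfold Rdiv. rewrite Rabs_mult, Rabs_inv.
    assert (0 < Rabs h) by (apply Rabs_pos_lt; assumption).
    apply Rle_lt_trans with (eps / 2 * Rabs h * / Rabs h).
    + apply Rmult_le_compat_r. left; apply Rinv_0_lt_compat; assumption. assumption.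
    + field_simplify; lra.
Qed.

(** The uniform structure of a product is that of the maximum distance, so its balls are these cubes
    with the same radius. *)
Lemma locally_cube (t x u : R) (P : R * R * R -> Prop) :
  locally (t, x, u) P <->
  exists d, 0 < d /\ forall t' x' u', cube t x u d (t', x', u') -> P (t', x', u').
Proof.
  split.
  - intros [d Hd]. exists d. split. apply cond_pos.
    intros t' x' u' [H1 [H2 H3]]. apply Hd. split; [split|]; assumption.
  - intros [d [Hd H]]. exists (mkposreal d Hd). intros [[t' x'] u'] [[H1 H2] H3].
    apply H. split; [|split]; assumption.
Qed.

Lemma open_cubeP (D : R * R * R -> Prop) :
  open D <->
  forall t x u, D (t, x, u) -> exists d, 0 < d /\
    forall t' x' u', cube t x u d (t', x', u') -> D (t', x', u').
Proof.
  split.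
  - intros H t x u HD. apply locally_cube. apply H, HD.
  - intros H [[t x] u] HD. apply locally_cube. apply H, HD.
Qed.

Lemma cube_center (t x u d : R) : 0 < d -> cube t x u d (t, x, u).
Proof.
  intros Hd. unfold cube; simpl.
  replace (t - t) with 0 by ring; replace (x - x) with 0 by ring;
  replace (u - u) with 0 by ring; rewrite Rabs_R0; auto.
Qed.

Lemma cube_mono (t x u d e : R) (p : R * R * R) :
  d <= e -> cube t x u d p -> cube t x u e p.
Proof. unfold cube; intros; intuition lra. Qed.

Lemma open_cube (t x u d : R) : open (cube t x u d).
Proof.
  apply open_cubeP. unfold cube; simpl. intros t' x' u' (H1 & H2 & H3).
  exists (Rmin (d - Rabs (t' - t)) (Rmin (d - Rabs (x' - x)) (d - Rabs (u' - u)))).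
  split. { repeat apply Rmin_glb_lt; lra. }
  intros a b c (Ha & Hb & Hc).
  pose proof (Rmin_l (d - Rabs (t' - t)) (Rmin (d - Rabs (x' - x)) (d - Rabs (u' - u)))).
  pose proof (Rmin_r (d - Rabs (t' - t)) (Rmin (d - Rabs (x' - x)) (d - Rabs (u' - u)))).
  pose proof (Rmin_l (d - Rabs (x' - x)) (d - Rabs (u' - u))).
  pose proof (Rmin_r (d - Rabs (x' - x)) (d - Rabs (u' - u))).
  repeat split.
  - replace (a - t) with ((a - t') + (t' - t)) by ring.
    eapply Rle_lt_trans; [apply Rabs_triang|lra].
  - replace (b - x) with ((b - x') + (x' - x)) by ring.
    eapply Rle_lt_trans; [apply Rabs_triang|lra].
  - replace (c - u) with ((c - u') + (u' - u)) by ring.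
    eapply Rle_lt_trans; [apply Rabs_triang|lra].
Qed.

(** * Joint continuity in three variables *)

Definition cont3 (f : R -> R -> R -> R) (t x u : R) : Prop :=
  continuous (fun p : R * R * R => f (fst (fst p)) (snd (fst p)) (snd p)) (t, x, u).

Lemma cont3_eps (f : R -> R -> R -> R) (t x u : R) :
  cont3 f t x u <->
  forall eps, 0 < eps -> exists d, 0 < d /\
    forall t' x' u', cube t x u d (t', x', u') -> Rabs (f t' x' u' - f t x u) < eps.
Proof.
  unfold cont3, continuous. rewrite filterlim_locally. split.
  - intros H eps He. apply (locally_cube t x u
      (fun p => Rabs (f (fst (fst p)) (snd (fst p)) (snd p) - f t x u) < eps)).
    apply (H (mkposreal eps He)).
  - intros H eps. apply locally_cube. apply (H eps (cond_pos eps)).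
Qed.

Lemma continuous_eps (f : R -> R) (x : R) :
  continuous f x <->
  forall eps, 0 < eps -> exists d, 0 < d /\
    forall y, Rabs (y - x) < d -> Rabs (f y - f x) < eps.
Proof.
  unfold continuous. rewrite filterlim_locally. split.
  - intros H eps He. destruct (H (mkposreal eps He)) as [d Hd].
    exists d. split. apply cond_pos. intros y Hy. apply (Hd y Hy).
  - intros H eps. destruct (H eps (cond_pos eps)) as [d [Hd Hy]].
    exists (mkposreal d Hd). intros y Hb. apply (Hy y Hb).
Qed.

Lemma continuous_pair {T U V : UniformSpace} (f : T -> U) (g : T -> V) (x : T) :
  continuous f x -> continuous g x -> continuous (fun y => (f y, g y)) x.
Proof.
  intros Hf Hg. apply (continuous_comp_2 f g (fun a b => (a, b)) x Hf Hg).
  apply (continuous_ext (fun p : U * V => p)). intros []; reflexivity.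
  apply continuous_id.
Qed.

Lemma continuous_cont3_comp {T : UniformSpace} (f : R -> R -> R -> R)
  (a b c : T -> R) (p : T) :
  continuous a p -> continuous b p -> continuous c p ->
  cont3 f (a p) (b p) (c p) ->
  continuous (fun q => f (a q) (b q) (c q)) p.
Proof.
  intros Ha Hb Hc Hf.
  apply (continuous_comp (fun q => (a q, b q, c q))
    (fun p : R * R * R => f (fst (fst p)) (snd (fst p)) (snd p))).
  - apply continuous_pair; [apply continuous_pair|]; assumption.
  - exact Hf.
Qed.

Lemma cont3_comp (f a b c : R -> R -> R -> R) (t x u : R) :
  cont3 a t x u -> cont3 b t x u -> cont3 c t x u ->
  cont3 f (a t x u) (b t x u) (c t x u) ->
  cont3 (fun t x u => f (a t x u) (b t x u) (c t x u)) t x u.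
Proof. intros Ha Hb Hc Hf. exact (continuous_cont3_comp f _ _ _ (t, x, u) Ha Hb Hc Hf). Qed.

Lemma cont3_t (t x u : R) : cont3 (fun t _ _ => t) t x u.
Proof.
  apply cont3_eps. intros eps He. exists eps. split; trivial.
  intros t' x' u' (H & _ & _); exact H.
Qed.

Lemma cont3_x (t x u : R) : cont3 (fun _ x _ => x) t x u.
Proof.
  apply cont3_eps. intros eps He. exists eps. split; trivial.
  intros t' x' u' (_ & H & _); exact H.
Qed.

Lemma cont3_u (t x u : R) : cont3 (fun _ _ u => u) t x u.
Proof.
  apply cont3_eps. intros eps He. exists eps. split; trivial.
  intros t' x' u' (_ & _ & H); exact H.
Qed.

Lemma cont3_const (k t x u : R) : cont3 (fun _ _ _ => k) t x u.
Proof. apply continuous_const. Qed.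

Lemma cont3_ext_open (D : R * R * R -> Prop) (f g : R -> R -> R -> R) (t x u : R) :
  open D -> D (t, x, u) -> (forall t x u, D (t, x, u) -> f t x u = g t x u) ->
  cont3 f t x u -> cont3 g t x u.
Proof.
  intros HD Hp Heq Hf.
  refine (continuous_ext_loc _ _ (t, x, u) _ Hf).
  generalize (HD _ Hp). apply filter_imp. intros [[a b] c] H. apply Heq, H.
Qed.

Lemma open_slice_t (D : R * R * R -> Prop) (t x u : R) :
  open D -> D (t, x, u) -> locally t (fun s => D (s, x, u)).
Proof.
  intros HD Hp. apply open_cubeP in Hp as (d & Hd & H); trivial.
  exists (mkposreal d Hd). intros s Hs. apply H.
  destruct (cube_center t x u d Hd) as (_ & H2 & H3). repeat split; assumption.
Qed.

Lemma open_slice_x (D : R * R * R -> Prop) (t x u : R) :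
  open D -> D (t, x, u) -> locally x (fun y => D (t, y, u)).
Proof.
  intros HD Hp. apply open_cubeP in Hp as (d & Hd & H); trivial.
  exists (mkposreal d Hd). intros s Hs. apply H.
  destruct (cube_center t x u d Hd) as (H1 & H2 & H3). repeat split; assumption.
Qed.

Lemma open_slice_u (D : R * R * R -> Prop) (t x u : R) :
  open D -> D (t, x, u) -> locally u (fun v => D (t, x, v)).
Proof.
  intros HD Hp. apply open_cubeP in Hp as (d & Hd & H); trivial.
  exists (mkposreal d Hd). intros s Hs. apply H.
  destruct (cube_center t x u d Hd) as (H1 & H2 & H3). repeat split; assumption.
Qed.

(** [smooth] quantifies over all orders at once; fixing the order gives the induction parameter of
    every regularity proof below. *)
Definition Ck (n : nat) (D : R * R * R -> Prop) (f : R -> R -> R -> R) : Prop :=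
  forall t x u, D (t, x, u) -> ex_diff_n3 f n t x u.

Lemma smooth_Ck (D : R * R * R -> Prop) (f : R -> R -> R -> R) :
  smooth D f <-> forall n, Ck n D f.
Proof. split; intros H n t x u; apply H. Qed.

Lemma Ck_cont (n : nat) (D : R * R * R -> Prop) (f : R -> R -> R -> R) (t x u : R) :
  Ck n D f -> D (t, x, u) -> cont3 f t x u.
Proof. intros H Hp. specialize (H _ _ _ Hp). destruct n; apply H. Qed.

Lemma Ck_S (n : nat) (D : R * R * R -> Prop) (f : R -> R -> R -> R) :
  Ck (S n) D f <->
  (forall t x u, D (t, x, u) -> cont3 f t x u /\
     ex_derive (fun s => f s x u) t /\ ex_derive (fun y => f t y u) x /\
     ex_derive (fun v => f t x v) u) /\
  Ck n D (dt f) /\ Ck n D (dx f) /\ Ck n D (du f).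
Proof.
  split.
  - intros H. repeat split; try (intros t x u Hp; apply (H t x u Hp));
    apply (H _ _ _ H0).
  - intros (H & H1 & H2 & H3) t x u Hp. specialize (H _ _ _ Hp).
    repeat split; try apply H; [apply H1|apply H2|apply H3]; assumption.
Qed.

Lemma Ck_S_le (n : nat) (D : R * R * R -> Prop) (f : R -> R -> R -> R) :
  Ck (S n) D f -> Ck n D f.
Proof.
  revert f. induction n; intros f H.
  - intros t x u Hp. split; trivial. apply (Ck_cont _ _ _ _ _ _ H Hp).
  - apply Ck_S in H as (H & H1 & H2 & H3). apply Ck_S. auto.
Qed.

Lemma dt_ext (D : R * R * R -> Prop) (f g : R -> R -> R -> R) :
  open D -> (forall t x u, D (t, x, u) -> f t x u = g t x u) ->
  forall t x u, D (t, x, u) -> dt f t x u = dt g t x u.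
Proof.
  intros HD H t x u Hp. apply Derive_ext_loc.
  generalize (open_slice_t D t x u HD Hp). apply filter_imp. intros; apply H; assumption.
Qed.

Lemma dx_ext (D : R * R * R -> Prop) (f g : R -> R -> R -> R) :
  open D -> (forall t x u, D (t, x, u) -> f t x u = g t x u) ->
  forall t x u, D (t, x, u) -> dx f t x u = dx g t x u.
Proof.
  intros HD H t x u Hp. apply Derive_ext_loc.
  generalize (open_slice_x D t x u HD Hp). apply filter_imp. intros; apply H; assumption.
Qed.

Lemma du_ext (D : R * R * R -> Prop) (f g : R -> R -> R -> R) :
  open D -> (forall t x u, D (t, x, u) -> f t x u = g t x u) ->
  forall t x u, D (t, x, u) -> du f t x u = du g t x u.
Proof.
  intros HD H t x u Hp. apply Derive_ext_loc.
  generalize (open_slice_u D t x u HD Hp). apply filter_imp. intros; apply H; assumption.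
Qed.

(** Openness of [D] is what makes equality on [D] pass to the total functions [dt], [dx], [du], and
    hence to all iterated derivatives. *)
Lemma Ck_ext (n : nat) (D : R * R * R -> Prop) (f g : R -> R -> R -> R) :
  open D -> (forall t x u, D (t, x, u) -> f t x u = g t x u) ->
  Ck n D f -> Ck n D g.
Proof.
  intros HD. revert f g. induction n; intros f g He Hf.
  - intros t x u Hp. split; trivial.
    apply (cont3_ext_open D f g); trivial. apply (Ck_cont _ _ _ _ _ _ Hf Hp).
  - apply Ck_S in Hf as (Hf & H1 & H2 & H3). apply Ck_S. split; [|split; [|split]].
    + intros t x u Hp. destruct (Hf t x u Hp) as (Hc & Ht & Hx & Hu).
      split; [|split; [|split]].
      * apply (cont3_ext_open D f g); trivial.
      * refine (ex_derive_ext_loc _ _ _ _ Ht).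
        generalize (open_slice_t D t x u HD Hp). apply filter_imp; auto.
      * refine (ex_derive_ext_loc _ _ _ _ Hx).
        generalize (open_slice_x D t x u HD Hp). apply filter_imp; auto.
      * refine (ex_derive_ext_loc _ _ _ _ Hu).
        generalize (open_slice_u D t x u HD Hp). apply filter_imp; auto.
    + apply (IHn (dt f)); trivial. apply dt_ext; trivial.
    + apply (IHn (dx f)); trivial. apply dx_ext; trivial.
    + apply (IHn (du f)); trivial. apply du_ext; trivial.
Qed.

(* Taking candidate partial derivatives as input avoids computing [Derive]. *)
Lemma Ck_S_intro (n : nat) (D : R * R * R -> Prop) (f ft fx fu : R -> R -> R -> R) :
  open D ->
  (forall t x u, D (t, x, u) -> cont3 f t x u /\
     is_derive (fun s => f s x u) t (ft t x u) /\
     is_derive (fun y => f t y u) x (fx t x u) /\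
     is_derive (fun v => f t x v) u (fu t x u)) ->
  Ck n D ft -> Ck n D fx -> Ck n D fu -> Ck (S n) D f.
Proof.
  intros HD H Ht Hx Hu. apply Ck_S. split; [|split; [|split]].
  - intros t x u Hp. destruct (H t x u Hp) as (H0 & H1 & H2 & H3).
    split; [|split; [|split]]; trivial; eexists; eassumption.
  - apply (Ck_ext n D ft); trivial. intros t x u Hp. symmetry.
    apply is_derive_unique, H, Hp.
  - apply (Ck_ext n D fx); trivial. intros t x u Hp. symmetry.
    apply is_derive_unique, H, Hp.
  - apply (Ck_ext n D fu); trivial. intros t x u Hp. symmetry.
    apply is_derive_unique, H, Hp.
Qed.

Lemma Ck_partials (n : nat) (D : R * R * R -> Prop) (f : R -> R -> R -> R) :
  Ck (S n) D f -> forall t x u, D (t, x, u) ->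
  is_derive (fun s => f s x u) t (dt f t x u) /\
  is_derive (fun y => f t y u) x (dx f t x u) /\
  is_derive (fun v => f t x v) u (du f t x u).
Proof.
  intros H t x u Hp. apply Ck_S in H as (H & _).
  destruct (H t x u Hp) as (_ & H1 & H2 & H3).
  split; [|split]; apply Derive_correct; assumption.
Qed.

Lemma Ck_const (n : nat) (D : R * R * R -> Prop) (k : R) :
  open D -> Ck n D (fun _ _ _ => k).
Proof.
  intros HD. revert k. induction n; intros k.
  - intros t x u _. split; trivial. apply cont3_const.
  - apply (Ck_S_intro n D _ (fun _ _ _ => 0) (fun _ _ _ => 0) (fun _ _ _ => 0)); auto.
    intros t x u _. split; [apply cont3_const|].
    split; [|split]; apply (is_derive_const (K := R_AbsRing) (V := R_NormedModule) k).
Qed.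

Lemma Ck_t (n : nat) (D : R * R * R -> Prop) : open D -> Ck n D (fun t _ _ => t).
Proof.
  intros HD. destruct n.
  - intros t x u _. split; trivial. apply cont3_t.
  - apply (Ck_S_intro n D _ (fun _ _ _ => 1) (fun _ _ _ => 0) (fun _ _ _ => 0));
    trivial; try (apply Ck_const; trivial).
    intros t x u _. split; [apply cont3_t|].
    split; [|split]; auto_derive; trivial.
Qed.

Lemma Ck_x (n : nat) (D : R * R * R -> Prop) : open D -> Ck n D (fun _ x _ => x).
Proof.
  intros HD. destruct n.
  - intros t x u _. split; trivial. apply cont3_x.
  - apply (Ck_S_intro n D _ (fun _ _ _ => 0) (fun _ _ _ => 1) (fun _ _ _ => 0));
    trivial; try (apply Ck_const; trivial).
    intros t x u _. split; [apply cont3_x|].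
    split; [|split]; auto_derive; trivial.
Qed.

Lemma Ck_u (n : nat) (D : R * R * R -> Prop) : open D -> Ck n D (fun _ _ u => u).
Proof.
  intros HD. destruct n.
  - intros t x u _. split; trivial. apply cont3_u.
  - apply (Ck_S_intro n D _ (fun _ _ _ => 0) (fun _ _ _ => 0) (fun _ _ _ => 1));
    trivial; try (apply Ck_const; trivial).
    intros t x u _. split; [apply cont3_u|].
    split; [|split]; auto_derive; trivial.
Qed.

Lemma Ck_plus (n : nat) (D : R * R * R -> Prop) (f g : R -> R -> R -> R) :
  open D -> Ck n D f -> Ck n D g -> Ck n D (fun t x u => f t x u + g t x u).
Proof.
  intros HD. revert f g. induction n; intros f g Hf Hg.
  - intros t x u Hp. split; trivial.
    exact (continuous_plus _ _ _ (Ck_cont _ _ _ _ _ _ Hf Hp) (Ck_cont _ _ _ _ _ _ Hg Hp)).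
  - pose proof Hf as Hf'. pose proof Hg as Hg'.
    apply Ck_S in Hf' as (_ & F1 & F2 & F3). apply Ck_S in Hg' as (_ & G1 & G2 & G3).
    eapply (Ck_S_intro n D); [trivial| |apply (IHn _ _ F1 G1)|apply (IHn _ _ F2 G2)
      |apply (IHn _ _ F3 G3)].
    intros t x u Hp.
    destruct (Ck_partials _ _ _ Hf t x u Hp) as (a1 & a2 & a3).
    destruct (Ck_partials _ _ _ Hg t x u Hp) as (b1 & b2 & b3).
    split; [|split; [|split]].
    + exact (continuous_plus _ _ _ (Ck_cont _ _ _ _ _ _ Hf Hp) (Ck_cont _ _ _ _ _ _ Hg Hp)).
    + exact (is_derive_plus _ _ _ _ _ a1 b1).
    + exact (is_derive_plus _ _ _ _ _ a2 b2).
    + exact (is_derive_plus _ _ _ _ _ a3 b3).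
Qed.

Lemma Ck_mult (n : nat) (D : R * R * R -> Prop) (f g : R -> R -> R -> R) :
  open D -> Ck n D f -> Ck n D g -> Ck n D (fun t x u => f t x u * g t x u).
Proof.
  intros HD. revert f g. induction n; intros f g Hf Hg.
  - intros t x u Hp. split; trivial.
    exact (continuous_mult _ _ _ (Ck_cont _ _ _ _ _ _ Hf Hp) (Ck_cont _ _ _ _ _ _ Hg Hp)).
  - pose proof Hf as Hf'. pose proof Hg as Hg'.
    apply Ck_S in Hf' as (_ & F1 & F2 & F3). apply Ck_S in Hg' as (_ & G1 & G2 & G3).
    pose proof (Ck_S_le _ _ _ Hf) as F0. pose proof (Ck_S_le _ _ _ Hg) as G0.
    eapply (Ck_S_intro n D); [trivial| 
      |apply (Ck_plus n D _ _ HD (IHn _ _ F1 G0) (IHn _ _ F0 G1))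
      |apply (Ck_plus n D _ _ HD (IHn _ _ F2 G0) (IHn _ _ F0 G2))
      |apply (Ck_plus n D _ _ HD (IHn _ _ F3 G0) (IHn _ _ F0 G3))].
    intros t x u Hp.
    destruct (Ck_partials _ _ _ Hf t x u Hp) as (a1 & a2 & a3).
    destruct (Ck_partials _ _ _ Hg t x u Hp) as (b1 & b2 & b3).
    split; [|split; [|split]].
    + exact (continuous_mult _ _ _ (Ck_cont _ _ _ _ _ _ Hf Hp) (Ck_cont _ _ _ _ _ _ Hg Hp)).
    + exact (is_derive_mult _ _ _ _ _ a1 b1 Rmult_comm).
    + exact (is_derive_mult _ _ _ _ _ a2 b2 Rmult_comm).
    + exact (is_derive_mult _ _ _ _ _ a3 b3 Rmult_comm).
Qed.

Lemma Ck_opp (n : nat) (D : R * R * R -> Prop) (f : R -> R -> R -> R) :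
  open D -> Ck n D f -> Ck n D (fun t x u => - f t x u).
Proof.
  intros HD Hf. apply (Ck_ext n D (fun t x u => (-1) * f t x u)); trivial.
  - intros; ring.
  - apply Ck_mult; trivial. apply Ck_const; trivial.
Qed.

(** * Strict differentiability, the chain rule and composition *)

Lemma MVT_bound (g : R -> R) (z0 d l e : R) :
  (forall z, Rabs (z - z0) < d -> ex_derive g z /\ Rabs (Derive g z - l) <= e) ->
  forall z1 z2, Rabs (z1 - z0) < d -> Rabs (z2 - z0) < d ->
  Rabs (g z2 - g z1 - l * (z2 - z1)) <= e * Rabs (z2 - z1).
Proof.
  intros H z1 z2 H1 H2.
  assert (Hin : forall z, Rmin z1 z2 <= z <= Rmax z1 z2 -> Rabs (z - z0) < d).
  { intros z. apply Rabs_def2 in H1. apply Rabs_def2 in H2.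
    unfold Rmin, Rmax. destruct (Rle_dec z1 z2); intros; apply Rabs_def1; lra. }
  destruct (MVT_gen g z1 z2 (Derive g)) as (c & Hc & E).
  - intros z Hz. apply Derive_correct, H, Hin. lra.
  - intros z Hz. apply continuity_pt_filterlim. apply (ex_derive_continuous g), H, Hin, Hz.
  - rewrite E. replace (Derive g c * (z2 - z1) - l * (z2 - z1))
      with ((Derive g c - l) * (z2 - z1)) by ring.
    rewrite Rabs_mult. apply Rmult_le_compat_r. apply Rabs_pos. apply H, Hin, Hc.
Qed.

(** Continuity of the partial derivatives gives an error bound between any two points near the base
    point, not only from the base point itself. The two-point form is what lets [flow_strict] move
    the base point along a trajectory. *)
Lemma strict_diff (D : R * R * R -> Prop) (f : R -> R -> R -> R) (t x u : R) :
  open D -> Ck 1 D f -> D (t, x, u) ->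
  forall eps, 0 < eps -> exists d, 0 < d /\
    (forall p, cube t x u d p -> D p) /\
    forall t1 x1 u1 t2 x2 u2, cube t x u d (t1, x1, u1) -> cube t x u d (t2, x2, u2) ->
    Rabs (f t2 x2 u2 - f t1 x1 u1
          - (dt f t x u * (t2 - t1) + dx f t x u * (x2 - x1) + du f t x u * (u2 - u1)))
    <= eps * (Rabs (t2 - t1) + Rabs (x2 - x1) + Rabs (u2 - u1)).
Proof.
  intros HD Hf Hp eps He.
  apply Ck_S in Hf as (Hf & Ht & Hx & Hu).
  destruct (proj1 (open_cubeP D) HD t x u Hp) as (d0 & Hd0 & H0).
  destruct (proj1 (cont3_eps _ _ _ _) (Ck_cont _ _ _ _ _ _ Ht Hp) eps He) as (da & Hda & Ha).
  destruct (proj1 (cont3_eps _ _ _ _) (Ck_cont _ _ _ _ _ _ Hx Hp) eps He) as (db & Hdb & Hb).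
  destruct (proj1 (cont3_eps _ _ _ _) (Ck_cont _ _ _ _ _ _ Hu Hp) eps He) as (dc & Hdc & Hc).
  set (d := Rmin (Rmin d0 da) (Rmin db dc)).
  assert (L : d <= d0 /\ d <= da /\ d <= db /\ d <= dc).
  { unfold d. pose proof (Rmin_l (Rmin d0 da) (Rmin db dc)).
    pose proof (Rmin_r (Rmin d0 da) (Rmin db dc)).
    pose proof (Rmin_l d0 da). pose proof (Rmin_r d0 da).
    pose proof (Rmin_l db dc). pose proof (Rmin_r db dc). lra. }
  exists d. split. { unfold d. repeat apply Rmin_glb_lt; assumption. }
  split. { intros [[a b] c] Hq. apply H0. eapply cube_mono; [|exact Hq]. lra. }
  intros t1 x1 u1 t2 x2 u2 (T1 & X1 & U1) (T2 & X2 & U2); simpl in *.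
  (* The increment is split along the path (t1,x1,u1), (t1,x1,u2), (t1,x2,u2), (t2,x2,u2); a cube
     contains all three segments once it contains both endpoints. *)
  assert (E1 := MVT_bound (fun s => f s x2 u2) t d (dt f t x u) eps).
  assert (E2 := MVT_bound (fun s => f t1 s u2) x d (dx f t x u) eps).
  assert (E3 := MVT_bound (fun s => f t1 x1 s) u d (du f t x u) eps).
  assert (I : forall a b c, cube t x u d (a, b, c) ->
     D (a, b, c) /\ cube t x u da (a, b, c) /\ cube t x u db (a, b, c) /\ cube t x u dc (a, b, c)).
  { intros a b c Hq. split; [|split; [|split]].
    - apply H0. eapply cube_mono; [|exact Hq]; lra.
    - eapply cube_mono; [|exact Hq]; lra.
    - eapply cube_mono; [|exact Hq]; lra.
    - eapply cube_mono; [|exact Hq]; lra. }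
  lapply E1; [clear E1; intros E1|].
  2:{ intros z Hz. destruct (I z x2 u2) as (i0 & i1 & i2 & i3). repeat split; assumption.
      split. apply (Hf _ _ _ i0). left. apply (Ha _ _ _ i1). }
  lapply E2; [clear E2; intros E2|].
  2:{ intros z Hz. destruct (I t1 z u2) as (i0 & i1 & i2 & i3). repeat split; assumption.
      split. apply (Hf _ _ _ i0). left. apply (Hb _ _ _ i2). }
  lapply E3; [clear E3; intros E3|].
  2:{ intros z Hz. destruct (I t1 x1 z) as (i0 & i1 & i2 & i3). repeat split; assumption.
      split. apply (Hf _ _ _ i0). left. apply (Hc _ _ _ i3). }
  specialize (E1 t1 t2 T1 T2). specialize (E2 x1 x2 X1 X2). specialize (E3 u1 u2 U1 U2).
  replace (f t2 x2 u2 - f t1 x1 u1 -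
    (dt f t x u * (t2 - t1) + dx f t x u * (x2 - x1) + du f t x u * (u2 - u1)))
  with ((f t2 x2 u2 - f t1 x2 u2 - dt f t x u * (t2 - t1))
    + ((f t1 x2 u2 - f t1 x1 u2 - dx f t x u * (x2 - x1))
    + (f t1 x1 u2 - f t1 x1 u1 - du f t x u * (u2 - u1)))) by ring.
  eapply Rle_trans. apply Rabs_triang.
  eapply Rle_trans. apply Rplus_le_compat_l, Rabs_triang. lra.
Qed.

Lemma is_derive_loc_lip (a : R -> R) (s l : R) :
  is_derive a s l -> exists d, 0 < d /\ forall r, Rabs (r - s) < d ->
    Rabs (a r - a s) <= (Rabs l + 1) * Rabs (r - s).
Proof.
  intros H. destruct (proj1 (is_derive_eps _ _ _) H 1 Rlt_0_1) as (d & Hd & B).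
  exists d. split; trivial. intros r Hr. specialize (B r Hr).
  replace (a r - a s) with ((a r - a s - l * (r - s)) + l * (r - s)) by ring.
  eapply Rle_trans. apply Rabs_triang. rewrite (Rabs_mult l). lra.
Qed.

Lemma is_derive_comp3 (D : R * R * R -> Prop) (f : R -> R -> R -> R)
  (a b c : R -> R) (s a' b' c' : R) :
  open D -> Ck 1 D f -> D (a s, b s, c s) ->
  is_derive a s a' -> is_derive b s b' -> is_derive c s c' ->
  is_derive (fun r => f (a r) (b r) (c r)) s
    (dt f (a s) (b s) (c s) * a' + dx f (a s) (b s) (c s) * b'
     + du f (a s) (b s) (c s) * c').
Proof.
  intros HD Hf Hp Ha Hb Hc.
  set (lt := dt f (a s) (b s) (c s)). set (lx := dx f (a s) (b s) (c s)).
  set (lu := du f (a s) (b s) (c s)).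
  (* The linear part of [f] is split off: it has the announced derivative by linearity, and the rest
     has derivative 0 by strict differentiability. *)
  apply (is_derive_ext (fun r => (f (a r) (b r) (c r) - (lt * a r + lx * b r + lu * c r))
    + (lt * a r + lx * b r + lu * c r))).
  { intros r; cbv beta.
    set (S := lt * a r + lx * b r + lu * c r). set (F := f (a r) (b r) (c r)).
    change (@eq R (F - S + S) F); ring. }
  replace (lt * a' + lx * b' + lu * c') with (0 + (lt * a' + lx * b' + lu * c')) by ring.
  apply (is_derive_plus (fun r => f (a r) (b r) (c r) - (lt * a r + lx * b r + lu * c r))
    (fun r => lt * a r + lx * b r + lu * c r)).
  2:{ apply (is_derive_plus (fun r => lt * a r + lx * b r) (fun r => lu * c r)).
      apply (is_derive_plus (fun r => lt * a r) (fun r => lx * b r)).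
      all: apply is_derive_scal; assumption. }
  destruct (is_derive_loc_lip _ _ _ Ha) as (da & Hda & La).
  destruct (is_derive_loc_lip _ _ _ Hb) as (db & Hdb & Lb).
  destruct (is_derive_loc_lip _ _ _ Hc) as (dc & Hdc & Lc).
  (* A local Lipschitz constant of the inner curve in the sum norm; error [eps / K] for [f] becomes
     [eps] along the curve. *)
  set (K := (Rabs a' + 1) + (Rabs b' + 1) + (Rabs c' + 1)).
  assert (HK : 0 < K).
  { unfold K. pose proof (Rabs_pos a'); pose proof (Rabs_pos b'); pose proof (Rabs_pos c'). lra. }
  apply is_derive_eps. intros eps He.
  assert (HeK : 0 < eps / K) by (apply Rdiv_lt_0_compat; assumption).
  destruct (strict_diff D f _ _ _ HD Hf Hp (eps / K) HeK) as (d & Hd & _ & B).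
  assert (Hca : continuous a s) by (apply (ex_derive_continuous a); eexists; eassumption).
  assert (Hcb : continuous b s) by (apply (ex_derive_continuous b); eexists; eassumption).
  assert (Hcc : continuous c s) by (apply (ex_derive_continuous c); eexists; eassumption).
  destruct (proj1 (continuous_eps _ _) Hca d Hd) as (ea & Hea & Ca).
  destruct (proj1 (continuous_eps _ _) Hcb d Hd) as (eb & Heb & Cb).
  destruct (proj1 (continuous_eps _ _) Hcc d Hd) as (ec & Hec & Cc).
  exists (Rmin (Rmin (Rmin da db) (Rmin dc ea)) (Rmin eb ec)). split.
  { repeat apply Rmin_glb_lt; assumption. }
  intros r Hr.
  apply Rmin_Rgt in Hr as (Hr & Hr2). apply Rmin_Rgt in Hr as (Hr & Hr1).
  apply Rmin_Rgt in Hr as (Ra & Rb). apply Rmin_Rgt in Hr1 as (Rc & Rea).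
  apply Rmin_Rgt in Hr2 as (Reb & Rec).
  specialize (B (a s) (b s) (c s) (a r) (b r) (c r) (cube_center _ _ _ _ Hd)).
  lapply B; [clear B; intros B|].
  2:{ split; [|split]; simpl; auto. }
  fold lt lx lu in B.
  replace (f (a r) (b r) (c r) - (lt * a r + lx * b r + lu * c r) -
    (f (a s) (b s) (c s) - (lt * a s + lx * b s + lu * c s)) - 0 * (r - s)) with
    (f (a r) (b r) (c r) - f (a s) (b s) (c s) -
     (lt * (a r - a s) + lx * (b r - b s) + lu * (c r - c s))) by ring.
  eapply Rle_trans. exact B.
  specialize (La r Ra). specialize (Lb r Rb). specialize (Lc r Rc).
  apply Rle_trans with (eps / K * (K * Rabs (r - s))).
  - apply Rmult_le_compat_l. lra. unfold K. lra.
  - right. field. lra.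
Qed.

(** By the chain rule each partial derivative is a sum of products of [dt f], [dx f], [du f],
    composed with the same inner maps, and of derivatives of the inner maps. The induction therefore
    varies the outer function too. *)
Lemma Ck_comp (n : nat) (D E : R * R * R -> Prop) (f a b c : R -> R -> R -> R) :
  open D -> open E -> Ck n E f -> Ck n D a -> Ck n D b -> Ck n D c ->
  (forall t x u, D (t, x, u) -> E (a t x u, b t x u, c t x u)) ->
  Ck n D (fun t x u => f (a t x u) (b t x u) (c t x u)).
Proof.
  intros HD HE. revert f a b c. induction n; intros f a b c Hf Ha Hb Hc HDE.
  - intros t x u Hp. split; trivial. apply cont3_comp;
    [apply (Ha t x u Hp)|apply (Hb t x u Hp)|apply (Hc t x u Hp)|].
    apply (Hf _ _ _ (HDE _ _ _ Hp)).
  - assert (Hf1 : Ck 1 E f).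
    { clear -Hf. induction n; trivial. apply IHn, Ck_S_le, Hf. }
    pose proof Hf as Hf'. apply Ck_S in Hf' as (Hfc & F1 & F2 & F3).
    pose proof Ha as Ha'. apply Ck_S in Ha' as (_ & A1 & A2 & A3).
    pose proof Hb as Hb'. apply Ck_S in Hb' as (_ & B1 & B2 & B3).
    pose proof Hc as Hc'. apply Ck_S in Hc' as (_ & C1 & C2 & C3).
    pose proof (Ck_S_le _ _ _ Ha) as A0. pose proof (Ck_S_le _ _ _ Hb) as B0.
    pose proof (Ck_S_le _ _ _ Hc) as C0.
    pose proof (IHn _ _ _ _ F1 A0 B0 C0 HDE) as G1.
    pose proof (IHn _ _ _ _ F2 A0 B0 C0 HDE) as G2.
    pose proof (IHn _ _ _ _ F3 A0 B0 C0 HDE) as G3.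
    eapply (Ck_S_intro n D); [trivial| |
      exact (Ck_plus n D _ _ HD (Ck_plus n D _ _ HD (Ck_mult n D _ _ HD G1 A1)
         (Ck_mult n D _ _ HD G2 B1)) (Ck_mult n D _ _ HD G3 C1)) |
      exact (Ck_plus n D _ _ HD (Ck_plus n D _ _ HD (Ck_mult n D _ _ HD G1 A2)
         (Ck_mult n D _ _ HD G2 B2)) (Ck_mult n D _ _ HD G3 C2)) |
      exact (Ck_plus n D _ _ HD (Ck_plus n D _ _ HD (Ck_mult n D _ _ HD G1 A3)
         (Ck_mult n D _ _ HD G2 B3)) (Ck_mult n D _ _ HD G3 C3))].
    intros t x u Hp.
    destruct (Ck_partials _ _ _ Ha t x u Hp) as (a1 & a2 & a3).
    destruct (Ck_partials _ _ _ Hb t x u Hp) as (b1 & b2 & b3).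
    destruct (Ck_partials _ _ _ Hc t x u Hp) as (c1 & c2 & c3).
    split; [|split; [|split]].
    + apply cont3_comp;
      [apply (Ha t x u Hp)|apply (Hb t x u Hp)|apply (Hc t x u Hp)|].
      apply (Hf _ _ _ (HDE _ _ _ Hp)).
    + exact (is_derive_comp3 E f (fun s => a s x u) (fun s => b s x u) (fun s => c s x u)
        t _ _ _ HE Hf1 (HDE _ _ _ Hp) a1 b1 c1).
    + exact (is_derive_comp3 E f (fun s => a t s u) (fun s => b t s u) (fun s => c t s u)
        x _ _ _ HE Hf1 (HDE _ _ _ Hp) a2 b2 c2).
    + exact (is_derive_comp3 E f (fun s => a t x s) (fun s => b t x s) (fun s => c t x s)
        u _ _ _ HE Hf1 (HDE _ _ _ Hp) a3 b3 c3).
Qed.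

Lemma open_neq0_u : open (fun p : R * R * R => snd p <> 0).
Proof.
  apply open_cubeP. simpl. intros t x u Hu. exists (Rabs u).
  split. { apply Rabs_pos_lt, Hu. }
  intros t' x' u' (_ & _ & H) E; simpl in *. rewrite E in H.
  replace (0 - u) with (- u) in H by ring. rewrite Rabs_Ropp in H. lra.
Qed.

(** The derivative of 1/u is minus the square of 1/u, so the function supplies its own next order;
    the exponential below behaves likewise. *)
Lemma Ck_inv_u (n : nat) : Ck n (fun p => snd p <> 0) (fun _ _ u => / u).
Proof.
  assert (Hc : forall t x u : R, u <> 0 -> cont3 (fun _ _ u => / u) t x u).
  { intros t x u Hu.
    apply (continuous_comp (fun p : R * R * R => snd p) Rinv). apply cont3_u.
    apply continuous_Rinv. exact Hu. }
  induction n.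
  - intros t x u Hu. split; trivial. apply Hc, Hu.
  - pose proof open_neq0_u as HO.
    eapply (Ck_S_intro n _ _ (fun _ _ _ => 0) (fun _ _ _ => 0)); trivial.
    2,3: apply Ck_const; trivial.
    2: exact (Ck_opp n _ _ HO (Ck_mult n _ _ _ HO IHn IHn)).
    intros t x u Hu; simpl in Hu. split; [apply Hc, Hu|].
    split; [|split].
    + apply (is_derive_const (K := R_AbsRing) (V := R_NormedModule)).
    + apply (is_derive_const (K := R_AbsRing) (V := R_NormedModule)).
    + auto_derive. exact Hu. field. exact Hu.
Qed.

Lemma Ck_exp_u (n : nat) : Ck n (fun _ => True) (fun _ _ u => exp u).
Proof.
  assert (Hc : forall t x u : R, cont3 (fun _ _ u => exp u) t x u).
  { intros t x u.
    apply (continuous_comp (fun p : R * R * R => snd p) exp). apply cont3_u.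
    apply (ex_derive_continuous exp). auto_derive. trivial. }
  induction n.
  - intros t x u Hu. split; trivial. apply Hc.
  - pose proof (open_true : open (fun _ : R * R * R => True)) as HO.
    eapply (Ck_S_intro n _ _ (fun _ _ _ => 0) (fun _ _ _ => 0)); trivial.
    2,3: apply Ck_const; trivial.
    2: exact IHn.
    intros t x u _. split; [apply Hc|].
    split; [|split].
    + apply (is_derive_const (K := R_AbsRing) (V := R_NormedModule)).
    + apply (is_derive_const (K := R_AbsRing) (V := R_NormedModule)).
    + auto_derive. exact I. ring.
Qed.

Lemma Ck_inv (n : nat) (D : R * R * R -> Prop) (f : R -> R -> R -> R) :
  open D -> Ck n D f -> (forall t x u, D (t, x, u) -> f t x u <> 0) ->
  Ck n D (fun t x u => / f t x u).
Proof.
  intros HD Hf H0.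
  apply (Ck_comp n D _ (fun _ _ u => / u) f f f HD open_neq0_u (Ck_inv_u n) Hf Hf Hf).
  exact H0.
Qed.

Lemma Ck_exp (n : nat) (D : R * R * R -> Prop) (f : R -> R -> R -> R) :
  open D -> Ck n D f -> Ck n D (fun t x u => exp (f t x u)).
Proof.
  intros HD Hf.
  apply (Ck_comp n D _ (fun _ _ u => exp u) f f f HD open_true (Ck_exp_u n) Hf Hf Hf).
  trivial.
Qed.

Lemma Ck_smooth (D : R * R * R -> Prop) (f : R -> R -> R -> R) (n : nat) :
  smooth D f -> Ck n D f.
Proof. intros H. apply smooth_Ck, H. Qed.

Lemma smooth_partials (D : R * R * R -> Prop) (f : R -> R -> R -> R) :
  smooth D f -> smooth D (dt f) /\ smooth D (dx f) /\ smooth D (du f).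
Proof.
  intros H. split; [|split]; apply smooth_Ck; intros n;
  pose proof (Ck_smooth _ _ (S n) H) as H'; apply Ck_S in H'; apply H'.
Qed.

(** * Symmetry of mixed partial derivatives *)

Lemma schwarz_2d (g : R -> R -> R) (s0 y0 d : R) :
  0 < d ->
  (forall s y, Rabs (s - s0) < d -> Rabs (y - y0) < d ->
   ex_derive (fun z => g z y) s /\ ex_derive (fun z => g s z) y /\
   ex_derive (fun z => Derive (fun r => g z r) y) s /\
   ex_derive (fun z => Derive (fun r => g r z) s) y) ->
  continuity_2d_pt (fun s y => Derive (fun z => Derive (fun r => g z r) y) s) s0 y0 ->
  continuity_2d_pt (fun s y => Derive (fun z => Derive (fun r => g r z) s) y) s0 y0 ->
  Derive (fun z => Derive (fun r => g z r) y0) s0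
  = Derive (fun z => Derive (fun r => g r z) s0) y0.
Proof.
  intros Hd H C1 C2. apply Schwarz; trivial.
  exists (mkposreal d Hd). intros s y Hs Hy. apply H; assumption.
Qed.

Lemma dtdx_comm (D : R * R * R -> Prop) (f : R -> R -> R -> R) :
  open D -> smooth D f -> forall t x u, D (t, x, u) -> dt (dx f) t x u = dx (dt f) t x u.
Proof.
  intros HD Hf t x u Hp.
  destruct (smooth_partials _ _ Hf) as (Ht & Hx & Hu).
  destruct (proj1 (open_cubeP D) HD t x u Hp) as (d & Hd & H).
  apply (schwarz_2d (fun s y => f s y u) t x d Hd).
  - intros s y Hs Hy.
    assert (Hq : D (s, y, u)).
    { apply H. destruct (cube_center t x u d Hd) as (_ & _ & H3). repeat split; assumption. }
    split; [|split; [|split]].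
    + apply (Ck_smooth _ _ 1 Hf _ _ _ Hq).
    + apply (Ck_smooth _ _ 1 Hf _ _ _ Hq).
    + apply (Ck_smooth _ _ 1 Hx _ _ _ Hq).
    + apply (Ck_smooth _ _ 1 Ht _ _ _ Hq).
  - apply continuity_2d_pt_filterlim.
    refine (continuous_cont3_comp (dt (dx f)) (fun p : R * R => fst p) (fun p => snd p)
      (fun _ => u) (t, x) _ _ _ _).
    apply continuous_fst. apply continuous_snd. apply continuous_const.
    destruct (smooth_partials _ _ Hx) as (K & _). apply (K 0%nat _ _ _ Hp).
  - apply continuity_2d_pt_filterlim.
    refine (continuous_cont3_comp (dx (dt f)) (fun p : R * R => fst p) (fun p => snd p)
      (fun _ => u) (t, x) _ _ _ _).
    apply continuous_fst. apply continuous_snd. apply continuous_const.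
    destruct (smooth_partials _ _ Ht) as (_ & K & _). apply (K 0%nat _ _ _ Hp).
Qed.

Lemma dxdu_comm (D : R * R * R -> Prop) (f : R -> R -> R -> R) :
  open D -> smooth D f -> forall t x u, D (t, x, u) -> dx (du f) t x u = du (dx f) t x u.
Proof.
  intros HD Hf t x u Hp.
  destruct (smooth_partials _ _ Hf) as (Ht & Hx & Hu).
  destruct (proj1 (open_cubeP D) HD t x u Hp) as (d & Hd & H).
  apply (schwarz_2d (fun y v => f t y v) x u d Hd).
  - intros s y Hs Hy.
    assert (Hq : D (t, s, y)).
    { apply H. destruct (cube_center t x u d Hd) as (H1 & _ & _). repeat split; assumption. }
    split; [|split; [|split]].
    + apply (Ck_smooth _ _ 1 Hf _ _ _ Hq).
    + apply (Ck_smooth _ _ 1 Hf _ _ _ Hq).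
    + apply (Ck_smooth _ _ 1 Hu _ _ _ Hq).
    + apply (Ck_smooth _ _ 1 Hx _ _ _ Hq).
  - apply continuity_2d_pt_filterlim.
    refine (continuous_cont3_comp (dx (du f)) (fun _ : R * R => t) (fun p => fst p)
      (fun p => snd p) (x, u) _ _ _ _).
    apply continuous_const. apply continuous_fst. apply continuous_snd.
    destruct (smooth_partials _ _ Hu) as (_ & K & _). apply (K 0%nat _ _ _ Hp).
  - apply continuity_2d_pt_filterlim.
    refine (continuous_cont3_comp (du (dx f)) (fun _ : R * R => t) (fun p => fst p)
      (fun p => snd p) (x, u) _ _ _ _).
    apply continuous_const. apply continuous_fst. apply continuous_snd.
    destruct (smooth_partials _ _ Hx) as (_ & _ & K). apply (K 0%nat _ _ _ Hp).
Qed.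

(** * Hodograph transformation *)

Lemma cont3_pos_cube (D : R * R * R -> Prop) (g : R -> R -> R -> R) (t x u : R) :
  open D -> D (t, x, u) -> cont3 g t x u -> 0 < g t x u ->
  exists d, 0 < d /\ forall t' x' u', cube t x u d (t', x', u') ->
    D (t', x', u') /\ 0 < g t' x' u'.
Proof.
  intros HD Hp Hg Hpos.
  destruct (proj1 (open_cubeP D) HD t x u Hp) as (d1 & Hd1 & H1).
  destruct (proj1 (cont3_eps _ _ _ _) Hg _ Hpos) as (d2 & Hd2 & H2).
  exists (Rmin d1 d2). split. apply Rmin_glb_lt; assumption.
  intros t' x' u' Hc. split.
  - apply H1. eapply cube_mono; [|exact Hc]. apply Rmin_l.
  - assert (H := H2 t' x' u' (cube_mono _ _ _ _ _ _ (Rmin_r _ _) Hc)).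
    apply Rabs_def2 in H. lra.
Qed.

Lemma deriv_pos_increasing (g : R -> R) (a b : R) :
  a < b -> (forall z, a <= z <= b -> ex_derive g z /\ 0 < Derive g z) -> g a < g b.
Proof.
  intros Hab H. destruct (MVT_gen g a b (Derive g)) as (c & Hc & E).
  - intros z Hz. rewrite Rmin_left, Rmax_right in Hz by lra. apply Derive_correct, H. lra.
  - intros z Hz. rewrite Rmin_left, Rmax_right in Hz by lra.
    apply continuity_pt_filterlim, (ex_derive_continuous g), H, Hz.
  - rewrite Rmin_left, Rmax_right in Hc by lra.
    destruct (H c Hc) as (_ & Hpos). assert (0 < Derive g c * (b - a)).
    apply Rmult_lt_0_compat; lra. lra.
Qed.

Lemma IVT_derivable (g : R -> R) (a b y : R) :
  a < b -> (forall z, a <= z <= b -> ex_derive g z) -> g a < y < g b ->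
  exists z, a < z < b /\ g z = y.
Proof.
  intros Hab H Hy.
  destruct (IVT_interv (fun z => g z - y) a b) as (z & Hz & E); try lra.
  - intros z Hz. apply continuity_pt_minus.
    apply continuity_pt_filterlim, (ex_derive_continuous g), H, Hz.
    apply continuity_pt_const. intros ? ?; reflexivity.
  - exists z. split; [|lra]. destruct Hz as [[Hz|Hz] [Hz'|Hz']]; subst; lra.
Qed.

(** Reflecting [u] changes the sign of w_k, so the continuity of [Phi] need only be proved for an
    increasing family. *)
Lemma hodograph_neg (D W : R * R * R -> Prop) (Phi w : R -> R -> R -> R) :
  hodograph D W Phi w ->
  hodograph (fun p => D (fst (fst p), snd (fst p), - snd p)) W
    (fun t x u => Phi t x (- u)) (fun t x k => - w t x k).
Proof.
  intros H t x u k; simpl. split.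
  - intros Hp. apply H in Hp. destruct Hp as [Hp E]. split; trivial. lra.
  - intros [Hp E]. apply (H t x (- u) k). split; trivial. lra.
Qed.

(** Since [w] increases in [k], the strict inequalities w(t,x,k-e) < u < w(t,x,k+e) hold at the base
    point and persist nearby. The intermediate value theorem then gives a parameter within [e] of
    [k] that is sent to the nearby value of [u], and the bijection identifies it with [Phi]. *)
Lemma hodograph_cont_pos (D W : R * R * R -> Prop) (w Phi : R -> R -> R -> R) (t x u : R) :
  open W -> smooth W w -> hodograph D W Phi w -> D (t, x, u) ->
  0 < du w t x (Phi t x u) ->
  forall eps, 0 < eps -> exists d, 0 < d /\
    forall t' x' u', cube t x u d (t', x', u') -> Rabs (Phi t' x' u' - Phi t x u) < eps.
Proof.
  intros HW Hw Hh Hp Hpos eps He. set (k := Phi t x u) in *.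
  destruct (proj1 (Hh t x u k) (conj Hp eq_refl)) as [Wk Ek].
  destruct (cont3_pos_cube W (du w) t x k HW Wk) as (d & Hd & H); trivial.
  { destruct (smooth_partials _ _ Hw) as (_ & _ & Hu). apply (Hu 0%nat _ _ _ Wk). }
  set (e := Rmin (d / 2) (eps / 2)).
  assert (Le : 0 < e /\ e < d /\ e < eps).
  { unfold e. pose proof (Rmin_l (d / 2) (eps / 2)). pose proof (Rmin_r (d / 2) (eps / 2)).
    assert (0 < Rmin (d / 2) (eps / 2)) by (apply Rmin_glb_lt; lra). lra. }
  assert (I : forall t' x' z, Rabs (t' - t) < d -> Rabs (x' - x) < d -> k - e <= z <= k + e ->
     W (t', x', z) /\ 0 < du w t' x' z).
  { intros t' x' z Ht Hx Hz. apply H. repeat split; simpl; trivial.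
    apply Rabs_def1; lra. }
  destruct (cube_center t x u d Hd) as (C1 & C2 & _); simpl in C1, C2.
  assert (Dw : forall t' x' z, Rabs (t' - t) < d -> Rabs (x' - x) < d -> k - e <= z <= k + e ->
     ex_derive (fun v => w t' x' v) z).
  { intros t' x' z Ht Hx Hz. apply (Ck_smooth _ _ 1 Hw). apply (I t' x' z Ht Hx Hz). }
  assert (M1 : w t x (k - e) < u).
  { rewrite Ek. apply (deriv_pos_increasing (fun v => w t x v)); [lra|].
    intros z Hz. split. apply Dw; trivial; lra. apply (I t x z); trivial; lra. }
  assert (M2 : u < w t x (k + e)).
  { rewrite Ek at 1. apply (deriv_pos_increasing (fun v => w t x v)); [lra|].
    intros z Hz. split. apply Dw; trivial; lra. apply (I t x z); trivial; lra. }
  assert (Wm : W (t, x, k - e)) by (apply (I t x (k - e)); trivial; lra).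
  assert (Wp : W (t, x, k + e)) by (apply (I t x (k + e)); trivial; lra).
  (* Half the smaller gap: [u] and either endpoint value of [w] may each move by less than [g]
     without changing order. *)
  set (g := Rmin ((u - w t x (k - e)) / 2) ((w t x (k + e) - u) / 2)).
  assert (Lg : 0 < g /\ w t x (k - e) + g <= u - g /\ u + g <= w t x (k + e) - g).
  { unfold g. pose proof (Rmin_l ((u - w t x (k - e)) / 2) ((w t x (k + e) - u) / 2)).
    pose proof (Rmin_r ((u - w t x (k - e)) / 2) ((w t x (k + e) - u) / 2)).
    split; [apply Rmin_glb_lt; lra|lra]. }
  destruct (proj1 (cont3_eps _ _ _ _) (proj1 (Hw 0%nat _ _ _ Wm)) g)
    as (dm & Hdm & Cm). lra.
  destruct (proj1 (cont3_eps _ _ _ _) (proj1 (Hw 0%nat _ _ _ Wp)) g) as (dp & Hdp & Cp). lra.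
  exists (Rmin (Rmin d g) (Rmin dm dp)). split. { repeat apply Rmin_glb_lt; lra. }
  intros t' x' u' (T & X & U); simpl in T, X, U.
  apply Rmin_Rgt in T as (T1 & T2). apply Rmin_Rgt in T1 as (T1 & _).
  apply Rmin_Rgt in T2 as (T2 & T3).
  apply Rmin_Rgt in X as (X1 & X2). apply Rmin_Rgt in X1 as (X1 & _).
  apply Rmin_Rgt in X2 as (X2 & X3).
  apply Rmin_Rgt in U as (U1 & _). apply Rmin_Rgt in U1 as (_ & U1).
  assert (Bm := Cm t' x' (k - e)). assert (Bp := Cp t' x' (k + e)).
  lapply Bm; [clear Bm; intros Bm|].
  2:{ repeat split; simpl; trivial. replace (k - e - (k - e)) with 0 by ring.
      rewrite Rabs_R0; trivial. }
  lapply Bp; [clear Bp; intros Bp|].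
  2:{ repeat split; simpl; trivial. replace (k + e - (k + e)) with 0 by ring.
      rewrite Rabs_R0; trivial. }
  apply Rabs_def2 in Bm. apply Rabs_def2 in Bp. apply Rabs_def2 in U1.
  destruct (IVT_derivable (fun v => w t' x' v) (k - e) (k + e) u') as (z & Hz & Ez).
  - lra.
  - intros z Hz. apply Dw; trivial.
  - lra.
  (* The parameter found lies in [W], so the bijection places the nearby point in [D] and shows that
     [Phi] takes the value [z] there. *)
  - destruct (proj2 (Hh t' x' u' z)) as [_ Ephi].
    { split; [|congruence]. apply I; trivial; lra. }
    rewrite <- Ephi. apply Rabs_def1; lra.
Qed.

Lemma hodograph_cont (D W : R * R * R -> Prop) (w Phi : R -> R -> R -> R) (t x u : R) :
  open W -> smooth W w -> hodograph D W Phi w -> D (t, x, u) ->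
  du w t x (Phi t x u) <> 0 -> cont3 Phi t x u.
Proof.
  intros HW Hw Hh Hp Hn. apply cont3_eps. intros eps He.
  destruct (Rdichotomy _ _ Hn) as [Hneg|Hpos].
  - destruct (hodograph_cont_pos (fun p => D (fst (fst p), snd (fst p), - snd p)) W (fun t x k => - w t x k) (fun t x u => Phi t x (- u))
      t x (- u) HW) with (eps := eps) as (d & Hd & B); trivial.
    + apply smooth_Ck. intros n. apply Ck_opp; trivial. apply Ck_smooth, Hw.
    + apply hodograph_neg, Hh.
    + simpl. rewrite Ropp_involutive. exact Hp.
    + rewrite Ropp_involutive. unfold du. rewrite Derive_opp.
      change (0 < - du w t x (Phi t x u)). lra.
    + exists d. split; trivial. intros t' x' u' (T & X & U); simpl in *.
      specialize (B t' x' (- u')). rewrite !Ropp_involutive in B. apply B.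
      repeat split; simpl; trivial.
      replace (- u' - - u) with (- (u' - u)) by ring. rewrite Rabs_Ropp. exact U.
  - apply (hodograph_cont_pos D W w Phi t x u); trivial.
Qed.

(** One implicit differentiation serves all three partial derivatives of [Phi]: the point moves with
    velocity [(al, be)] in the [(t, x)] plane while the prescribed value moves with rate [mu]. A
    crude linear bound on the increment of [kap] comes first; fed back into the error term, it gives
    the derivative. *)
Lemma implicit_derive (W : R * R * R -> Prop) (w : R -> R -> R -> R) (kap : R -> R)
  (t x u k s al be mu : R) :
  open W -> smooth W w -> W (t, x, k) -> du w t x k <> 0 ->
  Rabs al <= 1 -> Rabs be <= 1 ->
  kap s = k -> w t x k = u -> continuous kap s ->
  locally s (fun r => w (t + al * (r - s)) (x + be * (r - s)) (kap r) = u + mu * (r - s)) ->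
  is_derive kap s ((mu - dt w t x k * al - dx w t x k * be) / du w t x k).
Proof.
  intros HW Hw Hp Hn Hal Hbe Ek Eu Hc [dl Hl].
  set (l := du w t x k) in *. set (N := mu - dt w t x k * al - dx w t x k * be).
  assert (Pl : 0 < Rabs l) by (apply Rabs_pos_lt, Hn).
  (* With error at most |l|/2 the expansion reads |l||q| <= |N||h| + (|l|/2)(2|h| + |q|); absorbing
     the |q| term on the left gives |q| <= K|h|. *)
  set (K := 2 * (Rabs N + Rabs l) / Rabs l).
  assert (HK : 0 <= K).
  { unfold K. apply Rdiv_le_0_compat; trivial. pose proof (Rabs_pos N). lra. }
  apply is_derive_eps. intros eps He.
  (* The first entry permits the absorption that yields [K]; the second makes the final error e(2 +
     K)|h| at most eps|l||h|. *)
  set (e := Rmin (Rabs l / 2) (eps * Rabs l / (2 + K))).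
  assert (He' : 0 < e).
  { apply Rmin_glb_lt. lra. apply Rdiv_lt_0_compat; [|lra]. apply Rmult_lt_0_compat; lra. }
  assert (E1 : e <= Rabs l / 2) by apply Rmin_l.
  assert (E2 : e * (2 + K) <= eps * Rabs l).
  { apply Rle_trans with (eps * Rabs l / (2 + K) * (2 + K)).
    apply Rmult_le_compat_r; [lra|apply Rmin_r]. right; field; lra. }
  destruct (strict_diff W w t x k HW (Ck_smooth _ _ 1 Hw) Hp e He') as (d & Hd & _ & B).
  destruct (proj1 (continuous_eps _ _) Hc d Hd) as (d' & Hd' & C).
  exists (Rmin dl (Rmin d d')). split. { repeat apply Rmin_glb_lt; trivial. apply cond_pos. }
  intros r Hr. apply Rmin_Rgt in Hr as (R1 & Hr). apply Rmin_Rgt in Hr as (R2 & R3).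
  specialize (C r R3). specialize (Hl r R1); simpl in Hl. rewrite Ek in C |- *.
  set (h := r - s) in *. set (q := kap r - k) in *.
  specialize (B t x k (t + al * h) (x + be * h) (kap r) (cube_center _ _ _ _ Hd)).
  assert (Ha : Rabs (al * h) <= Rabs h).
  { rewrite Rabs_mult. rewrite <- (Rmult_1_l (Rabs h)) at 2.
    apply Rmult_le_compat_r; trivial. apply Rabs_pos. }
  assert (Hb : Rabs (be * h) <= Rabs h).
  { rewrite Rabs_mult. rewrite <- (Rmult_1_l (Rabs h)) at 2.
    apply Rmult_le_compat_r; trivial. apply Rabs_pos. }
  replace (t + al * h - t) with (al * h) in B by ring.
  replace (x + be * h - x) with (be * h) in B by ring.
  lapply B; [clear B; intros B|].
  2:{ unfold cube; simpl. replace (t + al * h - t) with (al * h) by ring.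
      replace (x + be * h - x) with (be * h) by ring. repeat split; trivial; lra. }
  rewrite Hl, Eu in B. fold q l in B.
  replace (u + mu * h - u - (dt w t x k * (al * h) + dx w t x k * (be * h) + l * q))
    with (N * h - l * q) in B by (unfold N; ring).
  assert (B2 : Rabs (N * h - l * q) <= e * (2 * Rabs h + Rabs q)).
  { eapply Rle_trans; [exact B|]. apply Rmult_le_compat_l; lra. }
  assert (Q : Rabs q <= K * Rabs h).
  { assert (S : Rabs l * Rabs q <= Rabs N * Rabs h + e * (2 * Rabs h + Rabs q)).
    { rewrite <- !Rabs_mult. replace (l * q) with (N * h + - (N * h - l * q)) by ring.
      eapply Rle_trans; [apply Rabs_triang|]. rewrite Rabs_Ropp. lra. }
    assert (S2 : e * (2 * Rabs h + Rabs q) <= Rabs l / 2 * (2 * Rabs h + Rabs q)).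
    { apply Rmult_le_compat_r; trivial.
      pose proof (Rabs_pos h); pose proof (Rabs_pos q); lra. }
    apply Rmult_le_reg_l with (Rabs l / 2); [lra|].
    replace (Rabs l / 2 * (K * Rabs h)) with ((Rabs N + Rabs l) * Rabs h)
      by (unfold K; field; lra). lra. }
  apply Rmult_le_reg_l with (Rabs l); trivial.
  rewrite <- Rabs_mult.
  replace (l * (q - N / l * h)) with (- (N * h - l * q)) by (field; exact Hn).
  rewrite Rabs_Ropp. eapply Rle_trans; [exact B2|].
  apply Rle_trans with (e * (2 + K) * Rabs h).
  - rewrite Rmult_assoc. apply Rmult_le_compat_l; lra.
  - replace (Rabs l * (eps * Rabs h)) with (eps * Rabs l * Rabs h) by ring.
    apply Rmult_le_compat_r; trivial. apply Rabs_pos.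
Qed.

Lemma comp_graph_partials (D W : R * R * R -> Prop) (w g : R -> R -> R -> R) (t x k : R) :
  open D -> smooth W w -> smooth D g -> W (t, x, k) -> D (t, x, w t x k) ->
  is_derive (fun s => g s x (w s x k)) t
    (dt g t x (w t x k) + du g t x (w t x k) * dt w t x k) /\
  is_derive (fun y => g t y (w t y k)) x
    (dx g t x (w t x k) + du g t x (w t x k) * dx w t x k).
Proof.
  intros HD Hw Hg Hp Dp.
  destruct (Ck_partials _ _ _ (Ck_smooth _ _ 1 Hw) t x k Hp) as (P1 & P2 & _).
  split.
  - replace (dt g t x (w t x k) + du g t x (w t x k) * dt w t x k) with
      (dt g t x (w t x k) * 1 + dx g t x (w t x k) * 0 + du g t x (w t x k) * dt w t x k)
      by ring.
    apply (is_derive_comp3 D g (fun s => s) (fun _ => x) (fun s => w s x k)); trivial.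
    apply Ck_smooth, Hg. apply (is_derive_id (K := R_AbsRing)).
    apply (is_derive_const (K := R_AbsRing) (V := R_NormedModule)).
  - replace (dx g t x (w t x k) + du g t x (w t x k) * dx w t x k) with
      (dt g t x (w t x k) * 0 + dx g t x (w t x k) * 1 + du g t x (w t x k) * dx w t x k)
      by ring.
    apply (is_derive_comp3 D g (fun _ => t) (fun s => s) (fun s => w t s k)); trivial.
    apply Ck_smooth, Hg.
    apply (is_derive_const (K := R_AbsRing) (V := R_NormedModule)).
    apply (is_derive_id (K := R_AbsRing)).
Qed.

Section Hodograph.

Context (D W : R * R * R -> Prop) (w Phi : R -> R -> R -> R).
Hypotheses (HW : open W) (HD : open D) (Hw : smooth W w)
  (Hn : forall t x k, W (t, x, k) -> du w t x k <> 0) (Hh : hodograph D W Phi w).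

Lemma hodograph_W (t x u : R) : D (t, x, u) -> W (t, x, Phi t x u) /\ u = w t x (Phi t x u).
Proof. intros Hp. apply (proj1 (Hh t x u _) (conj Hp eq_refl)). Qed.

Lemma hodograph_D (t x k : R) : W (t, x, k) -> D (t, x, w t x k) /\ k = Phi t x (w t x k).
Proof. intros Hp. apply (proj2 (Hh t x _ k) (conj Hp eq_refl)). Qed.

Lemma hodograph_Phi_cont (t x u : R) : D (t, x, u) -> cont3 Phi t x u.
Proof.
  intros Hp. apply (hodograph_cont D W w); trivial. apply Hn, hodograph_W, Hp.
Qed.

(** Implicit differentiation of u = w(t,x,Phi). The formulas use products with an inverse so that
    the closure lemmas for [Ck] apply to them verbatim. *)
Lemma hodograph_partials (t x u : R) : D (t, x, u) ->
  is_derive (fun s => Phi s x u) t (- dt w t x (Phi t x u) * / du w t x (Phi t x u)) /\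
  is_derive (fun y => Phi t y u) x (- dx w t x (Phi t x u) * / du w t x (Phi t x u)) /\
  is_derive (fun v => Phi t x v) u (/ du w t x (Phi t x u)).
Proof.
  intros Hp. destruct (hodograph_W t x u Hp) as (Wp & Ep).
  pose proof (hodograph_Phi_cont t x u Hp) as Hc.
  pose proof (Hn _ _ _ Wp) as Hnp.
  assert (shift0 : forall a b : R, a + 0 * b = a) by (intros; ring).
  assert (shift1 : forall a b : R, a + 1 * (b - a) = b) by (intros; ring).
  split; [|split].
  - replace (- dt w t x (Phi t x u) * / du w t x (Phi t x u)) with
      ((0 - dt w t x (Phi t x u) * 1 - dx w t x (Phi t x u) * 0) / du w t x (Phi t x u))
      by (field; trivial).
    apply (implicit_derive W w (fun s => Phi s x u) t x u (Phi t x u)); trivial.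
    + rewrite Rabs_R1; lra.
    + rewrite Rabs_R0; lra.
    + symmetry; exact Ep.
    + refine (continuous_cont3_comp Phi (fun s => s) (fun _ => x) (fun _ => u) t _ _ _ Hc).
      apply continuous_id. apply continuous_const. apply continuous_const.
    + generalize (open_slice_t D t x u HD Hp). apply filter_imp. intros r Hr.
      rewrite ?shift0, ?shift1. symmetry. apply hodograph_W, Hr.
  - replace (- dx w t x (Phi t x u) * / du w t x (Phi t x u)) with
      ((0 - dt w t x (Phi t x u) * 0 - dx w t x (Phi t x u) * 1) / du w t x (Phi t x u))
      by (field; trivial).
    apply (implicit_derive W w (fun s => Phi t s u) t x u (Phi t x u)); trivial.
    + rewrite Rabs_R0; lra.
    + rewrite Rabs_R1; lra.
    + symmetry; exact Ep.
    + refine (continuous_cont3_comp Phi (fun s => t) (fun s => s) (fun _ => u) x _ _ _ Hc).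
      apply continuous_const. apply continuous_id. apply continuous_const.
    + generalize (open_slice_x D t x u HD Hp). apply filter_imp. intros r Hr.
      rewrite ?shift0, ?shift1. symmetry. apply hodograph_W, Hr.
  - replace (/ du w t x (Phi t x u)) with
      ((1 - dt w t x (Phi t x u) * 0 - dx w t x (Phi t x u) * 0) / du w t x (Phi t x u))
      by (field; trivial).
    apply (implicit_derive W w (fun s => Phi t x s) t x u (Phi t x u)); trivial.
    + rewrite Rabs_R0; lra.
    + rewrite Rabs_R0; lra.
    + symmetry; exact Ep.
    + refine (continuous_cont3_comp Phi (fun s => t) (fun s => x) (fun s => s) u _ _ _ Hc).
      apply continuous_const. apply continuous_const. apply continuous_id.
    + generalize (open_slice_u D t x u HD Hp). apply filter_imp. intros r Hr.
      rewrite ?shift0, ?shift1. symmetry. apply hodograph_W, Hr.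
Qed.

(** The partial derivatives of [Phi] are smooth functions evaluated at [(t, x, Phi)], so they have
    whatever class [Phi] has, and [Phi] gains one order. *)
Lemma hodograph_smooth : smooth D Phi.
Proof.
  apply smooth_Ck. intros n.
  destruct (smooth_partials _ _ Hw) as (Wt & Wx & Wu).
  induction n.
  - intros t x u Hp. split; trivial. apply hodograph_Phi_cont, Hp.
  - assert (Hcomp : forall g, smooth W g -> Ck n D (fun t x u => g t x (Phi t x u))).
    { intros g Hg. apply (Ck_comp n D W g (fun t _ _ => t) (fun _ x _ => x) Phi); trivial.
      apply Ck_smooth, Hg. apply Ck_t, HD. apply Ck_x, HD.
      intros; apply hodograph_W; trivial. }
    assert (Hinv : Ck n D (fun t x u => / du w t x (Phi t x u))).
    { apply (Ck_inv n D (fun t x u => du w t x (Phi t x u))); trivial. apply Hcomp, Wu.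
      intros; apply Hn, hodograph_W; trivial. }
    eapply (Ck_S_intro n D Phi); trivial.
    + intros t x u Hp. split. apply hodograph_Phi_cont, Hp. apply hodograph_partials, Hp.
    + exact (Ck_mult n D _ _ HD (Ck_opp n D _ HD (Hcomp _ Wt)) Hinv).
    + exact (Ck_mult n D _ _ HD (Ck_opp n D _ HD (Hcomp _ Wx)) Hinv).
    + exact Hinv.
Qed.

Lemma hodograph_du (t x u : R) : D (t, x, u) -> du Phi t x u = / du w t x (Phi t x u).
Proof. intros Hp. apply is_derive_unique, hodograph_partials, Hp. Qed.

Lemma hodograph_du_neq0 (t x u : R) : D (t, x, u) -> du Phi t x u <> 0.
Proof.
  intros Hp. rewrite hodograph_du; trivial. apply Rinv_neq_0_compat, Hn, hodograph_W, Hp.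
Qed.

Lemma hodograph_subst (t x u : R) : D (t, x, u) ->
  nonlocal_subst Phi t x u = dx w t x (Phi t x u).
Proof.
  intros Hp. unfold nonlocal_subst. rewrite hodograph_du by trivial.
  replace (dx Phi t x u) with (- dx w t x (Phi t x u) * / du w t x (Phi t x u)).
  - field. apply Hn, hodograph_W, Hp.
  - symmetry. apply is_derive_unique, hodograph_partials, Hp.
Qed.

Lemma hodograph_subst_smooth : smooth D (nonlocal_subst Phi).
Proof.
  destruct (smooth_partials _ _ hodograph_smooth) as (_ & Px & Pu).
  apply smooth_Ck. intros n. unfold nonlocal_subst, Rdiv.
  apply Ck_mult; trivial.
  - apply Ck_opp; trivial. apply Ck_smooth, Px.
  - apply Ck_inv; trivial. apply Ck_smooth, Pu. apply hodograph_du_neq0.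
Qed.

Lemma hodograph_nonlinear (Omega : R * R -> Prop) (A B C : R -> R -> R) :
  (forall t x, Omega (t, x) -> ex_derive (A t) x /\ ex_derive (B t) x /\ ex_derive (C t) x) ->
  lies_over Omega W ->
  (forall t x k : R, W (t, x, k) -> Lop A B C (fun s y => w s y k) t x = 0) ->
  nonlinear_solution A B C D (nonlocal_subst Phi).
Proof.
  intros HABC HO HL. split. apply hodograph_subst_smooth.
  set (eta := nonlocal_subst Phi).
  pose proof hodograph_subst_smooth as He. fold eta in He.
  destruct (smooth_partials _ _ He) as (Et & Ex & Eu).
  destruct (smooth_partials _ _ Hw) as (Wt & Wx & Wu).
  destruct (smooth_partials _ _ Wx) as (Wxt & Wxx & _).
  (* The substitution read on the graph of [w]: the slope w_x depends on [k] only through the value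
     of [w]. *)
  assert (F : forall t x k, W (t, x, k) -> dx w t x k = eta t x (w t x k)).
  { intros t x k Hp. destruct (hodograph_D t x k Hp) as (Dp & Ek).
    unfold eta. rewrite hodograph_subst, <- Ek; trivial. }
  assert (Fx : forall t x k, W (t, x, k) ->
    dx (dx w) t x k = dx eta t x (w t x k) + du eta t x (w t x k) * eta t x (w t x k)).
  { intros t x k Hp. rewrite <- (F t x k Hp).
    rewrite (dx_ext W _ (fun t x k => eta t x (w t x k)) HW F t x k Hp).
    apply is_derive_unique, (comp_graph_partials D W w eta t x k HD Hw He Hp (proj1 (hodograph_D t x k Hp))). }
  assert (Ft : forall t x k, W (t, x, k) ->
    dx (dt w) t x k = dt eta t x (w t x k) + du eta t x (w t x k) * dt w t x k).
  { intros t x k Hp. rewrite <- (dtdx_comm W w HW Hw t x k Hp).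
    rewrite (dt_ext W _ (fun t x k => eta t x (w t x k)) HW F t x k Hp).
    apply is_derive_unique, (comp_graph_partials D W w eta t x k HD Hw He Hp (proj1 (hodograph_D t x k Hp))). }
  intros t x u Hp. destruct (hodograph_W t x u Hp) as (Wp & Ep).
  (* From here the parameter is frozen: [x] varies along one curve of the family, and the dependence
     of [Phi] on [x] must not be differentiated. *)
  set (k := Phi t x u) in *. clearbody k.
  assert (Dp : D (t, x, w t x k)) by (rewrite <- Ep; exact Hp).
  assert (Fxx : is_derive (fun y => dx (dx w) t y k) x
     (dx (dx eta) t x u + du (dx eta) t x u * eta t x u
      + ((dx (du eta) t x u + du (du eta) t x u * eta t x u) * eta t x u
      + du eta t x u * (dx eta t x u + du eta t x u * eta t x u)))).
  { apply (is_derive_ext_loc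
      (fun y => dx eta t y (w t y k) + du eta t y (w t y k) * eta t y (w t y k))).
    { generalize (open_slice_x W t x k HW Wp). apply filter_imp. intros; symmetry; apply Fx; trivial. }
    destruct (comp_graph_partials D W w _ t x k HD Hw Ex Wp Dp) as (_ & a1).
    destruct (comp_graph_partials D W w _ t x k HD Hw Eu Wp Dp) as (_ & a2).
    destruct (comp_graph_partials D W w _ t x k HD Hw He Wp Dp) as (_ & a3).
    rewrite (F t x k Wp), <- Ep in a1, a2, a3.
    pose proof (is_derive_plus _ _ _ _ _ a1 (is_derive_mult _ _ _ _ _ a2 a3 Rmult_comm)) as a4.
    cbv beta in a4. rewrite <- Ep in a4. exact a4. }
  destruct (HABC t x (HO _ _ _ Wp)) as (HA & HB & HC).
  (* The left side of L w = 0 vanishes on a whole interval in [x], so its [x]-derivative is 0; [L2]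
     computes the same derivative by the product rule, with w_xxx supplied by [Fxx]. *)
  assert (L0 : is_derive (fun y => dt w t y k
     - (A t y * dx (dx w) t y k + B t y * dx w t y k + C t y * w t y k)) x 0).
  { apply (is_derive_ext_loc (fun _ => 0)).
    - generalize (open_slice_x W t x k HW Wp). apply filter_imp. intros y Hy.
      pose proof (HL t y k Hy) as E. unfold Lop in E. 
      change (dt w t y k - A t y * dx (dx w) t y k - B t y * dx w t y k - C t y * w t y k = 0) in E.
      lra.
    - apply (is_derive_const (K := R_AbsRing) (V := R_NormedModule)). }
  assert (L1 := HL t x k Wp). unfold Lop in L1.
  change (dt w t x k - A t x * dx (dx w) t x k - B t x * dx w t x k - C t x * w t x k = 0) in L1.
  destruct (Ck_partials _ _ _ (Ck_smooth _ _ 1 Hw) t x k Wp) as (_ & q0 & _).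
  destruct (Ck_partials _ _ _ (Ck_smooth _ _ 1 Wt) t x k Wp) as (_ & q1 & _).
  destruct (Ck_partials _ _ _ (Ck_smooth _ _ 1 Wx) t x k Wp) as (_ & q2 & _).
  pose proof (Derive_correct _ _ HA) as dA. pose proof (Derive_correct _ _ HB) as dB.
  pose proof (Derive_correct _ _ HC) as dC.
  pose proof (is_derive_minus _ _ _ _ _ q1 (is_derive_plus _ _ _ _ _ (is_derive_plus _ _ _ _ _
    (is_derive_mult _ _ _ _ _ dA Fxx Rmult_comm) (is_derive_mult _ _ _ _ _ dB q2 Rmult_comm))
    (is_derive_mult _ _ _ _ _ dC q0 Rmult_comm))) as L2.
  apply is_derive_unique in L0. apply is_derive_unique in L2. cbv beta in L2.
  assert (E := eq_trans (eq_sym L2) L0). clear L0 L2.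
  unfold minus, plus, opp, mult, scal in E; simpl in E.
  rewrite (Ft t x k Wp), (Fx t x k Wp), (F t x k Wp), <- Ep in E.
  rewrite (Fx t x k Wp), (F t x k Wp), <- Ep in L1.
  rewrite (dxdu_comm D eta HD He t x u Hp) in E.
  assert (EB : dx (fun s y v => B s y * eta s y v) t x u
     = d2 B t x * eta t x u + B t x * dx eta t x u).
  { apply is_derive_unique.
    destruct (Ck_partials _ _ _ (Ck_smooth _ _ 1 He) t x u Hp) as (_ & b & _).
    exact (is_derive_mult _ _ _ _ _ dB b Rmult_comm). }
  rewrite EB. fold (d2 A t x) (d2 B t x) (d2 C t x) in E.
  (* After [Ft], w_t still occurs with the factor eta_u; the undifferentiated linear equation
     eliminates it and leaves a relation in [eta] alone. *)
  replace (dt w t x k) with (A t x * (dx eta t x u + du eta t x u * eta t x u)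
     + B t x * eta t x u + C t x * u) in E by lra.
  change (Derive (A t) x) with (d2 A t x) in E.
  change (Derive (B t) x) with (d2 B t x) in E.
  change (Derive (C t) x) with (d2 C t x) in E.
  lra.
Qed.

End Hodograph.

(** * Double power series *)

(* [ring] does not see through the carriers of Coquelicot's algebraic structures. *)
Ltac ringR := match goal with |- ?p = ?q => change (@eq R p q) end; ring.

Lemma sum_n_S_first (g : nat -> R) (n : nat) :
  sum_n g (S n) = g 0%nat + sum_n (fun i => g (S i)) n.
Proof.
  induction n.
  - rewrite sum_Sn, !sum_O. reflexivity.
  - rewrite sum_Sn, IHn, (sum_Sn (fun i => g (S i))). unfold plus; simpl. ring.
Qed.

Lemma sum_n_Rabs_le (u v : nat -> R) (n : nat) :
  (forall i, (i <= n)%nat -> Rabs (u i) <= v i) -> Rabs (sum_n u n) <= sum_n v n.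
Proof.
  induction n; intros H.
  - rewrite !sum_O. apply H. lia.
  - rewrite !sum_Sn. eapply Rle_trans; [apply Rabs_triang|].
    apply Rplus_le_compat; [apply IHn; intros; apply H; lia|apply H; lia].
Qed.

Lemma sum_n_flip (u : nat -> R) (n : nat) :
  sum_n (fun i => u (n - i)%nat) n = sum_n u n.
Proof.
  induction n.
  - rewrite !sum_O. reflexivity.
  - rewrite sum_n_S_first, sum_Sn. rewrite <- IHn. unfold plus; simpl. ring.
Qed.

(** Exchanging the variables reverses the order of the terms inside each homogeneous degree. What is
    proved for differentiation in [t] thereby transfers to [x]. *)
Lemma analytic_at_swap (f : R -> R -> R) (t0 x0 : R) :
  analytic_at f t0 x0 -> analytic_at (fun x t => f t x) x0 t0.
Proof.
  intros (a & r & Hr & H). exists (fun i j => a j i), r. split; trivial.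
  intros x t Hx Ht term. destruct (H t x Ht Hx) as (H1 & H2).
  assert (E : forall n (F : R -> R),
    sum_n (fun i => F (a i (n - i)%nat * (t - t0) ^ i * (x - x0) ^ (n - i))) n
    = sum_n (fun i => F (term i (n - i)%nat)) n).
  { intros n F. rewrite <- sum_n_flip. apply sum_n_ext_loc. intros i Hi.
    unfold term. replace (n - (n - i))%nat with i by lia. f_equal. ring. }
  split.
  - refine (ex_series_ext _ _ _ H1). intros n. apply (E n Rabs).
  - refine (is_series_ext _ _ _ _ H2). intros n. apply (E n (fun z => z)).
Qed.

Lemma INR_le_pow4 (n : nat) : INR n <= 4 ^ n.
Proof.
  induction n. simpl; lra. rewrite S_INR. simpl.
  pose proof (pow_R1_Rle 4 n). lra.
Qed.

(** The second-order Taylor remainder of a power, with the polynomial growth in the exponent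
    weakened to 4^i. In this form the remainder is dominated by a geometric term at radius 4 rho,
    where the series still converges absolutely. *)
Lemma pow_remainder_bound (T h rho : R) (i : nat) :
  0 < rho -> Rabs T <= rho -> Rabs (T + h) <= rho ->
  Rabs ((T + h) ^ i - T ^ i - h * (INR i * T ^ pred i)) * rho ^ 2 <= h ^ 2 * (4 * rho) ^ i.
Proof.
  intros Hr HT Hh. induction i.
  - simpl. replace (1 - 1 - h * (0 * 1)) with 0 by ring. rewrite Rabs_R0.
    pose proof (pow2_ge_0 h). simpl in H. lra.
  - set (e := (T + h) ^ i - T ^ i - h * (INR i * T ^ pred i)) in *.
    replace ((T + h) ^ S i - T ^ S i - h * (INR (S i) * T ^ pred (S i)))
      (* Recursion for the remainder: multiplying by T + h creates the one new second-order term h^2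
         i T^(i-1). *)
      with ((T + h) * e + h ^ 2 * (INR i * T ^ pred i)).
    2:{ unfold e. rewrite S_INR. destruct i; simpl; ring. }
    assert (P : 0 < rho ^ i) by (apply pow_lt; trivial).
    assert (H2 : 0 <= h ^ 2) by apply pow2_ge_0.
    assert (E1 : INR i * Rabs (T ^ pred i) * rho ^ 2 <= 4 ^ i * (rho * rho ^ i)).
    { apply Rle_trans with (INR i * (rho * rho ^ i)).
      - destruct i. simpl; lra.
        rewrite Rmult_assoc. apply Rmult_le_compat_l. apply pos_INR. simpl pred.
        replace (rho * rho ^ S i) with (rho ^ i * rho ^ 2) by (simpl; ring).
        apply Rmult_le_compat_r. apply pow2_ge_0. rewrite <- RPow_abs.
        apply pow_incr. split; trivial. apply Rabs_pos.
      - apply Rmult_le_compat_r. apply Rmult_le_pos; lra. apply INR_le_pow4. }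
    apply Rle_trans with (Rabs (T + h) * (Rabs e * rho ^ 2)
      + h ^ 2 * (INR i * Rabs (T ^ pred i) * rho ^ 2)).
    { replace (Rabs (T + h) * (Rabs e * rho ^ 2) + h ^ 2 * (INR i * Rabs (T ^ pred i) * rho ^ 2))
        with ((Rabs ((T + h) * e) + Rabs (h ^ 2 * (INR i * T ^ pred i))) * rho ^ 2).
      apply Rmult_le_compat_r. apply pow2_ge_0. apply Rabs_triang.
      rewrite !Rabs_mult. rewrite (Rabs_pos_eq (h ^ 2)), (Rabs_pos_eq (INR i)); trivial.
      ring. apply pos_INR. }
    apply Rle_trans with (rho * (h ^ 2 * (4 * rho) ^ i) + h ^ 2 * (4 ^ i * (rho * rho ^ i))).
    + apply Rplus_le_compat.
      * apply Rmult_le_compat; trivial. apply Rabs_pos.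
        apply Rmult_le_pos. apply Rabs_pos. apply pow2_ge_0.
      * apply Rmult_le_compat_l; trivial.
    + simpl (_ ^ S i). rewrite Rpow_mult_distr.
      assert (0 <= h ^ 2 * (rho * (4 ^ i * rho ^ i))).
      { apply Rmult_le_pos; trivial. apply Rmult_le_pos. lra. apply Rmult_le_pos; try lra.
        apply pow_le; lra. }
      lra.
Qed.

Section DoubleSeries.

Context (f : R -> R -> R) (t0 x0 : R) (a : nat -> nat -> R) (r : R).

Definition hterm (a : nat -> nat -> R) (T X : R) (n : nat) : R :=
  sum_n (fun i => a i (n - i)%nat * T ^ i * X ^ (n - i)) n.

Hypotheses (Hr : 0 < r)
  (Habs : forall t x : R, Rabs (t - t0) < r -> Rabs (x - x0) < r ->
     ex_series (fun n => sum_n (fun i => Rabs (a i (n - i)%nat * (t - t0) ^ i * (x - x0) ^ (n - i))) n))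
  (Hsum : forall t x : R, Rabs (t - t0) < r -> Rabs (x - x0) < r ->
     is_series (hterm a (t - t0) (x - x0)) (f t x)).

(** Absolute convergence at the corner where both increments equal [rad] gives the numerical
    majorant [b]. The further factor 4 in [rho] absorbs the powers 4^i that come from
    differentiation. *)
Let rad := r / 2.
Let rho := rad / 4.

Let b (n : nat) : R := sum_n (fun i => Rabs (a i (n - i)%nat) * rad ^ i * rad ^ (n - i)) n.

Let rad_pos : 0 < rad. Proof. unfold rad; lra. Qed.
Let rho_pos : 0 < rho. Proof. unfold rho, rad; lra. Qed.

Lemma majorant_ex_series : ex_series b.
Proof.
  refine (ex_series_ext _ _ _ (Habs (t0 + rad) (x0 + rad) _ _)).
  - intros n. apply sum_n_ext. intros i.
    replace (t0 + rad - t0) with rad by ring. replace (x0 + rad - x0) with rad by ring.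
    rewrite !Rabs_mult. f_equal; [f_equal|]; apply Rabs_pos_eq, pow_le; lra.
  - replace (t0 + rad - t0) with rad by ring. rewrite Rabs_pos_eq; unfold rad; lra.
  - replace (x0 + rad - x0) with rad by ring. rewrite Rabs_pos_eq; unfold rad; lra.
Qed.

Lemma series_bound (u : nat -> R) (l K : R) : 0 <= K ->
  is_series u l -> (forall n, Rabs (u n) <= K * b n) -> Rabs l <= K * Series b.
Proof.
  intros HK Hu H. rewrite <- (is_series_unique _ _ Hu).
  rewrite <- Series_scal_l.
  assert (Hb : ex_series (fun n => K * b n)).
  { apply (ex_series_scal_l (K := R_AbsRing) (V := R_NormedModule) K b), majorant_ex_series. }
  eapply Rle_trans. apply Series_Rabs.
  - refine (ex_series_le (fun n => Rabs (u n)) _ _ Hb).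
    intros n. unfold norm; simpl. unfold abs; simpl. rewrite Rabs_Rabsolu. apply H.
  - apply Series_le; trivial. intros n. split. apply Rabs_pos. apply H.
Qed.

(** Every nonconstant monomial with both increments below [m] is at most m/rad times its value at
    [rad], so the function differs from its central value by at most (m/rad) times the sum of [b].
    The centre is the point of interest, since [analytic] provides an expansion around each point of
    the domain. *)
Lemma double_series_cont0 :
  continuous (fun p : R * R => f (fst p) (snd p)) (t0, x0).
Proof.
  unfold continuous. rewrite filterlim_locally. intros eps. simpl.
  assert (Hb0 : 0 <= Series b).
  { eapply Rle_trans; [apply Rabs_pos|].
    rewrite <- (Rmult_1_l (Series b)).
    apply (series_bound b _ 1). lra. apply Series_correct, majorant_ex_series.
    intros n. rewrite Rmult_1_l. rewrite Rabs_pos_eq. lra.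
    unfold b. eapply Rle_trans; [apply Rabs_pos|].
    apply (sum_n_Rabs_le (fun _ => 0)). intros i _. rewrite Rabs_R0.
    repeat apply Rmult_le_pos; try apply Rabs_pos; apply pow_le; lra. }
  (* Chosen so that (m/rad) times the sum of [b] stays below [eps]; the added 1 keeps the
     denominator positive. *)
  set (m := Rmin rad (eps * rad / (2 * (Series b + 1)))).
  assert (Hm : 0 < m).
  { apply Rmin_glb_lt; trivial. apply Rdiv_lt_0_compat; [|lra].
    apply Rmult_lt_0_compat; trivial. apply cond_pos. }
  assert (M1 : m <= rad) by apply Rmin_l.
  assert (M2 : m / rad * Series b < eps).
  { apply Rle_lt_trans with (eps / (2 * (Series b + 1)) * Series b).
    - apply Rmult_le_compat_r; trivial. apply Rmult_le_reg_r with rad; trivial.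
      replace (m / rad * rad) with m by (field; lra).
      replace (eps / (2 * (Series b + 1)) * rad) with (eps * rad / (2 * (Series b + 1)))
        by (field; lra). apply Rmin_r.
    - pose proof (cond_pos eps). apply Rmult_lt_reg_r with (2 * (Series b + 1)). lra.
      replace (eps / (2 * (Series b + 1)) * Series b * (2 * (Series b + 1)))
        with (eps * Series b) by (field; lra).
      replace (eps * (2 * (Series b + 1))) with (eps * Series b + eps * (Series b + 2)) by ring.
      assert (0 < eps * (Series b + 2)) by (apply Rmult_lt_0_compat; lra). lra. }
  exists (mkposreal m Hm). intros [t x] [Ht Hx]; simpl in Ht, Hx |- *.
  change (Rabs (t - t0) < m) in Ht. change (Rabs (x - x0) < m) in Hx.
  change (Rabs (f t x - f t0 x0) < eps).
  assert (S1 : is_series (hterm a (t - t0) (x - x0)) (f t x)).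
  { apply Hsum; unfold rad in M1; lra. }
  assert (S0 : is_series (hterm a (t0 - t0) (x0 - x0)) (f t0 x0)).
  { apply Hsum; rewrite Rminus_diag, Rabs_R0; lra. }
  assert (S2 := is_series_minus _ _ _ _ S1 S0).
  eapply Rle_lt_trans; [|exact M2].
  apply (series_bound _ _ (m / rad)) in S2; trivial.
  { apply Rdiv_le_0_compat; lra. }
  intros n. rewrite !Rminus_diag. unfold hterm, b.
  change (Rabs (sum_n (fun i => a i (n - i)%nat * (t - t0) ^ i * (x - x0) ^ (n - i)) n
    - sum_n (fun i => a i (n - i)%nat * 0 ^ i * 0 ^ (n - i)) n)
    <= m / rad * sum_n (fun i => Rabs (a i (n - i)%nat) * rad ^ i * rad ^ (n - i)) n).
  assert (E0 : sum_n (fun i => a i (n - i)%nat * (t - t0) ^ i * (x - x0) ^ (n - i)) n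
    - sum_n (fun i => a i (n - i)%nat * 0 ^ i * 0 ^ (n - i)) n
    = sum_n (fun i => a i (n - i)%nat * ((t - t0) ^ i * (x - x0) ^ (n - i) - 0 ^ i * 0 ^ (n - i))) n).
  { match goal with |- ?p - ?q = _ => replace (p - q) with (p + (-1) * q) by ring end.
    rewrite <- (sum_n_mult_l (K := R_AbsRing) (-1)).
    match goal with |- ?p + ?q = ?s => change (plus p q = s) end.
    rewrite <- sum_n_plus.
    apply sum_n_ext. intros i. unfold plus, mult; simpl. ring. }
  rewrite E0. rewrite <- (sum_n_mult_l (K := R_AbsRing) (m / rad)).
  apply sum_n_Rabs_le. intros i _. unfold mult; simpl. rewrite Rabs_mult.
  set (j := (n - i)%nat).
  replace (m / rad * (Rabs (a i j) * rad ^ i * rad ^ j))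
    with (Rabs (a i j) * (m / rad * (rad ^ i * rad ^ j))) by ring.
  apply Rmult_le_compat_l. apply Rabs_pos.
  assert (Hpow : forall z k, Rabs z < m -> Rabs (z ^ k) <= rad ^ k).
  { intros z k Hz. rewrite <- RPow_abs. apply pow_incr. split. apply Rabs_pos. lra. }
  assert (HpowS : forall z k, Rabs z < m -> Rabs (z ^ S k) <= m / rad * rad ^ S k).
  { intros z k Hz. simpl. rewrite Rabs_mult.
    replace (m / rad * (rad * rad ^ k)) with (m * rad ^ k) by (field; lra).
    apply Rmult_le_compat; try apply Rabs_pos. lra. apply Hpow, Hz. }
  assert (Hmr : 0 <= m / rad) by (apply Rdiv_le_0_compat; lra).
  assert (Pp : forall k, 0 <= rad ^ k) by (intros; apply pow_le; lra).
  (* As 0^0 = 1, the constant monomial cancels against its value at the centre; every other monomial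
     vanishes there and carries a power from which the factor m/rad is extracted. *)
  destruct i as [|i].
  - destruct j as [|j].
    + simpl. replace (1 * 1 - 1 * 1) with 0 by ring. rewrite Rabs_R0. lra.
    + replace (0 ^ 0 * 0 ^ S j) with 0 by (simpl; ring). rewrite Rminus_0_r.
      simpl (_ ^ 0). rewrite !Rmult_1_l. apply HpowS, Hx.
  - replace (0 ^ S i * 0 ^ j) with 0 by (simpl; ring). rewrite Rminus_0_r.
    rewrite Rabs_mult, <- Rmult_assoc. apply Rmult_le_compat; try apply Rabs_pos.
    apply HpowS, Ht. apply Hpow, Hx.
Qed.

Definition da (i j : nat) : R := INR (S i) * a (S i) j.

(** Differentiation in [t] lowers the degree by one, hence the shifted majorant. The factor i+1 is
    bounded by 4^(i+1), and 4^(i+1) rho^i is rad^(i+1) / rho. *)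
Lemma derived_terms_abs (T X : R) (n : nat) : Rabs T < rho -> Rabs X < rho ->
  sum_n (fun i => Rabs (da i (n - i)%nat * T ^ i * X ^ (n - i))) n <= / rho * b (S n).
Proof.
  intros HT HX. unfold b. rewrite sum_n_S_first.
  assert (P0 : 0 <= Rabs (a 0%nat (S n - 0)%nat) * rad ^ 0 * rad ^ (S n - 0)).
  { assert (Pp : forall k, 0 <= rad ^ k) by (intros; apply pow_le; lra).
    apply Rmult_le_pos; [apply Rmult_le_pos; [apply Rabs_pos|apply Pp]|apply Pp]. }
  apply Rle_trans with (/ rho * sum_n (fun i =>
    Rabs (a (S i) (S n - S i)%nat) * rad ^ S i * rad ^ (S n - S i)) n).
  2:{ apply Rmult_le_compat_l. left; apply Rinv_0_lt_compat; trivial. lra. }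
  rewrite <- (sum_n_mult_l (K := R_AbsRing) (/ rho)).
  eapply Rle_trans; [apply Rle_abs|].
  apply sum_n_Rabs_le. intros i Hi. rewrite Rabs_Rabsolu. unfold mult; simpl (AbsRing.sort _).
  simpl (S n - S i)%nat. set (j := (n - i)%nat). unfold da.
  rewrite !Rabs_mult. rewrite (Rabs_pos_eq (INR (S i))) by apply pos_INR.
  assert (HXp : Rabs (X ^ j) <= rad ^ j).
  { rewrite <- RPow_abs. apply pow_incr. split. apply Rabs_pos. unfold rho in HX. lra. }
  assert (HTp : INR (S i) * Rabs (T ^ i) <= / rho * rad ^ S i).
  { apply Rle_trans with (4 ^ S i * rho ^ i).
    - apply Rmult_le_compat. apply pos_INR. apply Rabs_pos. apply INR_le_pow4.
      rewrite <- RPow_abs. apply pow_incr. split. apply Rabs_pos. lra.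
    - replace rad with (4 * rho) by (unfold rho; field). rewrite Rpow_mult_distr.
      simpl (rho ^ S i). right. field. lra. }
  match goal with |- ?p <= _ =>
    change (p <= / rho * (Rabs (a (S i) j) * rad ^ S i * rad ^ j)) end.
  replace (/ rho * (Rabs (a (S i) j) * rad ^ S i * rad ^ j))
    with (Rabs (a (S i) j) * (/ rho * rad ^ S i * rad ^ j)) by ring.
  replace (INR (S i) * Rabs (a (S i) j) * Rabs (T ^ i) * Rabs (X ^ j))
    with (Rabs (a (S i) j) * (INR (S i) * Rabs (T ^ i) * Rabs (X ^ j))) by ring.
  apply Rmult_le_compat_l. apply Rabs_pos.
  apply Rmult_le_compat; trivial; try apply Rabs_pos.
  apply Rmult_le_pos. apply pos_INR. apply Rabs_pos.
Qed.

Lemma derived_abs_series (T X : R) : Rabs T < rho -> Rabs X < rho ->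
  ex_series (fun n => sum_n (fun i => Rabs (da i (n - i)%nat * T ^ i * X ^ (n - i))) n).
Proof.
  intros HT HX.
  apply (ex_series_le (K := R_AbsRing) (V := R_CompleteNormedModule) _ (fun n => / rho * b (S n))).
  - intros n. unfold norm; simpl. unfold abs; simpl. rewrite Rabs_pos_eq.
    apply derived_terms_abs; trivial.
    eapply Rle_trans; [apply Rabs_pos|].
    apply (sum_n_Rabs_le (fun _ => 0)). intros i _. rewrite Rabs_R0. apply Rabs_pos.
  - apply (ex_series_scal_l (K := R_AbsRing) (V := R_NormedModule) (/ rho) (fun n => b (S n))).
    apply (ex_series_incr_1 b), majorant_ex_series.
Qed.

Lemma derived_ex_series (T X : R) : Rabs T < rho -> Rabs X < rho -> ex_series (hterm da T X).
Proof.
  intros HT HX.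
  refine (ex_series_le (K := R_AbsRing) (V := R_CompleteNormedModule) _ _ _ (derived_abs_series T X HT HX)).
  intros n. apply sum_n_Rabs_le. intros i _. lra.
Qed.

(** The termwise remainder bound is summable with total (h^2 / rho^2) times the sum of [b], so the
    remainder of the whole function is quadratic in [h]. *)
Lemma double_series_derive (t x : R) : Rabs (t - t0) < rho -> Rabs (x - x0) < rho ->
  is_derive (fun s => f s x) t (Series (hterm da (t - t0) (x - x0))).
Proof.
  intros Ht Hx. set (T := t - t0) in *. set (X := x - x0) in *.
  set (l := Series (hterm da T X)).
  (* The termwise derivative graded by the degree of the original term, so that it can be subtracted
     degree by degree. Its degree 0 part vanishes and its tail is the series with coefficients
     [da]. *)
  pose (Q (n : nat) := (sum_n : (nat -> R) -> nat -> R) (fun i => a i (n - i)%nat * (INR i * T ^ pred i) * X ^ (n - i)) n).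
  assert (HQ : is_series Q l).
  { apply is_series_decr_1.
    match goal with |- is_series _ ?v => assert (E0 : v = l) end.
    { unfold Q. rewrite sum_O. simpl. unfold plus, opp; simpl. ring. }
    rewrite E0.
    refine (is_series_ext _ _ _ _ (Series_correct _ (derived_ex_series T X Ht Hx))).
    intros n. unfold hterm, Q. rewrite sum_n_S_first. simpl (INR 0).
    match goal with |- ?p = ?q + ?s => change (@eq R p (q + s));
      assert (Z : q = 0) by ring; rewrite Z, Rplus_0_l; clear Z end.
    apply sum_n_ext. intros i. simpl (S n - S i)%nat. simpl (pred _). unfold da. ringR. }
  set (K := Series b / rho ^ 2).
  assert (Key : forall h, Rabs (T + h) < rho ->
    Rabs (f (t + h) x - f t x - l * h) <= h ^ 2 / rho ^ 2 * Series b).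
  { intros h Hh.
    assert (S1 : is_series (hterm a (T + h) X) (f (t + h) x)).
    { replace (T + h) with (t + h - t0) by (unfold T; ring).
      apply Hsum; fold X; replace (t + h - t0) with (T + h) by (unfold T; ring);
      unfold rho, rad in *; lra. }
    assert (S0 : is_series (hterm a T X) (f t x)).
    { apply Hsum; fold T; fold X; unfold rho, rad in *; lra. }
    pose proof (is_series_minus _ _ _ _ (is_series_minus _ _ _ _ S1 S0)
      (is_series_scal_l h _ _ HQ)) as S2.
    apply (series_bound _ _ (h ^ 2 / rho ^ 2)) in S2.
    - replace (f (t + h) x - f t x - l * h) with (f (t + h) x - f t x - h * l) by ring.
      exact S2.
    - apply Rdiv_le_0_compat. apply pow2_ge_0. apply pow_lt; trivial.
    - intros n.
      change (Rabs (hterm a (T + h) X n - hterm a T X n - h * Q n) <= h ^ 2 / rho ^ 2 * b n).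
      replace (hterm a (T + h) X n - hterm a T X n - h * Q n) with
        (sum_n (fun i =>
          a i (n - i)%nat * ((T + h) ^ i - T ^ i - h * (INR i * T ^ pred i)) * X ^ (n - i)) n).
      2:{ replace (hterm a (T + h) X n - hterm a T X n - h * Q n) with
          (hterm a (T + h) X n + ((-1) * hterm a T X n + (- h) * Q n)) by ring.
          unfold hterm, Q. rewrite <- !(sum_n_mult_l (K := R_AbsRing)).
          match goal with |- ?u = ?p + (?q + ?s) => change (u = plus p (plus q s)) end.
          rewrite <- !sum_n_plus.
          apply sum_n_ext. intros i. unfold plus, Hierarchy.mult; simpl. ringR. }
      unfold b. rewrite <- (sum_n_mult_l (K := R_AbsRing)).
      apply sum_n_Rabs_le. intros i _. set (j := (n - i)%nat).
      match goal with |- ?p <= _ =>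
        change (p <= h ^ 2 / rho ^ 2 * (Rabs (a i j) * rad ^ i * rad ^ j)) end.
      rewrite !Rabs_mult.
      assert (HXp : Rabs (X ^ j) <= rad ^ j).
      { rewrite <- RPow_abs. apply pow_incr. split. apply Rabs_pos. unfold rho in Hx. lra. }
      assert (B := pow_remainder_bound T h rho i rho_pos (Rlt_le _ _ Ht) (Rlt_le _ _ Hh)).
      replace (4 * rho) with rad in B by (unfold rho; field).
      replace (h ^ 2 / rho ^ 2 * (Rabs (a i j) * rad ^ i * rad ^ j))
        with (Rabs (a i j) * (h ^ 2 * rad ^ i / rho ^ 2) * rad ^ j) by (field; lra).
      apply Rmult_le_compat; trivial; try apply Rabs_pos.
      apply Rmult_le_pos; apply Rabs_pos.
      apply Rmult_le_compat_l. apply Rabs_pos.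
      apply Rmult_le_reg_r with (rho ^ 2). apply pow_lt; trivial.
      eapply Rle_trans; [exact B|]. right. field. lra. }
  apply is_derive_eps. intros eps He.
  (* Nonnegativity is read off from [Key] at one admissible nonzero increment, since the right side
     bounds an absolute value. *)
  assert (HK : 0 <= K).
  { unfold K. assert (0 < rho - Rabs T) by lra.
    set (h := (rho - Rabs T) / 2).
    assert (Hh : Rabs (T + h) < rho).
    { eapply Rle_lt_trans; [apply Rabs_triang|]. rewrite (Rabs_pos_eq h); unfold h; lra. }
    specialize (Key h Hh). apply Rmult_le_reg_l with (h ^ 2).
    - apply pow_lt. unfold h; lra.
    - rewrite Rmult_0_r. eapply Rle_trans; [apply Rabs_pos|]. eapply Rle_trans; [exact Key|].
      right. field. lra. }
  exists (Rmin (rho - Rabs T) (eps / (K + 1))). split.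
  { apply Rmin_glb_lt. lra. apply Rdiv_lt_0_compat; lra. }
  intros s Hs. apply Rmin_Rgt in Hs as (H1 & H2). set (h := s - t) in *.
  replace s with (t + h) by (unfold h; ring).
  eapply Rle_trans. apply Key.
  { eapply Rle_lt_trans; [apply Rabs_triang|]. lra. }
  replace (h ^ 2 / rho ^ 2 * Series b) with (K * (Rabs h * Rabs h)).
  2:{ rewrite <- Rabs_mult. replace (h * h) with (h ^ 2) by ring.
      rewrite Rabs_pos_eq by apply pow2_ge_0. unfold K. field. lra. }
  rewrite <- Rmult_assoc. apply Rmult_le_compat_r. apply Rabs_pos.
  apply Rle_trans with (K * (eps / (K + 1))). apply Rmult_le_compat_l; lra.
  apply Rmult_le_reg_r with (K + 1). lra.
  replace (K * (eps / (K + 1)) * (K + 1)) with (K * eps) by (field; lra). lra.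
Qed.

End DoubleSeries.

Lemma analytic_at_props (f : R -> R -> R) (t0 x0 : R) :
  analytic_at f t0 x0 ->
  continuous (fun p : R * R => f (fst p) (snd p)) (t0, x0) /\
  ex_derive (fun s => f s x0) t0 /\ analytic_at (d1 f) t0 x0.
Proof.
  intros (a & r & Hr & H).
  assert (Ha : forall t x, Rabs (t - t0) < r -> Rabs (x - x0) < r -> _) by
    (intros t x p q; exact (proj1 (H t x p q))).
  assert (Hs : forall t x, Rabs (t - t0) < r -> Rabs (x - x0) < r -> _) by
    (intros t x p q; exact (proj2 (H t x p q))).
  assert (Hrho : 0 < r / 2 / 4) by lra.
  split; [|split].
  - exact (double_series_cont0 f t0 x0 a r Hr Ha Hs).
  - eexists. apply (double_series_derive f t0 x0 a r Hr Ha Hs);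
    rewrite Rminus_diag, Rabs_R0; trivial.
  - exists (da a), (r / 2 / 4). split; trivial. intros t x Ht Hx term. split.
    + exact (derived_abs_series t0 x0 a r Hr Ha _ _ Ht Hx).
    + replace (d1 f t x) with (Series (hterm (da a) (t - t0) (x - x0))).
      * apply Series_correct. exact (derived_ex_series t0 x0 a r Hr Ha _ _ Ht Hx).
      * symmetry. apply is_derive_unique. exact (double_series_derive f t0 x0 a r Hr Ha Hs t x Ht Hx).
Qed.

Lemma analytic_props (Omega : R * R -> Prop) (f : R -> R -> R) :
  analytic Omega f ->
  analytic Omega (d1 f) /\ analytic Omega (d2 f) /\
  forall t x, Omega (t, x) ->
    continuous (fun p : R * R => f (fst p) (snd p)) (t, x) /\
    ex_derive (fun s => f s x) t /\ ex_derive (f t) x.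
Proof.
  intros H. split; [|split].
  - intros t x Hp. apply analytic_at_props, H, Hp.
  - intros t x Hp. apply H in Hp. apply analytic_at_swap, analytic_at_props in Hp.
    destruct Hp as (_ & _ & Hp). apply analytic_at_swap in Hp. exact Hp.
  - intros t x Hp. apply H in Hp. split; [|split].
    + apply analytic_at_props, Hp.
    + apply analytic_at_props, Hp.
    + apply analytic_at_swap, analytic_at_props in Hp. exact (proj1 (proj2 Hp)).
Qed.

(** Both partial derivatives of an analytic function are analytic, so the induction on the order
    runs over all of them. *)
Lemma Ck_analytic (Omega : R * R -> Prop) (D : R * R * R -> Prop) (f : R -> R -> R) (n : nat) :
  open D -> lies_over Omega D -> analytic Omega f -> Ck n D (fun t x _ => f t x).
Proof.
  intros HD HO. revert f. induction n; intros f Hf;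
  destruct (analytic_props _ _ Hf) as (A1 & A2 & A3);
  assert (Hc : forall t x u, D (t, x, u) -> cont3 (fun t x _ => f t x) t x u) by
   (intros t x u Hp; exact (continuous_comp (fun p : R * R * R => fst p)
      (fun p => f (fst p) (snd p)) (t, x, u) (continuous_fst
        (U := prod_UniformSpace R_UniformSpace R_UniformSpace) (V := R_UniformSpace) (t, x) u)
      (proj1 (A3 t x (HO _ _ _ Hp))))).
  - intros t x u Hp. split; trivial. apply Hc, Hp.
  - eapply (Ck_S_intro n D); [trivial| |exact (IHn _ A1)|exact (IHn _ A2)|exact (Ck_const n D 0 HD)].
    intros t x u Hp. split; [apply Hc, Hp|].
    destruct (A3 t x (HO _ _ _ Hp)) as (_ & B1 & B2).
    split; [|split].
    + apply Derive_correct, B1.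
    + apply Derive_correct, B2.
    + apply (is_derive_const (K := R_AbsRing) (V := R_NormedModule)).
Qed.

(** * Integrals depending on parameters *)

Lemma segment_ball (s0 s d z : R) :
  Rabs (s - s0) < d -> Rmin s0 s <= z <= Rmax s0 s -> Rabs (z - s0) <= Rabs (s - s0).
Proof.
  unfold Rmin, Rmax. destruct (Rle_dec s0 s); intros Hs Hz.
  - rewrite !Rabs_pos_eq; lra.
  - rewrite !Rabs_left1; lra.
Qed.

Lemma segment_ball2 (s0 s s' d z : R) :
  Rabs (s - s0) < d -> Rabs (s' - s0) < d -> Rmin s s' <= z <= Rmax s s' ->
  Rabs (z - s0) < d.
Proof.
  intros H1 H2. apply Rabs_def2 in H1. apply Rabs_def2 in H2.
  unfold Rmin, Rmax. destruct (Rle_dec s s'); intros; apply Rabs_def1; lra.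
Qed.

(** Heine-Borel for a property that survives shrinking its radius: local uniformity around each
    point becomes one radius for the whole interval. *)
Lemma compact_uniform (a b : R) (P : R -> R -> Prop) :
  (forall d d' z, 0 < d' <= d -> P d z -> P d' z) ->
  (forall z, a <= z <= b -> exists d, 0 < d /\ forall z', Rabs (z' - z) < d -> P d z') ->
  exists d, 0 < d /\ forall z, a <= z <= b -> P d z.
Proof.
  intros Hmono H.
  assert (Hch : forall z, exists d : posreal, a <= z <= b ->
     forall z', Rabs (z' - z) < d -> P d z').
  { intros z. destruct (classic (a <= z <= b)) as [Hz|Hz].
    - destruct (H z Hz) as (d & Hd & Hd'). exists (mkposreal d Hd). intros _. exact Hd'.
    - exists (mkposreal 1 Rlt_0_1). tauto. }
  (* The compactness theorem wants a gauge defined at every real, which choice extracts from the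
     pointwise radii, with the default 1 outside the interval. Its conclusion is doubly negated,
     hence the classical step below. *)
  set (del z := proj1_sig (constructive_indefinite_description _ (Hch z))).
  destruct (compactness_value_1d a b del) as [d Hd].
  exists d. split. apply cond_pos. intros z Hz.
  destruct (NNPP _ (Hd z Hz)) as (t & Ht & H1 & H2).
  apply (Hmono (del t)). { split; trivial. apply cond_pos. }
  exact (proj2_sig (constructive_indefinite_description _ (Hch t)) Ht z H1).
Qed.

Lemma abs_RInt_bound (f : R -> R) (a b M : R) :
  ex_RInt f a b -> (forall z, Rmin a b <= z <= Rmax a b -> Rabs (f z) <= M) ->
  Rabs (RInt f a b) <= M * Rabs (b - a).
Proof.
  intros Hf HM. destruct (Rle_dec a b) as [Hab|Hab].
  - rewrite Rmin_left, Rmax_right in HM by trivial.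
    rewrite (Rabs_pos_eq (b - a)) by lra. rewrite Rmult_comm.
    apply abs_RInt_le_const; trivial.
  - rewrite Rmin_right, Rmax_left in HM by lra.
    rewrite (Rabs_left1 (b - a)) by lra. apply ex_RInt_swap in Hf.
    rewrite <- opp_RInt_swap by trivial. unfold opp; simpl. rewrite Rabs_Ropp.
    replace (M * - (b - a)) with ((a - b) * M) by ring.
    apply abs_RInt_le_const; trivial. lra.
Qed.

Lemma MVT_segment (V dV : R -> R) (a b K : R) :
  (forall z, Rmin a b <= z <= Rmax a b -> is_derive V z (dV z) /\ Rabs (dV z) <= K) ->
  Rabs (V b - V a) <= K * Rabs (b - a).
Proof.
  intros H. destruct (MVT_gen V a b dV) as (c & Hc & E).
  - intros z Hz. apply H. lra.
  - intros z Hz. apply continuity_pt_filterlim, (ex_derive_continuous V).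
    eexists. apply H, Hz.
  - rewrite E, Rabs_mult. apply Rmult_le_compat_r. apply Rabs_pos. apply H, Hc.
Qed.

Section ParamInt.

Context (p0 s0 c0 d : R).

Definition pint (g : R -> R -> R -> R) (p s c : R) : R := RInt (fun z => g p z c) s0 s.

Lemma slice_cont (g : R -> R -> R -> R) (p s c : R) :
  Ck 0 (cube p0 s0 c0 d) g -> cube p0 s0 c0 d (p, s, c) -> continuous (fun z => g p z c) s.
Proof.
  intros Hg Hp. refine (continuous_cont3_comp g (fun _ => p) (fun z => z) (fun _ => c) s _ _ _ _).
  apply continuous_const. apply continuous_id. apply continuous_const.
  apply (Ck_cont _ _ _ _ _ _ Hg Hp).
Qed.

Lemma slice_int (g : R -> R -> R -> R) (p s s' c : R) :
  Ck 0 (cube p0 s0 c0 d) g -> cube p0 s0 c0 d (p, s, c) -> Rabs (s' - s0) < d ->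
  ex_RInt (fun z => g p z c) s s'.
Proof.
  intros Hg (H1 & H2 & H3) Hs. apply (ex_RInt_continuous (V := R_CompleteNormedModule)).
  intros z Hz. apply slice_cont; trivial. simpl in *.
  split; [|split]; simpl; trivial. apply (segment_ball2 s0 s s'); trivial.
Qed.

Lemma cube_slot2 (p s c z : R) :
  cube p0 s0 c0 d (p, s, c) -> Rabs (z - s0) < d -> cube p0 s0 c0 d (p, z, c).
Proof. intros (H1 & _ & H3) Hz; repeat split; trivial. Qed.

Lemma cube_s0 (p s c : R) : cube p0 s0 c0 d (p, s, c) -> cube p0 s0 c0 d (p, s0, c).
Proof.
  intros H. apply (cube_slot2 p s c); trivial. rewrite Rminus_diag, Rabs_R0.
  destruct H as (H & _). pose proof (Rabs_pos (p - p0)). simpl in H. lra.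
Qed.

Lemma pint_derive_s (g : R -> R -> R -> R) (p s c : R) :
  Ck 0 (cube p0 s0 c0 d) g -> cube p0 s0 c0 d (p, s, c) ->
  is_derive (fun z => pint g p z c) s (g p s c).
Proof.
  intros Hg Hp.
  apply (is_derive_RInt (fun z => g p z c) (fun z => pint g p z c) s0).
  - generalize (open_slice_x _ p s c (open_cube p0 s0 c0 d) Hp).
    apply filter_imp. intros z Hz.
    apply (RInt_correct (V := R_CompleteNormedModule)).
    apply slice_int; trivial. apply (cube_s0 p s c Hp). apply Hz.
  - apply slice_cont; trivial.
Qed.

Lemma pint_cont (g : R -> R -> R -> R) (p s c : R) :
  Ck 0 (cube p0 s0 c0 d) g -> cube p0 s0 c0 d (p, s, c) -> cont3 (pint g) p s c.
Proof.
  intros Hg Hp. apply cont3_eps. intros eps He.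
  pose proof Hp as (H1 & H2 & H3); simpl in H1, H2, H3.
  assert (Hd : 0 < d) by (pose proof (Rabs_pos (p - p0)); lra).
  (* A radius strictly between |s - s0| and [d]: the closed interval around [s0] lies inside the
     cube and still contains every endpoint near [s]. *)
  set (m := (Rabs (s - s0) + d) / 2).
  assert (Hm : Rabs (s - s0) < m < d) by (unfold m; lra).
  assert (Ht : 0 < eps / (2 * d)) by (apply Rdiv_lt_0_compat; lra).
  (* The integrands are made uniformly close, to eps/(2d), on an interval of length below [d]; this
     costs eps/2, and moving the endpoint costs the other half. *)
  destruct (compact_uniform (s0 - m) (s0 + m)
    (fun e z => forall p' c', Rabs (p' - p) < e -> Rabs (c' - c) < e ->
       Rabs (g p' z c' - g p z c) < eps / (2 * d))) as (e1 & He1 & U).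
  { intros e e' z He' H p' c' Hp' Hc'. apply H; lra. }
  { intros z Hz.
    assert (Hz' : cube p0 s0 c0 d (p, z, c)).
    { apply (cube_slot2 p s c); trivial. apply Rabs_def1; lra. }
    destruct (proj1 (cont3_eps _ _ _ _) (Ck_cont _ _ _ _ _ _ Hg Hz') (eps / (2 * d) / 2))
      as (e & He' & H). lra.
    exists e. split; trivial. intros z' Hzz p' c' Hp' Hc'.
    assert (B1 := H p' z' c' (conj Hp' (conj Hzz Hc'))).
    assert (B2 := H p z' c). lapply B2; [clear B2; intros B2|].
    2:{ repeat split; simpl; trivial; rewrite Rminus_diag, Rabs_R0; trivial. }
    apply Rabs_def2 in B1. apply Rabs_def2 in B2. apply Rabs_def1; lra. }
  assert (Cs : continuous (fun z => pint g p z c) s).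
  { apply (ex_derive_continuous (fun z => pint g p z c)). eexists.
    apply pint_derive_s; trivial. }
  destruct (proj1 (continuous_eps _ _) Cs (eps / 2)) as (e2 & He2 & B2). lra.
  destruct (proj1 (open_cubeP _) (open_cube p0 s0 c0 d) p s c Hp) as (e3 & He3 & B3).
  exists (Rmin (Rmin e1 e2) (Rmin e3 (m - Rabs (s - s0)))). split.
  { repeat apply Rmin_glb_lt; lra. }
  intros p' s' c' (K1 & K2 & K3); simpl in K1, K2, K3.
  apply Rmin_Rgt in K1 as (P1 & P2). apply Rmin_Rgt in P1 as (P1 & _).
  apply Rmin_Rgt in P2 as (P2 & _).
  apply Rmin_Rgt in K2 as (S1 & S2). apply Rmin_Rgt in S1 as (_ & S1).
  apply Rmin_Rgt in S2 as (S2 & S3).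
  apply Rmin_Rgt in K3 as (C1 & C2). apply Rmin_Rgt in C1 as (C1 & _).
  apply Rmin_Rgt in C2 as (C2 & _).
  assert (Q : cube p0 s0 c0 d (p', s', c')) by (apply B3; repeat split; trivial).
  assert (Sm : Rabs (s' - s0) < m).
  { replace (s' - s0) with ((s' - s) + (s - s0)) by ring.
    eapply Rle_lt_trans; [apply Rabs_triang|]. lra. }
  specialize (B2 s' S1).
  assert (I1 : ex_RInt (fun z => g p' z c') s0 s').
  { apply slice_int; trivial. apply (cube_s0 _ _ _ Q). apply Q. }
  assert (I2 : ex_RInt (fun z => g p z c) s0 s').
  { apply slice_int; trivial. apply (cube_s0 _ _ _ Hp). apply Q. }
  assert (B1 : Rabs (pint g p' s' c' - pint g p s' c) <= eps / 2).
  { unfold pint.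
    replace (RInt (fun z => g p' z c') s0 s' - RInt (fun z => g p z c) s0 s')
      with (RInt (fun z => g p' z c' - g p z c) s0 s').
    2:{ exact (RInt_minus (fun z => g p' z c') (fun z => g p z c) s0 s' I1 I2). }
    eapply Rle_trans. apply (abs_RInt_bound _ _ _ (eps / (2 * d))).
    - exact (ex_RInt_minus (fun z => g p' z c') (fun z => g p z c) s0 s' I1 I2).
    - intros z Hz. left. apply U; trivial.
      assert (Z := segment_ball s0 s' m z Sm Hz). 
      assert (Z' : Rabs (z - s0) < m) by lra. apply Rabs_def2 in Z'. lra.
    - apply Rle_trans with (eps / (2 * d) * d).
      apply Rmult_le_compat_l; lra. right; field; lra. }
  replace (pint g p' s' c' - pint g p s c)
    with ((pint g p' s' c' - pint g p s' c) + (pint g p s' c - pint g p s c)) by ring.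
  eapply Rle_lt_trans; [apply Rabs_triang|]. lra.
Qed.

Lemma pint_derive_t (g : R -> R -> R -> R) (p s c : R) :
  Ck 1 (cube p0 s0 c0 d) g -> cube p0 s0 c0 d (p, s, c) ->
  is_derive (fun q => pint g q s c) p (pint (dt g) p s c).
Proof.
  intros Hg Hp. pose proof (Ck_S_le _ _ _ Hg) as Hg0.
  apply Ck_S in Hg as (Hg & Gt & _ & _).
  assert (Hz : forall z, Rmin s0 s <= z <= Rmax s0 s -> cube p0 s0 c0 d (p, z, c)).
  { intros z Hz. apply (cube_slot2 p s c); trivial.
    destruct Hp as (_ & H & _). eapply Rle_lt_trans; [|exact H]. eapply segment_ball; eassumption. }
  apply (is_derive_RInt_param (fun q z => g q z c)).
  - generalize (open_slice_t _ p s c (open_cube p0 s0 c0 d) Hp). apply filter_imp.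
    intros q Hq z Hz'. refine (proj1 (proj2 (Hg q z c _))). apply (cube_slot2 q s c); trivial.
    apply (Hz z Hz').
  - intros z Hz'. apply continuity_2d_pt_filterlim.
    refine (continuous_cont3_comp (dt g) (fun q : R * R => fst q) (fun q => snd q)
      (fun _ => c) (p, z) _ _ _ _).
    apply continuous_fst. apply continuous_snd. apply continuous_const.
    apply (Ck_cont _ _ _ _ _ _ Gt (Hz z Hz')).
  - generalize (open_slice_t _ p s c (open_cube p0 s0 c0 d) Hp). apply filter_imp.
    intros q Hq. apply slice_int; trivial. apply (cube_s0 _ _ _ Hq). apply Hq.
Qed.

Lemma pint_derive_u (g : R -> R -> R -> R) (p s c : R) :
  Ck 1 (cube p0 s0 c0 d) g -> cube p0 s0 c0 d (p, s, c) ->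
  is_derive (fun q => pint g p s q) c (pint (du g) p s c).
Proof.
  intros Hg Hp. pose proof (Ck_S_le _ _ _ Hg) as Hg0.
  apply Ck_S in Hg as (Hg & _ & _ & Gu).
  assert (Hz : forall z, Rmin s0 s <= z <= Rmax s0 s -> cube p0 s0 c0 d (p, z, c)).
  { intros z Hz. apply (cube_slot2 p s c); trivial.
    destruct Hp as (_ & H & _). eapply Rle_lt_trans; [|exact H]. eapply segment_ball; eassumption. }
  apply (is_derive_RInt_param (fun q z => g p z q)).
  - generalize (open_slice_u _ p s c (open_cube p0 s0 c0 d) Hp). apply filter_imp.
    intros q Hq z Hz'. refine (proj2 (proj2 (proj2 (Hg p z q _)))). apply (cube_slot2 p s q); trivial.
    apply (Hz z Hz').
  - intros z Hz'. apply continuity_2d_pt_filterlim.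
    refine (continuous_cont3_comp (du g) (fun _ : R * R => p) (fun q => snd q)
      (fun q => fst q) (c, z) _ _ _ _).
    apply continuous_const. apply continuous_snd. apply continuous_fst.
    apply (Ck_cont _ _ _ _ _ _ Gu (Hz z Hz')).
  - generalize (open_slice_u _ p s c (open_cube p0 s0 c0 d) Hp). apply filter_imp.
    intros q Hq. apply slice_int; trivial. apply (cube_s0 _ _ _ Hq). apply Hq.
Qed.

Lemma Ck_0 (n : nat) (D : R * R * R -> Prop) (g : R -> R -> R -> R) : Ck n D g -> Ck 0 D g.
Proof. intros H t x u Hp. split; trivial. apply (Ck_cont _ _ _ _ _ _ H Hp). Qed.

Lemma Ck_1 (n : nat) (D : R * R * R -> Prop) (g : R -> R -> R -> R) : Ck (S n) D g -> Ck 1 D g.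
Proof. induction n; trivial. intros H. apply IHn, Ck_S_le, H. Qed.

(** No order is lost: the derivative in the endpoint is [g] itself, and the two others are integrals
    of derivatives of [g]. The bootstrap for flows relies on this. *)
Lemma Ck_pint (n : nat) (g : R -> R -> R -> R) :
  Ck n (cube p0 s0 c0 d) g -> Ck n (cube p0 s0 c0 d) (pint g).
Proof.
  revert g. induction n; intros g Hg.
  - intros p s c Hp. split; trivial. apply pint_cont; trivial.
  - pose proof Hg as Hg'. apply Ck_S in Hg' as (_ & Gt & _ & Gu).
    eapply (Ck_S_intro n); [apply open_cube| |exact (IHn _ Gt)|exact (Ck_S_le _ _ _ Hg)
      |exact (IHn _ Gu)].
    intros p s c Hp. split; [|split; [|split]].
    + apply pint_cont; trivial. apply (Ck_0 _ _ _ Hg).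
    + apply pint_derive_t; trivial. apply (Ck_1 _ _ _ Hg).
    + apply pint_derive_s; trivial. apply (Ck_0 _ _ _ Hg).
    + apply pint_derive_u; trivial. apply (Ck_1 _ _ _ Hg).
Qed.

End ParamInt.

(** * Smooth dependence of scalar flows *)

Lemma Rplus_cancel3 (c a b : R) : c + (a + b) - (c + a) = b.
Proof. ring. Qed.

Lemma cont3_bound (f : R -> R -> R -> R) (p s y : R) : cont3 f p s y ->
  exists d, 0 < d /\ forall p' s' y', cube p s y d (p', s', y') ->
    Rabs (f p' s' y') <= Rabs (f p s y) + 1.
Proof.
  intros Hf. destruct (proj1 (cont3_eps _ _ _ _) Hf 1 Rlt_0_1) as (d & Hd & H).
  exists d. split; trivial. intros p' s' y' Hc. specialize (H _ _ _ Hc).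
  replace (f p' s' y') with ((f p' s' y' - f p s y) + f p s y) by ring.
  eapply Rle_trans; [apply Rabs_triang|]. lra.
Qed.

Lemma flow_bounds (D : R * R * R -> Prop) (f : R -> R -> R -> R) (p0 s0 y0 : R) :
  open D -> smooth D f -> D (p0, s0, y0) ->
  exists r M, 0 < r /\ 0 < M /\ forall p s y, cube p0 s0 y0 r (p, s, y) ->
    D (p, s, y) /\ Rabs (f p s y) <= M /\ Rabs (dt f p s y) <= M /\ Rabs (du f p s y) <= M.
Proof.
  intros HD Hf Hp. destruct (smooth_partials _ _ Hf) as (Ft & _ & Fu).
  destruct (proj1 (open_cubeP D) HD p0 s0 y0 Hp) as (r0 & R0 & H0).
  destruct (cont3_bound f p0 s0 y0) as (r1 & R1 & H1). apply (Hf 0%nat _ _ _ Hp).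
  destruct (cont3_bound (dt f) p0 s0 y0) as (r2 & R2 & H2). apply (Ft 0%nat _ _ _ Hp).
  destruct (cont3_bound (du f) p0 s0 y0) as (r3 & R3 & H3). apply (Fu 0%nat _ _ _ Hp).
  exists (Rmin (Rmin r0 r1) (Rmin r2 r3)).
  exists (Rabs (f p0 s0 y0) + Rabs (dt f p0 s0 y0) + Rabs (du f p0 s0 y0) + 1).
  pose proof (Rabs_pos (f p0 s0 y0)). pose proof (Rabs_pos (dt f p0 s0 y0)).
  pose proof (Rabs_pos (du f p0 s0 y0)).
  split. { repeat apply Rmin_glb_lt; trivial. } split. lra.
  intros p s y Hc.
  pose proof (Rmin_l (Rmin r0 r1) (Rmin r2 r3)). pose proof (Rmin_r (Rmin r0 r1) (Rmin r2 r3)).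
  pose proof (Rmin_l r0 r1). pose proof (Rmin_r r0 r1).
  pose proof (Rmin_l r2 r3). pose proof (Rmin_r r2 r3).
  split; [|split; [|split]].
  - apply H0. eapply cube_mono; [|exact Hc]; lra.
  - eapply Rle_trans. apply H1. eapply cube_mono; [|exact Hc]; lra. lra.
  - eapply Rle_trans. apply H2. eapply cube_mono; [|exact Hc]; lra. lra.
  - eapply Rle_trans. apply H3. eapply cube_mono; [|exact Hc]; lra. lra.
Qed.

Lemma lim_abs_le (u v : nat -> R) (l l' K : R) :
  is_lim_seq u l -> is_lim_seq v l' -> (forall n, Rabs (u n - v n) <= K) ->
  Rabs (l - l') <= K.
Proof.
  intros Hu Hv H.
  assert (L := is_lim_seq_abs _ _ (is_lim_seq_minus' _ _ _ _ Hu Hv)).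
  exact (is_lim_seq_le _ _ _ _ H L (is_lim_seq_const K)).
Qed.

Lemma half_pow_small (K eps : R) : 0 <= K -> 0 < eps -> exists n, K * (/ 2) ^ n < eps.
Proof.
  intros HK He. destruct (pow_lt_1_zero (/ 2)) with (y := eps / (K + 1)) as (n & Hn).
  - rewrite Rabs_pos_eq; lra.
  - apply Rdiv_lt_0_compat; lra.
  - exists n. specialize (Hn n (le_n n)). rewrite Rabs_pos_eq in Hn by (apply pow_le; lra).
    apply Rle_lt_trans with (K * (eps / (K + 1))).
    apply Rmult_le_compat_l; lra.
    apply Rmult_lt_reg_r with (K + 1). lra.
    replace (K * (eps / (K + 1)) * (K + 1)) with (K * eps) by (field; lra). lra.
Qed.

(** * Picard iteration on a box, uniformly in the parameter and the initial value *)

Section Flow.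

Context (D : R * R * R -> Prop) (f : R -> R -> R -> R) (p0 s0 y0 r M d : R).
(** Initial values stay within r/4 of [y0] and trajectories move by at most r/4 more, hence never
    leave the cube of radius [r]. The condition M d <= 1/4 serves both the contraction and the
    stability of the Lipschitz constant 2 in [good]. *)
Hypotheses (HD : open D) (Hf : smooth D f) (Hd : 0 < d) (HM : 0 < M)
  (Hdr : d <= r / 4) (HMdr : M * d <= r / 4) (HMd : M * d <= / 4)
  (HB : forall p s y, cube p0 s0 y0 r (p, s, y) ->
    D (p, s, y) /\ Rabs (f p s y) <= M /\ Rabs (dt f p s y) <= M /\ Rabs (du f p s y) <= M).

Notation box := (cube p0 s0 y0 d).

(* Closed under [picard] and under pointwise limits; the Lipschitz bounds make the
   fixed point jointly continuous. *)
Definition good (Y : R -> R -> R -> R) : Prop :=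
  forall p s c, box (p, s, c) ->
    Rabs (Y p s c - c) <= r / 4 /\
    (forall s', Rabs (s' - s0) < d -> Rabs (Y p s' c - Y p s c) <= M * Rabs (s' - s)) /\
    (forall p' c', box (p', s, c') ->
       Rabs (Y p' s c' - Y p s c) <= 2 * (Rabs (p' - p) + Rabs (c' - c))).

Definition picard (Y : R -> R -> R -> R) (p s c : R) : R :=
  c + RInt (fun z => f p z (Y p z c)) s0 s.

Lemma f_lip (p s y p' y' : R) :
  cube p0 s0 y0 r (p, s, y) -> cube p0 s0 y0 r (p', s, y') ->
  Rabs (f p' s y' - f p s y) <= M * (Rabs (p' - p) + Rabs (y' - y)).
Proof.
  intros (P1 & S1 & Y1) (P2 & _ & Y2); simpl in *.
  assert (E1 := MVT_bound (fun z => f z s y') p0 r 0 M).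
  assert (E2 := MVT_bound (fun z => f p s z) y0 r 0 M).
  lapply E1; [clear E1; intros E1|].
  2:{ intros z Hz. destruct (HB z s y') as (B1 & B2 & B3 & B4). repeat split; assumption.
      split. apply (Hf 1%nat _ _ _ B1). rewrite Rminus_0_r. exact B3. }
  lapply E2; [clear E2; intros E2|].
  2:{ intros z Hz. destruct (HB p s z) as (B1 & B2 & B3 & B4). repeat split; assumption.
      split. apply (Hf 1%nat _ _ _ B1). rewrite Rminus_0_r. exact B4. }
  specialize (E1 p p' P1 P2). specialize (E2 y y' Y1 Y2).
  rewrite Rmult_0_l, Rminus_0_r in E1, E2.
  replace (f p' s y' - f p s y) with ((f p' s y' - f p s y') + (f p s y' - f p s y)) by ring.
  eapply Rle_trans; [apply Rabs_triang|]. lra.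
Qed.

Lemma good_in (Y : R -> R -> R -> R) (p s c : R) :
  good Y -> box (p, s, c) -> cube p0 s0 y0 r (p, s, Y p s c).
Proof.
  intros HY Hp. destruct (HY p s c Hp) as (H & _). destruct Hp as (H1 & H2 & H3).
  simpl in *. split; [|split]; simpl; try lra.
  replace (Y p s c - y0) with ((Y p s c - c) + (c - y0)) by ring.
  eapply Rle_lt_trans; [apply Rabs_triang|]. lra.
Qed.

Lemma good_slice_cont (Y : R -> R -> R -> R) (p s c : R) :
  good Y -> box (p, s, c) -> continuous (fun z => Y p z c) s.
Proof.
  intros HY Hp. apply continuous_eps. intros eps He.
  destruct (proj1 (open_cubeP _) (open_cube p0 s0 y0 d) p s c Hp) as (e & He' & Hin).
  exists (Rmin e (eps / M)). split.
  { apply Rmin_glb_lt; trivial. apply Rdiv_lt_0_compat; trivial. }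
  intros z Hz. apply Rmin_Rgt in Hz as (Z1 & Z2).
  destruct (HY p s c Hp) as (_ & H & _).
  eapply Rle_lt_trans. apply H.
  - assert (Q : box (p, z, c)).
    { apply Hin. destruct (cube_center p s c e He') as (K1 & _ & K3); repeat split; trivial. }
    apply Q.
  - apply Rlt_le_trans with (M * (eps / M)). apply Rmult_lt_compat_l; trivial.
    right; field; lra.
Qed.

Lemma good_comp_cont (Y g : R -> R -> R -> R) (p s c : R) :
  good Y -> Ck 0 D g -> box (p, s, c) -> continuous (fun z => g p z (Y p z c)) s.
Proof.
  intros HY Hg Hp.
  refine (continuous_cont3_comp g (fun _ => p) (fun z => z) (fun z => Y p z c) s _ _ _ _).
  apply continuous_const. apply continuous_id. apply good_slice_cont; trivial.
  apply (Ck_cont 0 D). exact Hg. apply HB, good_in; trivial.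
Qed.

Lemma good_int (Y g : R -> R -> R -> R) (p s s' c : R) :
  good Y -> Ck 0 D g -> box (p, s, c) -> Rabs (s' - s0) < d ->
  ex_RInt (fun z => g p z (Y p z c)) s s'.
Proof.
  intros HY Hg Hp Hs. apply (ex_RInt_continuous (V := R_CompleteNormedModule)).
  intros z Hz. apply good_comp_cont; trivial.
  apply (cube_slot2 p0 s0 y0 d p s c); trivial.
  apply (segment_ball2 s0 s s'); trivial. apply Hp.
Qed.

Lemma Rabs_seg (s : R) : Rabs (s - s0) < d -> M * Rabs (s - s0) <= M * d.
Proof. intros; apply Rmult_le_compat_l; lra. Qed.

Lemma in_seg (p s c z : R) : box (p, s, c) -> Rmin s0 s <= z <= Rmax s0 s -> box (p, z, c).
Proof.
  intros Hp Hz. apply (cube_slot2 p0 s0 y0 d p s c); trivial.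
  destruct Hp as (_ & H & _). simpl in H. eapply Rle_lt_trans; [|exact H].
  eapply segment_ball; eassumption.
Qed.

(** One estimate for two purposes: equal data give the contraction, and Y = Z gives Lipschitz
    dependence on the parameter and the initial value. *)
Lemma picard_diff (Y Z : R -> R -> R -> R) (p s c p' c' K : R) :
  good Y -> good Z -> box (p, s, c) -> box (p', s, c') -> 0 <= K ->
  (forall z, box (p, z, c) -> Rabs (Z p' z c' - Y p z c) <= K) ->
  Rabs (picard Z p' s c' - picard Y p s c) <= Rabs (c' - c) + / 4 * (Rabs (p' - p) + K).
Proof.
  intros HY HZ Hp Hp' HK H. unfold picard.
  assert (I1 := good_int Z f p' s0 s c' HZ (Ck_smooth _ _ 0 Hf) (cube_s0 _ _ _ _ _ _ _ Hp') (proj1 (proj2 Hp))).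
  assert (I2 := good_int Y f p s0 s c HY (Ck_smooth _ _ 0 Hf) (cube_s0 _ _ _ _ _ _ _ Hp) (proj1 (proj2 Hp))).
  match goal with |- Rabs (c' + ?i - (c + ?j)) <= _ =>
    replace (c' + i - (c + j)) with ((c' - c) + (i - j)) by ring end.
  eapply Rle_trans; [apply Rabs_triang|]. apply Rplus_le_compat_l.
  match goal with |- Rabs (?i - ?j) <= _ => replace (i - j) with
    (RInt (fun z => f p' z (Z p' z c') - f p z (Y p z c)) s0 s)
    by exact (RInt_minus _ _ s0 s I1 I2) end.
  eapply Rle_trans. apply (abs_RInt_bound _ _ _ (M * (Rabs (p' - p) + K))).
  - exact (ex_RInt_minus _ _ s0 s I1 I2).
  - intros z Hz.
    assert (Bz : box (p, z, c)) by (apply (in_seg p s c); trivial).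
    assert (Bz' : box (p', z, c')) by (apply (in_seg p' s c'); trivial).
    eapply Rle_trans. apply f_lip; apply good_in; trivial.
    apply Rmult_le_compat_l. lra. apply Rplus_le_compat_l, H, Bz.
  - destruct Hp as (_ & Hs & _); simpl in Hs. pose proof (Rabs_seg s Hs).
    pose proof (Rabs_pos (p' - p)).
    replace (M * (Rabs (p' - p) + K) * Rabs (s - s0)) with
      (M * Rabs (s - s0) * (Rabs (p' - p) + K)) by ring.
    apply Rmult_le_compat_r; lra.
Qed.

Lemma good_picard (Y : R -> R -> R -> R) : good Y -> good (picard Y).
Proof.
  intros HY p s c Hp.
  assert (Hbd : forall z, box (p, z, c) -> Rabs (f p z (Y p z c)) <= M).
  { intros z Hz. apply HB, good_in; trivial. }
  split; [|split].
  - unfold picard. rewrite Rplus_minus_l.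
    eapply Rle_trans. apply (abs_RInt_bound _ _ _ M).
    + apply good_int; trivial. apply Ck_smooth, Hf. apply (cube_s0 _ _ _ _ _ _ _ Hp). apply Hp.
    + intros z Hz. apply Hbd. apply (in_seg p s c); trivial.
    + destruct Hp as (_ & Hs & _). pose proof (Rabs_seg s Hs). simpl in *; lra.
  - intros s' Hs'. unfold picard.
    assert (I1 := good_int Y f p s0 s c HY (Ck_smooth _ _ 0 Hf) (cube_s0 _ _ _ _ _ _ _ Hp) (proj1 (proj2 Hp))).
    assert (I2 := good_int Y f p s s' c HY (Ck_smooth _ _ 0 Hf) Hp Hs').
    pose proof (RInt_Chasles _ _ _ _ I1 I2) as E. unfold plus in E; simpl in E.
    rewrite <- E, Rplus_cancel3.
    apply abs_RInt_bound; trivial.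
    intros z Hz. apply Hbd. apply (cube_slot2 p0 s0 y0 d p s c); trivial.
    apply (segment_ball2 s0 s s'); trivial. apply Hp.
  - intros p' c' Hp'.
    (* The constant 2 reproduces itself: the coefficient of |c' - c| becomes 1 + 2/4, that of |p' -
       p| becomes (1 + 2)/4, both at most 2. *)
    eapply Rle_trans. apply (picard_diff Y Y p s c p' c' (2 * (Rabs (p' - p) + Rabs (c' - c)))); trivial.
    + pose proof (Rabs_pos (p' - p)); pose proof (Rabs_pos (c' - c)); lra.
    + intros z Hz. destruct (HY p z c Hz) as (_ & _ & H). apply H.
      apply (cube_slot2 p0 s0 y0 d p' s c'); trivial. apply Hz.
    + pose proof (Rabs_pos (p' - p)); pose proof (Rabs_pos (c' - c)); lra.
Qed.

Fixpoint iter_picard (n : nat) : R -> R -> R -> R :=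
  match n with
  | O => fun _ _ c => c
  | S m => picard (iter_picard m)
  end.

Lemma good_iter (n : nat) : good (iter_picard n).
Proof.
  induction n; [|apply good_picard; trivial].
  intros p s c Hp. simpl. rewrite Rminus_diag, Rabs_R0. split; [lra|split].
  - intros s' _. apply Rmult_le_pos. lra. apply Rabs_pos.
  - intros p' c' _. pose proof (Rabs_pos (p' - p)); pose proof (Rabs_pos (c' - c)); lra.
Qed.

Lemma picard_contract (Y Z : R -> R -> R -> R) (K : R) :
  good Y -> good Z -> 0 <= K ->
  (forall p s c, box (p, s, c) -> Rabs (Z p s c - Y p s c) <= K) ->
  forall p s c, box (p, s, c) -> Rabs (picard Z p s c - picard Y p s c) <= K * / 2.
Proof.
  intros HY HZ HK H p s c Hp. eapply Rle_trans.
  apply (picard_diff Y Z p s c p c K); trivial. intros; apply H; trivial.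
  rewrite !Rminus_diag, Rabs_R0. lra.
Qed.

Lemma r_pos : 0 < r. Proof. lra. Qed.

Lemma iter_step (n : nat) (p s c : R) : box (p, s, c) ->
  Rabs (iter_picard (S n) p s c - iter_picard n p s c) <= r / 4 * (/ 2) ^ n.
Proof.
  pose proof r_pos. revert p s c. induction n; intros p s c Hp.
  - simpl (_ ^ _). rewrite Rmult_1_r. apply (good_iter 1 p s c Hp).
  - apply Rle_trans with (r / 4 * (/ 2) ^ n * / 2); [|simpl; lra].
    apply (picard_contract (iter_picard n) (iter_picard (S n))); trivial; try apply good_iter.
    apply Rmult_le_pos. lra. apply pow_le; lra.
Qed.

Lemma iter_far (n k : nat) (p s c : R) : box (p, s, c) ->
  Rabs (iter_picard (n + k) p s c - iter_picard n p s c) <= r / 2 * (/ 2) ^ n.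
Proof.
  intros Hp. pose proof r_pos.
  assert (P : 0 < (/ 2) ^ n) by (apply pow_lt; lra).
  (* The exact geometric sum of the steps is kept; without the factor 1 - 2^(-k) the induction on
     [k] would not close. *)
  assert (B : Rabs (iter_picard (n + k) p s c - iter_picard n p s c)
     <= r / 2 * (/ 2) ^ n * (1 - (/ 2) ^ k)).
  { induction k.
    - rewrite Nat.add_0_r, Rminus_diag, Rabs_R0. simpl; lra.
    - rewrite Nat.add_succ_r.
      match goal with |- Rabs (?u - ?v) <= _ =>
        replace (u - v) with ((u - iter_picard (n + k) p s c) + (iter_picard (n + k) p s c - v)) by ring end.
      eapply Rle_trans; [apply Rabs_triang|].
      pose proof (iter_step (n + k) p s c Hp) as E. rewrite pow_add in E.
      simpl (_ ^ S k). lra. }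
  assert (Pk : 0 < (/ 2) ^ k) by (apply pow_lt; lra).
  assert (0 < r / 2 * (/ 2) ^ n * (/ 2) ^ k).
  { repeat apply Rmult_lt_0_compat; lra. }
  lra.
Qed.

(** Being built from a total limit, it also has values outside the box, where they carry no
    meaning. *)
Definition flow (p s c : R) : R := real (Lim_seq (fun n => iter_picard n p s c)).

Lemma flow_lim (p s c : R) : box (p, s, c) ->
  is_lim_seq (fun n => iter_picard n p s c) (flow p s c).
Proof.
  intros Hp. apply Lim_seq_correct', ex_lim_seq_cauchy_corr. pose proof r_pos.
  intros eps. destruct (half_pow_small (r / 2) (eps / 2)) as (N & HN). lra.
  { pose proof (cond_pos eps); lra. }
  exists N. intros n m Hn Hm.
  pose proof (iter_far N (n - N) p s c Hp) as E1.
  pose proof (iter_far N (m - N) p s c Hp) as E2.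
  replace (N + (n - N))%nat with n in E1 by lia.
  replace (N + (m - N))%nat with m in E2 by lia.
  match goal with |- Rabs (?u - ?v) < _ =>
    replace (u - v) with ((u - iter_picard N p s c) + - (v - iter_picard N p s c)) by ring end.
  eapply Rle_lt_trans; [apply Rabs_triang|]. rewrite Rabs_Ropp. lra.
Qed.

Lemma flow_near (n : nat) (p s c : R) : box (p, s, c) ->
  Rabs (flow p s c - iter_picard n p s c) <= r / 2 * (/ 2) ^ n.
Proof.
  intros Hp.
  apply (lim_abs_le (fun k => iter_picard (n + k) p s c) (fun _ => iter_picard n p s c)).
  - apply (is_lim_seq_ext (fun k => iter_picard (k + n) p s c)).
    { intros k. rewrite Nat.add_comm. reflexivity. }
    apply (is_lim_seq_incr_n (fun k => iter_picard k p s c)). apply flow_lim, Hp.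
  - apply is_lim_seq_const.
  - intros k. apply iter_far, Hp.
Qed.

Lemma good_flow : good flow.
Proof.
  intros p s c Hp. split; [|split].
  - apply (lim_abs_le (fun n => iter_picard n p s c) (fun _ => c)).
    + apply flow_lim, Hp.
    + apply is_lim_seq_const.
    + intros n. apply (good_iter n p s c Hp).
  - intros s' Hs'.
    apply (lim_abs_le (fun n => iter_picard n p s' c) (fun n => iter_picard n p s c)).
    + apply flow_lim. apply (cube_slot2 p0 s0 y0 d p s c); trivial.
    + apply flow_lim, Hp.
    + intros n. apply (good_iter n p s c Hp), Hs'.
  - intros p' c' Hp'.
    apply (lim_abs_le (fun n => iter_picard n p' s c') (fun n => iter_picard n p s c)).
    + apply flow_lim, Hp'.
    + apply flow_lim, Hp.
    + intros n. apply (good_iter n p s c Hp), Hp'.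
Qed.

Lemma flow_fixed (p s c : R) : box (p, s, c) -> flow p s c = picard flow p s c.
Proof.
  intros Hp. pose proof r_pos. apply NNPP. intros Hne.
  assert (Hpos : 0 < Rabs (picard flow p s c - flow p s c)).
  { apply Rabs_pos_lt. intros E. apply Hne. lra. }
  (* The flow and its Picard image both lie within (r/4) 2^(-n) of iterate n + 1, so their distance
     is at most (r/2) 2^(-n); this [n] makes that less than the supposed distance. *)
  destruct (half_pow_small (r / 2) _ (ltac:(lra) : 0 <= r / 2) Hpos) as (n & Hn).
  assert (P : 0 < (/ 2) ^ n) by (apply pow_lt; lra).
  assert (B1 := picard_contract (iter_picard n) flow (r / 2 * (/ 2) ^ n) (good_iter n) good_flow
    ltac:(apply Rmult_le_pos; lra) (fun p s c Hq => flow_near n p s c Hq) p s c Hp).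
  assert (B2 := flow_near (S n) p s c Hp). simpl (_ ^ S n) in B2.
  change (iter_picard (S n)) with (picard (iter_picard n)) in B2.
  replace (picard flow p s c - flow p s c) with
    ((picard flow p s c - picard (iter_picard n) p s c)
     + - (flow p s c - picard (iter_picard n) p s c)) in Hn by ring.
  pose proof (Rabs_triang (picard flow p s c - picard (iter_picard n) p s c)
     (- (flow p s c - picard (iter_picard n) p s c))) as T.
  rewrite Rabs_Ropp in T. lra.
Qed.

Lemma flow_init (p s c : R) : box (p, s, c) -> flow p s0 c = c.
Proof.
  intros Hp. rewrite flow_fixed by (apply (cube_s0 _ _ _ _ _ _ _ Hp)).
  unfold picard. rewrite RInt_point. unfold zero; simpl. ring.
Qed.

Lemma flow_ode (p s c : R) : box (p, s, c) ->
  is_derive (fun z => flow p z c) s (f p s (flow p s c)).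
Proof.
  intros Hp.
  apply (is_derive_ext_loc (fun z => c + RInt (fun z => f p z (flow p z c)) s0 z)).
  - generalize (open_slice_x _ p s c (open_cube p0 s0 y0 d) Hp). apply filter_imp.
    intros z Hz. symmetry. apply flow_fixed, Hz.
  - rewrite <- (Rplus_0_l (f p s (flow p s c))).
    apply (is_derive_plus (fun _ => c) (fun z => RInt (fun z => f p z (flow p z c)) s0 z)).
    apply (is_derive_const (K := R_AbsRing) (V := R_NormedModule)).
    apply (is_derive_RInt (fun z => f p z (flow p z c)) (fun z => RInt (fun z => f p z (flow p z c)) s0 z) s0).
    + generalize (open_slice_x _ p s c (open_cube p0 s0 y0 d) Hp).
      apply filter_imp. intros z Hz.
      apply (RInt_correct (V := R_CompleteNormedModule)).
      apply good_int. apply good_flow. apply Ck_smooth, Hf.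
      apply (cube_s0 _ _ _ _ _ _ _ Hp). apply Hz.
    + apply good_comp_cont; trivial. apply good_flow. apply Ck_smooth, Hf.
Qed.

Lemma flow_cont (p s c : R) : box (p, s, c) -> cont3 flow p s c.
Proof.
  intros Hp. apply cont3_eps. intros eps He.
  destruct (proj1 (open_cubeP _) (open_cube p0 s0 y0 d) p s c Hp) as (e & He' & Hin).
  exists (Rmin e (eps / (M + 4))). split.
  { apply Rmin_glb_lt; trivial. apply Rdiv_lt_0_compat; lra. }
  intros p' s' c' Hc.
  assert (Q : box (p', s', c')).
  { apply Hin. eapply cube_mono; [|exact Hc]. apply Rmin_l. }
  destruct Hc as (K1 & K2 & K3); simpl in *.
  apply Rmin_Rgt in K1 as (_ & K1). apply Rmin_Rgt in K2 as (_ & K2).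
  apply Rmin_Rgt in K3 as (_ & K3).
  assert (Q' : box (p, s', c)) by (apply (cube_slot2 p0 s0 y0 d p s c); trivial; apply Q).
  destruct (good_flow p s' c Q') as (_ & _ & B1). specialize (B1 p' c' Q).
  destruct (good_flow p s c Hp) as (_ & B2 & _). specialize (B2 s' (proj1 (proj2 Q))).
  replace (flow p' s' c' - flow p s c) with
    ((flow p' s' c' - flow p s' c) + (flow p s' c - flow p s c)) by ring.
  eapply Rle_lt_trans; [apply Rabs_triang|].
  assert (E : M * Rabs (s' - s) <= M * (eps / (M + 4))).
  { apply Rmult_le_compat_l; lra. }
  apply Rlt_le_trans with (4 * (eps / (M + 4)) + M * (eps / (M + 4))). lra.
  right. field. lra.
Qed.

(** A first-order expansion of [f] whose radius is the same at all times of the trajectory: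
    compactness of the time segment turns local strict differentiability into a uniform one. *)
Lemma flow_strict (p s c eps : R) : box (p, s, c) -> 0 < eps ->
  exists e, 0 < e /\ forall z, Rmin s0 s <= z <= Rmax s0 s ->
    forall p' y', Rabs (p' - p) < e -> Rabs (y' - flow p z c) < e ->
    Rabs (f p' z y' - f p z (flow p z c)
      - (dt f p z (flow p z c) * (p' - p) + du f p z (flow p z c) * (y' - flow p z c)))
    <= eps * (Rabs (p' - p) + Rabs (y' - flow p z c)).
Proof.
  intros Hp He. destruct (smooth_partials _ _ Hf) as (Ft & _ & Fu).
  apply (compact_uniform (Rmin s0 s) (Rmax s0 s) (fun e z =>
    forall p' y', Rabs (p' - p) < e -> Rabs (y' - flow p z c) < e ->
    Rabs (f p' z y' - f p z (flow p z c)
      - (dt f p z (flow p z c) * (p' - p) + du f p z (flow p z c) * (y' - flow p z c)))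
    <= eps * (Rabs (p' - p) + Rabs (y' - flow p z c)))).
  { intros e e' z He' H p' y' H1 H2. apply H; lra. }
  intros z Hz. pose proof (in_seg p s c z Hp Hz) as Bz.
  (* One third pays for strict differentiability at [z], one each for replacing the two partial
     derivatives at time [z] by those at a nearby time. *)
  assert (He3 : 0 < eps / 3) by lra.
  destruct (strict_diff D f p z (flow p z c) HD (Ck_smooth _ _ 1 Hf)) with (eps := eps / 3)
    as (d1 & Hd1 & _ & S1); trivial.
  { apply HB, good_in; trivial. apply good_flow. }
  destruct (proj1 (continuous_eps _ _) (good_comp_cont flow (dt f) p z c good_flow (Ck_smooth _ _ 0 Ft) Bz) _ He3)
    as (d2 & Hd2 & S2).
  destruct (proj1 (continuous_eps _ _) (good_comp_cont flow (du f) p z c good_flow (Ck_smooth _ _ 0 Fu) Bz) _ He3)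
    as (d3 & Hd3 & S3).
  destruct (proj1 (continuous_eps _ _) (good_slice_cont flow p z c good_flow Bz) (d1 / 2))
    as (d4 & Hd4 & S4). lra.
  exists (Rmin (Rmin (d1 / 2) d2) (Rmin d3 d4)). split.
  { repeat apply Rmin_glb_lt; lra. }
  intros z' Hz' p' y' Hp' Hy'.
  apply Rmin_Rgt in Hz' as (K1 & K2). apply Rmin_Rgt in K1 as (K1 & K1').
  apply Rmin_Rgt in K2 as (K2 & K2').
  apply Rmin_Rgt in Hp' as (P1 & _). apply Rmin_Rgt in P1 as (P1 & _).
  apply Rmin_Rgt in Hy' as (Y1 & _). apply Rmin_Rgt in Y1 as (Y1 & _).
  specialize (S2 z' K1'). specialize (S3 z' K2). specialize (S4 z' K2').
  specialize (S1 p z' (flow p z' c) p' z' y').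
  lapply S1; [clear S1; intros S1|].
  2:{ split; [|split]; simpl; try lra. rewrite Rminus_diag, Rabs_R0; trivial. }
  lapply S1; [clear S1; intros S1|].
  2:{ split; [|split]; simpl; try lra.
      replace (y' - flow p z c) with ((y' - flow p z' c) + (flow p z' c - flow p z c)) by ring.
      eapply Rle_lt_trans; [apply Rabs_triang|]. lra. }
  rewrite (Rminus_diag z'), Rabs_R0, Rmult_0_r, !Rplus_0_r in S1.
  set (a := dt f p z (flow p z c)) in *. set (a' := dt f p z' (flow p z' c)) in *.
  set (b := du f p z (flow p z c)) in *. set (b' := du f p z' (flow p z' c)) in *.
  set (h := p' - p) in *. set (q := y' - flow p z' c) in *.
  match goal with |- Rabs (?F - (a' * h + b' * q)) <= _ =>
    replace (F - (a' * h + b' * q)) with ((F - (a * h + b * q)) + (- ((a' - a) * h) + - ((b' - b) * q)))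
      by ring end.
  eapply Rle_trans; [apply Rabs_triang|].
  eapply Rle_trans; [apply Rplus_le_compat_l, Rabs_triang|].
  rewrite !Rabs_Ropp, !Rabs_mult.
  assert (E1 : Rabs (a' - a) * Rabs h <= eps / 3 * Rabs h).
  { apply Rmult_le_compat_r. apply Rabs_pos. lra. }
  assert (E2 : Rabs (b' - b) * Rabs q <= eps / 3 * Rabs q).
  { apply Rmult_le_compat_r. apply Rabs_pos. lra. }
  pose proof (Rabs_pos h). pose proof (Rabs_pos q). nra.
Qed.

(** * Derivatives of the flow in the parameter and the initial value *)

Definition along (g : R -> R -> R -> R) (p s c : R) : R := g p s (flow p s c).

(** The logarithm of Y_c; [flow_source] below is the quotient Y_p / Y_c. *)
Definition flow_exponent : R -> R -> R -> R := pint s0 (along (du f)).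

Definition flow_source : R -> R -> R -> R :=
  pint s0 (fun p s c => along (dt f) p s c * exp (- flow_exponent p s c)).

Lemma Ck_along (n : nat) (g : R -> R -> R -> R) :
  Ck n D g -> Ck n box flow -> Ck n box (along g).
Proof.
  intros Hg Hn. apply (Ck_comp n box D g (fun p _ _ => p) (fun _ s _ => s) flow); trivial.
  - apply open_cube.
  - apply Ck_t, open_cube.
  - apply Ck_x, open_cube.
  - intros p s c Hp. apply HB, good_in; trivial. apply good_flow.
Qed.

Lemma Ck_exponent (n : nat) : Ck n box flow -> Ck n box flow_exponent.
Proof.
  intros Hn. apply Ck_pint, Ck_along; trivial. apply Ck_smooth, (smooth_partials _ _ Hf).
Qed.

Lemma Ck_source_integrand (n : nat) : Ck n box flow ->
  Ck n box (fun p s c => along (dt f) p s c * exp (- flow_exponent p s c)).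
Proof.
  intros Hn. pose proof (open_cube p0 s0 y0 d).
  apply Ck_mult; trivial.
  - apply Ck_along; trivial. apply Ck_smooth, (smooth_partials _ _ Hf).
  - apply Ck_exp; trivial. apply Ck_opp; trivial. apply Ck_exponent; trivial.
Qed.

Lemma Ck0_flow : Ck 0 box flow.
Proof. intros p s c Hp. split; trivial. apply flow_cont, Hp. Qed.

(** The integral of f_u is at most M d in size. The rounder bound 1 lets the exponential and its
    inverse both be estimated by [exp 1]. *)
Lemma exponent_bound (p s c : R) : box (p, s, c) -> Rabs (flow_exponent p s c) <= 1.
Proof.
  intros Hp. unfold flow_exponent, pint. eapply Rle_trans. apply (abs_RInt_bound _ _ _ M).
  - apply good_int. apply good_flow. apply Ck_smooth, (smooth_partials _ _ Hf).
    apply (cube_s0 _ _ _ _ _ _ _ Hp). apply Hp.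
  - intros z Hz. apply HB, good_in. apply good_flow. apply (in_seg p s c); trivial.
  - destruct Hp as (_ & Hs & _). pose proof (Rabs_seg s Hs). simpl in *; lra.
Qed.

Lemma exp_le_exp1 (E : R) : Rabs E <= 1 -> Rabs (exp E) <= exp 1.
Proof.
  intros H. rewrite Rabs_pos_eq by (left; apply exp_pos).
  destruct (Rle_lt_or_eq_dec E 1) as [L| ->].
  - eapply Rle_trans; [apply Rle_abs|exact H].
  - left. apply exp_increasing, L.
  - lra.
Qed.

(* With [Z] the difference of two solutions and [m] the exponential of the integral of [f_u],
   the derivative of [Z / m] is [h e f_t / m] up to [o(h)], uniformly in time. *)
Lemma flow_directional (p s c e c1 q0 : R) : box (p, s, c) -> Rabs e <= 1 -> Rabs c1 <= 1 ->
  is_derive (fun q => flow (p + e * (q - q0)) s (c + c1 * (q - q0))) q0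
    (exp (flow_exponent p s c) * (c1 + e * flow_source p s c)).
Proof.
  intros Hp He1 Hc1. apply is_derive_eps. intros eps He.
  pose proof (exp_pos 1) as X1.
  (* The 5 is 1 + 4: the parameter moves by at most |h| and the solution by at most 2(|h| + |h|).
     The two exponentials bound the integrating factor and its inverse, and d + 1 bounds the length
     of the time segment. *)
  set (K := 5 * exp 1 * exp 1 * (d + 1)).
  assert (HK : 0 < K) by (unfold K; repeat apply Rmult_lt_0_compat; lra).
  assert (He' : 0 < eps / K) by (apply Rdiv_lt_0_compat; trivial).
  destruct (flow_strict p s c (eps / K) Hp He') as (d1 & Hd1 & S).
  destruct (proj1 (open_cubeP _) (open_cube p0 s0 y0 d) p s c Hp) as (d2 & Hd2 & Hin).
  (* Two solutions differ by at most 4|h|, so |h| < d1/4 keeps them within the radius of the uniform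
     expansion. *)
  exists (Rmin (d1 / 4) d2). split. { apply Rmin_glb_lt; lra. }
  intros q Hq. apply Rmin_Rgt in Hq as (Q1 & Q2).
  rewrite (Rminus_diag q0), !Rmult_0_r, !Rplus_0_r. set (h := q - q0) in *.
  set (p' := p + e * h). set (c' := c + c1 * h).
  assert (Eh : Rabs (e * h) <= Rabs h).
  { rewrite Rabs_mult. rewrite <- (Rmult_1_l (Rabs h)) at 2.
    apply Rmult_le_compat_r; trivial. apply Rabs_pos. }
  assert (Ch : Rabs (c1 * h) <= Rabs h).
  { rewrite Rabs_mult. rewrite <- (Rmult_1_l (Rabs h)) at 2.
    apply Rmult_le_compat_r; trivial. apply Rabs_pos. }
  assert (Pp : p' - p = e * h) by (unfold p'; ring).
  assert (Cc : c' - c = c1 * h) by (unfold c'; ring).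
  assert (Hp' : box (p', s, c')).
  { apply Hin. split; [|split]; simpl. rewrite Pp; lra.
    rewrite Rminus_diag, Rabs_R0; trivial. rewrite Cc; lra. }
  (* Multiplying by the integrating factor removes the f_u term and subtracting the source removes
     the f_p term, so the derivative of [V] is only the remainder of [f] times the factor. As V
     vanishes at [s0], the mean value theorem bounds it. *)
  set (V := fun z => (flow p' z c' - flow p z c) * exp (- flow_exponent p z c)
    - h * (c1 + e * flow_source p z c)).
  assert (V0 : V s0 = 0).
  { unfold V, flow_source, flow_exponent, pint.
    rewrite (flow_init p' s c' Hp'), (flow_init p s c Hp), !RInt_point.
    unfold zero; simpl. rewrite Ropp_0, exp_0, Cc. ring. }
  assert (Vb : Rabs (V s - V s0) <= 5 * (eps / K) * exp 1 * Rabs h * Rabs (s - s0)).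
  { apply (MVT_segment V (fun z => (f p' z (flow p' z c') - f p z (flow p z c)
       - (dt f p z (flow p z c) * (p' - p) + du f p z (flow p z c) * (flow p' z c' - flow p z c)))
       * exp (- flow_exponent p z c))).
    intros z Hz. pose proof (in_seg p s c z Hp Hz) as Bz.
    pose proof (in_seg p' s c' z Hp' Hz) as Bz'. split.
    - assert (dE : is_derive (fun z => flow_exponent p z c) z (du f p z (flow p z c))).
      { apply (pint_derive_s p0 s0 y0 d (along (du f))); trivial.
        apply Ck_along. apply Ck_smooth, (smooth_partials _ _ Hf). apply Ck0_flow. }
      assert (dS : is_derive (fun z => flow_source p z c) z
        (dt f p z (flow p z c) * exp (- flow_exponent p z c))).
      { apply (pint_derive_s p0 s0 y0 d
          (fun p s c => along (dt f) p s c * exp (- flow_exponent p s c))); trivial.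
        apply Ck_source_integrand, Ck0_flow. }
      pose proof (flow_ode p' z c' Bz') as dY'. pose proof (flow_ode p z c Bz) as dY.
      assert (dX : is_derive (fun z => exp (- flow_exponent p z c)) z
        (- du f p z (flow p z c) * exp (- flow_exponent p z c))).
      { apply (is_derive_comp exp (fun z => - flow_exponent p z c)).
        apply is_derive_Reals, derivable_pt_lim_exp.
        exact (is_derive_opp _ _ _ dE). }
      pose proof (is_derive_minus _ _ _ _ _
        (is_derive_mult _ _ _ _ _ (is_derive_minus _ _ _ _ _ dY' dY) dX Rmult_comm)
        (is_derive_scal _ _ h _ (is_derive_plus _ _ _ _ _
           (is_derive_const (K := R_AbsRing) (V := R_NormedModule) c1 z)
           (is_derive_scal _ _ e _ dS)))) as dV.
      unfold V.
      match type of dV with is_derive _ _ ?l =>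
        match goal with |- is_derive _ _ ?l' => replace l' with l; [exact dV|] end end.
      rewrite Pp. unfold minus, plus, opp, mult, scal, zero; simpl. unfold mult; simpl. ring.
    - rewrite Rabs_mult.
      destruct (good_flow p z c Bz) as (_ & _ & B). specialize (B p' c' Bz').
      rewrite Pp, Cc in B.
      assert (B' : Rabs (flow p' z c' - flow p z c) <= 4 * Rabs h) by lra.
      replace (5 * (eps / K) * exp 1 * Rabs h) with (eps / K * (5 * Rabs h) * exp 1) by ring.
      apply Rmult_le_compat; try apply Rabs_pos.
      + eapply Rle_trans. apply S; trivial; try rewrite Pp; lra.
        apply Rmult_le_compat_l; [lra|]. rewrite Pp. lra.
      + apply exp_le_exp1. rewrite Rabs_Ropp. apply exponent_bound, Bz. }
  rewrite V0, Rminus_0_r in Vb.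
  replace (flow p' s c' - flow p s c - exp (flow_exponent p s c) * (c1 + e * flow_source p s c) * h)
    with (exp (flow_exponent p s c) * V s).
  2:{ unfold V. rewrite Rmult_minus_distr_l.
      replace (exp (flow_exponent p s c) * ((flow p' s c' - flow p s c) * exp (- flow_exponent p s c)))
        with ((flow p' s c' - flow p s c) * (exp (flow_exponent p s c) * exp (- flow_exponent p s c))) by ring.
      rewrite <- exp_plus, Rplus_opp_r, exp_0. ring. }
  rewrite Rabs_mult.
  apply Rle_trans with (exp 1 * (5 * (eps / K) * exp 1 * Rabs h * (d + 1))).
  - apply Rmult_le_compat; try apply Rabs_pos.
    + apply exp_le_exp1, exponent_bound, Hp.
    + eapply Rle_trans; [exact Vb|]. apply Rmult_le_compat_l.
      * apply Rmult_le_pos; [|apply Rabs_pos]. apply Rmult_le_pos; lra.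
      * destruct Hp as (_ & Hs & _); simpl in Hs; lra.
  - right. unfold K. field. split; lra.
Qed.

Lemma flow_partials (p s c : R) : box (p, s, c) ->
  is_derive (fun q => flow q s c) p (exp (flow_exponent p s c) * flow_source p s c) /\
  is_derive (fun q => flow p s q) c (exp (flow_exponent p s c)).
Proof.
  intros Hp. split.
  - apply (is_derive_ext (fun q => flow (p + 1 * (q - p)) s (c + 0 * (q - p)))).
    { intros q. f_equal; [|]; ring. }
    replace (exp (flow_exponent p s c) * flow_source p s c) with
      (exp (flow_exponent p s c) * (0 + 1 * flow_source p s c)) by ring.
    apply flow_directional; trivial; rewrite ?Rabs_R0, ?Rabs_R1; lra.
  - apply (is_derive_ext (fun q => flow (p + 0 * (q - c)) s (c + 1 * (q - c)))).
    { intros q. f_equal; [|]; ring. }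
    replace (exp (flow_exponent p s c)) with
      (exp (flow_exponent p s c) * (1 + 0 * flow_source p s c)) by ring.
    apply flow_directional; trivial; rewrite ?Rabs_R0, ?Rabs_R1; lra.
Qed.

Lemma flow_smooth : smooth box flow.
Proof.
  apply smooth_Ck. pose proof (open_cube p0 s0 y0 d) as HO. induction n.
  - apply Ck0_flow.
  - eapply (Ck_S_intro n box flow); trivial.
    + intros p s c Hp. split; [apply flow_cont, Hp|].
      destruct (flow_partials p s c Hp) as (H1 & H3).
      split; [exact H1|split; [exact (flow_ode p s c Hp)|exact H3]].
    + apply (Ck_mult n box (fun p s c => exp (flow_exponent p s c)) flow_source); trivial.
      apply Ck_exp, Ck_exponent; trivial.
      apply Ck_pint, Ck_source_integrand; trivial.
    + apply (Ck_along n f); trivial. apply Ck_smooth, Hf.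
    + apply (Ck_exp n box flow_exponent), Ck_exponent; trivial.
Qed.

End Flow.

(** The slots are parameter, time and initial value; the result is used once with [t] and once with
    [x] as time. Positivity of the derivative in the initial value is what will make the constructed
    family invertible in [k]. *)
Theorem ode_smooth_flow (D : R * R * R -> Prop) (f : R -> R -> R -> R) (p0 s0 y0 : R) :
  open D -> smooth D f -> D (p0, s0, y0) ->
  exists d Y, 0 < d /\ smooth (cube p0 s0 y0 d) Y /\
    forall p s c, cube p0 s0 y0 d (p, s, c) ->
      D (p, s, Y p s c) /\ dx Y p s c = f p s (Y p s c) /\ Y p s0 c = c /\ 0 < du Y p s c.
Proof.
  intros HD Hf Hp. destruct (flow_bounds D f p0 s0 y0 HD Hf Hp) as (r & M & Hr & HM & HB).
  set (d := Rmin (r / 4) (Rmin (r / 4 / M) (/ 4 / M))).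
  assert (Hd : 0 < d).
  { repeat apply Rmin_glb_lt; repeat apply Rdiv_lt_0_compat; lra. }
  assert (D1 : d <= r / 4) by apply Rmin_l.
  assert (D2 : M * d <= r / 4).
  { apply Rle_trans with (M * (r / 4 / M)).
    - apply Rmult_le_compat_l. lra. eapply Rle_trans; [apply Rmin_r|apply Rmin_l].
    - right; field; lra. }
  assert (D3 : M * d <= / 4).
  { apply Rle_trans with (M * (/ 4 / M)).
    - apply Rmult_le_compat_l. lra. eapply Rle_trans; [apply Rmin_r|apply Rmin_r].
    - right; field; lra. }
  exists d, (flow f s0). split; trivial. split.
  - apply (flow_smooth D f p0 s0 y0 r M d); trivial.
  - intros p s c Hb. split; [|split; [|split]].
    + apply HB. apply (good_in p0 s0 y0 r M d); trivial. apply (good_flow D f p0 s0 y0 r M d); trivial.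
    + apply is_derive_unique, (flow_ode D f p0 s0 y0 r M d); trivial.
    + apply (flow_init D f p0 s0 y0 r M d) with (s := s); trivial.
    + replace (du (flow f s0) p s c) with (exp (flow_exponent f s0 p s c)). apply exp_pos.
      symmetry. apply is_derive_unique, (flow_partials D f p0 s0 y0 r M d); trivial.
Qed.

(** * Integration of the overdetermined system *)

(** Multiplied by the integrating factor exp(- int a), the solution has zero derivative along the
    segment from [s0], so it keeps its initial value 0. *)
Lemma linear_ode_zero (p0 s0 c0 d : R) (a : R -> R -> R -> R) (g : R -> R) (p s c : R) :
  Ck 0 (cube p0 s0 c0 d) a -> cube p0 s0 c0 d (p, s, c) ->
  (forall z, cube p0 s0 c0 d (p, z, c) -> is_derive g z (a p z c * g z)) ->
  g s0 = 0 -> g s = 0.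
Proof.
  intros Ha Hp Hg H0.
  set (V := fun z => g z * exp (- pint s0 a p z c)).
  assert (B : Rabs (V s - V s0) <= 0 * Rabs (s - s0)).
  { apply (MVT_segment V (fun _ => 0)). intros z Hz. split; [|rewrite Rabs_R0; lra].
    assert (Bz : cube p0 s0 c0 d (p, z, c)).
    { apply (in_seg p0 s0 c0 d p s c z); trivial. }
    pose proof (pint_derive_s p0 s0 c0 d a p z c Ha Bz) as dE.
    assert (dX : is_derive (fun z => exp (- pint s0 a p z c)) z
        (- a p z c * exp (- pint s0 a p z c))).
    { apply (is_derive_comp exp (fun z => - pint s0 a p z c)).
      apply is_derive_Reals, derivable_pt_lim_exp. exact (is_derive_opp _ _ _ dE). }
    pose proof (is_derive_mult _ _ _ _ _ (Hg z Bz) dX Rmult_comm) as dV.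
    match type of dV with is_derive _ _ ?l =>
      match goal with |- is_derive _ _ ?l' => replace l' with l; [exact dV|] end end.
    unfold plus, mult; simpl. ring. }
  rewrite Rmult_0_l in B. unfold V in B. rewrite H0, Rmult_0_l, Rminus_0_r, Rabs_mult in B.
  pose proof (exp_pos (- pint s0 a p s c)) as X.
  rewrite (Rabs_pos_eq (exp _)) in B by lra.
  destruct (Req_dec (g s) 0) as [E|E]; trivial.
  apply Rabs_pos_lt in E. assert (0 < Rabs (g s) * exp (- pint s0 a p s c)).
  apply Rmult_lt_0_compat; trivial. lra.
Qed.

Section Frobenius.

Context (Omega : R * R -> Prop) (A B C : R -> R -> R) (D : R * R * R -> Prop)
  (eta : R -> R -> R -> R).
Hypotheses (HA : analytic Omega A) (HB : analytic Omega B) (HC : analytic Omega C)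
  (HD : open D) (HO : lies_over Omega D) (Heta : nonlinear_solution A B C D eta).

(* [w_t] as prescribed by [w_x = eta(t, x, w)] and [L w = 0]. *)
Definition zeta (t x u : R) : R :=
  A t x * (dx eta t x u + eta t x u * du eta t x u) + B t x * eta t x u + C t x * u.

Let eta_smooth : smooth D eta. Proof. apply Heta. Qed.

Lemma zeta_smooth : smooth D zeta.
Proof.
  destruct (smooth_partials _ _ eta_smooth) as (_ & Ex & Eu).
  apply smooth_Ck. intros n. unfold zeta.
  pose proof (Ck_analytic Omega D A n HD HO HA) as KA.
  pose proof (Ck_analytic Omega D B n HD HO HB) as KB.
  pose proof (Ck_analytic Omega D C n HD HO HC) as KC.
  pose proof (Ck_smooth _ _ n Ex) as K1. pose proof (Ck_smooth _ _ n Eu) as K2.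
  pose proof (Ck_smooth _ _ n eta_smooth) as K0.
  exact (Ck_plus n D _ _ HD (Ck_plus n D _ _ HD
    (Ck_mult n D _ _ HD KA (Ck_plus n D _ _ HD K1 (Ck_mult n D _ _ HD K0 K2)))
    (Ck_mult n D _ _ HD KB K0)) (Ck_mult n D _ _ HD KC (Ck_u n D HD))).
Qed.

(* The integrability condition of [w_x = eta(t, x, w)], [w_t = zeta(t, x, w)] is exactly
   the nonlinear equation. *)
Lemma zeta_compatible (t x u : R) : D (t, x, u) ->
  dt eta t x u + zeta t x u * du eta t x u = dx zeta t x u + eta t x u * du zeta t x u.
Proof.
  intros Hp. destruct (smooth_partials _ _ eta_smooth) as (_ & Ex & Eu).
  destruct (Ck_partials _ _ _ (Ck_smooth _ _ 1 eta_smooth) t x u Hp) as (_ & e2 & e3).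
  destruct (Ck_partials _ _ _ (Ck_smooth _ _ 1 Ex) t x u Hp) as (_ & x2 & x3).
  destruct (Ck_partials _ _ _ (Ck_smooth _ _ 1 Eu) t x u Hp) as (_ & u2 & u3).
  destruct (analytic_props _ _ HA) as (_ & _ & KA).
  destruct (analytic_props _ _ HB) as (_ & _ & KB).
  destruct (analytic_props _ _ HC) as (_ & _ & KC).
  pose proof (Derive_correct _ _ (proj2 (proj2 (KA t x (HO _ _ _ Hp))))) as a2.
  pose proof (Derive_correct _ _ (proj2 (proj2 (KB t x (HO _ _ _ Hp))))) as b2.
  pose proof (Derive_correct _ _ (proj2 (proj2 (KC t x (HO _ _ _ Hp))))) as c2.
  assert (Zx : dx zeta t x u =
     d2 A t x * (dx eta t x u + eta t x u * du eta t x u)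
     + A t x * (dx (dx eta) t x u + (dx eta t x u * du eta t x u + eta t x u * dx (du eta) t x u))
     + (d2 B t x * eta t x u + B t x * dx eta t x u) + d2 C t x * u).
  { apply is_derive_unique.
    pose proof (is_derive_plus _ _ _ _ _ (is_derive_plus _ _ _ _ _
      (is_derive_mult _ _ _ _ _ a2 (is_derive_plus _ _ _ _ _ x2
         (is_derive_mult _ _ _ _ _ e2 u2 Rmult_comm)) Rmult_comm)
      (is_derive_mult _ _ _ _ _ b2 e2 Rmult_comm))
      (is_derive_mult _ _ _ _ _ c2
        (is_derive_const (K := R_AbsRing) (V := R_NormedModule) u x) Rmult_comm)) as dZ.
    match type of dZ with is_derive _ _ ?l =>
      match goal with |- is_derive _ _ ?l' => replace l' with l; [exact dZ|] end end.
    change (Derive (A t) x) with (d2 A t x). change (Derive (B t) x) with (d2 B t x).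
    change (Derive (C t) x) with (d2 C t x).
    unfold plus, mult, zero; simpl. ring. }
  assert (Zu : du zeta t x u =
     A t x * (du (dx eta) t x u + (du eta t x u * du eta t x u + eta t x u * du (du eta) t x u))
     + B t x * du eta t x u + C t x).
  { apply is_derive_unique.
    pose proof (is_derive_plus _ _ _ _ _ (is_derive_plus _ _ _ _ _
      (is_derive_scal _ _ (A t x) _ (is_derive_plus _ _ _ _ _ x3
         (is_derive_mult _ _ _ _ _ e3 u3 Rmult_comm)))
      (is_derive_scal _ _ (B t x) _ e3))
      (is_derive_scal _ _ (C t x) _ (is_derive_id (K := R_AbsRing) u))) as dZ.
    match type of dZ with is_derive _ _ ?l =>
      match goal with |- is_derive _ _ ?l' => replace l' with l; [exact dZ|] end end.
    unfold plus, mult, one; simpl. unfold mult; simpl. ring. }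
  assert (EB : dx (fun s y v => B s y * eta s y v) t x u
     = d2 B t x * eta t x u + B t x * dx eta t x u).
  { apply is_derive_unique. exact (is_derive_mult _ _ _ _ _ b2 e2 Rmult_comm). }
  pose proof (proj2 Heta t x u Hp) as PDE. rewrite EB in PDE.
  rewrite Zx, Zu, PDE, (dxdu_comm D eta HD eta_smooth t x u Hp). unfold zeta. ring.
Qed.

Lemma frobenius (t0 x0 u0 : R) : D (t0, x0, u0) ->
  exists d w, 0 < d /\ smooth (cube t0 x0 u0 d) w /\
    (forall k, Rabs (k - u0) < d -> w t0 x0 k = k) /\
    forall t x k, cube t0 x0 u0 d (t, x, k) ->
      D (t, x, w t x k) /\ 0 < du w t x k /\
      dx w t x k = eta t x (w t x k) /\ dt w t x k = zeta t x (w t x k).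
Proof.
  intros Hp.
  (* For the integration in [t] on the line x = x0 the parameter slot is a dummy and time sits in
     the second slot, hence this rearranged domain. *)
  set (D1 := fun p : R * R * R => D (snd (fst p), x0, snd p)).
  assert (HD1 : open D1).
  { apply open_cubeP. intros p s y H.
    destruct (proj1 (open_cubeP D) HD s x0 y H) as (d & Hd & Hin).
    exists d. split; trivial. intros p' s' y' (_ & K2 & K3). apply Hin.
    repeat split; simpl; trivial. rewrite Rminus_diag, Rabs_R0; trivial. }
  assert (F1 : smooth D1 (fun _ s y => zeta s x0 y)).
  { apply smooth_Ck. intros n.
    exact (Ck_comp n D1 D zeta (fun _ s _ => s) (fun _ _ _ => x0) (fun _ _ y => y) HD1 HD
      (Ck_smooth _ _ n zeta_smooth) (Ck_x n D1 HD1) (Ck_const n D1 x0 HD1) (Ck_u n D1 HD1)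
      (fun t x u H => H)). }
  destruct (ode_smooth_flow D1 _ x0 t0 u0 HD1 F1 Hp) as (d1 & Y1 & Hd1 & S1 & P1).
  destruct (ode_smooth_flow D eta t0 x0 u0 HD eta_smooth Hp) as (d2 & Y2 & Hd2 & S2 & P2).
  assert (C1 : cube x0 t0 u0 d1 (x0, t0, u0)) by (apply cube_center; trivial).
  (* The solution on the line supplies the initial values of the flow in [x]; its continuity keeps
     them inside the box of that second flow. *)
  destruct (proj1 (cont3_eps _ _ _ _) (proj1 (S1 0%nat _ _ _ C1)) d2 Hd2) as (d3 & Hd3 & B3).
  set (d := Rmin d1 (Rmin d2 d3)).
  assert (Hd : 0 < d) by (repeat apply Rmin_glb_lt; trivial).
  assert (L1 : d <= d1) by apply Rmin_l.
  assert (L2 : d <= d2) by (eapply Rle_trans; [apply Rmin_r|apply Rmin_l]).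
  assert (L3 : d <= d3) by (eapply Rle_trans; [apply Rmin_r|apply Rmin_r]).
  set (v := fun t k => Y1 x0 t k).
  set (w := fun t x k => Y2 t x (v t k)).
  set (box := cube t0 x0 u0 d).
  assert (HO' : open box) by apply open_cube.
  assert (I1 : forall t x k, box (t, x, k) -> cube x0 t0 u0 d1 (x0, t, k)).
  { intros t x k (K1 & K2 & K3); simpl in *. repeat split; simpl; try lra.
    rewrite Rminus_diag, Rabs_R0; trivial. }
  assert (I2 : forall t x k, box (t, x, k) -> cube t0 x0 u0 d2 (t, x, v t k)).
  { intros t x k (K1 & K2 & K3); simpl in *. repeat split; simpl; try lra.
    pose proof (B3 x0 t k) as E. rewrite (proj1 (proj2 (proj2 (P1 _ _ _ C1)))) in E.
    apply E. repeat split; simpl; try lra. rewrite Rminus_diag, Rabs_R0; trivial. }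
  assert (Sv : smooth box (fun t _ k => v t k)).
  { apply smooth_Ck. intros n.
    exact (Ck_comp n box _ Y1 (fun _ _ _ => x0) (fun t _ _ => t) (fun _ _ k => k) HO'
      (open_cube x0 t0 u0 d1) (Ck_smooth _ _ n S1) (Ck_const n box x0 HO') (Ck_t n box HO')
      (Ck_u n box HO') I1). }
  assert (Sw : smooth box w).
  { apply smooth_Ck. intros n.
    exact (Ck_comp n box _ Y2 (fun t _ _ => t) (fun _ x _ => x) (fun t _ k => v t k) HO'
      (open_cube t0 x0 u0 d2) (Ck_smooth _ _ n S2) (Ck_t n box HO') (Ck_x n box HO')
      (Ck_smooth _ _ n Sv) I2). }
  assert (Dw : forall t x k, box (t, x, k) -> D (t, x, w t x k)).
  { intros t x k Hb. apply (P2 _ _ _ (I2 _ _ _ Hb)). }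
  assert (Xw : forall t x k, box (t, x, k) -> dx w t x k = eta t x (w t x k)).
  { intros t x k Hb. apply (P2 _ _ _ (I2 _ _ _ Hb)). }
  assert (W0 : forall t x k, box (t, x, k) -> w t x0 k = v t k).
  { intros t x k Hb. apply (P2 _ _ _ (I2 _ _ _ Hb)). }
  assert (Uw : forall t x k, box (t, x, k) -> 0 < du w t x k).
  { intros t x k Hb.
    destruct (Ck_partials _ _ _ (Ck_smooth _ _ 1 S1) _ _ _ (I1 _ _ _ Hb)) as (_ & _ & q1).
    destruct (Ck_partials _ _ _ (Ck_smooth _ _ 1 S2) _ _ _ (I2 _ _ _ Hb)) as (_ & _ & q2).
    (* By the chain rule w_k is the product of the initial-value derivatives of the two flows, both
       positive. *)
    replace (du w t x k) with (du Y1 x0 t k * du Y2 t x (v t k)).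
    - apply Rmult_lt_0_compat. apply (P1 _ _ _ (I1 _ _ _ Hb)). apply (P2 _ _ _ (I2 _ _ _ Hb)).
    - symmetry. apply is_derive_unique.
      exact (is_derive_comp (fun z => Y2 t x z) (fun k => v t k) k _ _ q2 q1). }
  destruct (smooth_partials _ _ eta_smooth) as (Et & Ex & Eu).
  destruct (smooth_partials _ _ Sw) as (Wt & Wx & Wu).
  assert (Tw : forall t x k, box (t, x, k) -> dt w t x k = zeta t x (w t x k)).
  { intros t x k Hb. apply Rminus_diag_uniq.
    (* Here (w_t)_x is the [t]-derivative of eta(t,x,w), namely eta_t + eta_u w_t; subtracting the
       [x]-derivative of zeta(t,x,w) and using [zeta_compatible] leaves eta_u times the defect. *)
    apply (linear_ode_zero t0 x0 u0 d (fun t x k => du eta t x (w t x k))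
      (fun y => dt w t y k - zeta t y (w t y k)) t x k).
    - exact (Ck_comp 0 box D (du eta) (fun t _ _ => t) (fun _ x _ => x) w HO' HD
        (Ck_smooth _ _ 0 Eu) (Ck_t 0 box HO') (Ck_x 0 box HO') (Ck_smooth _ _ 0 Sw) Dw).
    - exact Hb.
    - intros y Hy.
      destruct (Ck_partials _ _ _ (Ck_smooth _ _ 1 Wt) t y k Hy) as (_ & a1 & _).
      destruct (comp_graph_partials D box w zeta t y k HD Sw zeta_smooth Hy (Dw _ _ _ Hy))
        as (_ & a2).
      pose proof (is_derive_minus _ _ _ _ _ a1 a2) as a3.
      match type of a3 with is_derive _ _ ?l =>
        match goal with |- is_derive _ _ ?l' => replace l' with l; [exact a3|] end end.
      rewrite <- (dtdx_comm box w HO' Sw t y k Hy).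
      rewrite (dt_ext box _ (fun t x k => eta t x (w t x k)) HO' Xw t y k Hy).
      rewrite (Xw t y k Hy).
      replace (dt (fun t x k => eta t x (w t x k)) t y k) with
        (dt eta t y (w t y k) + du eta t y (w t y k) * dt w t y k).
      + pose proof (zeta_compatible t y (w t y k) (Dw _ _ _ Hy)) as E.
        unfold minus, plus, opp; simpl.
        replace (dt eta t y (w t y k)) with
          (dx zeta t y (w t y k) + eta t y (w t y k) * du zeta t y (w t y k)
           - zeta t y (w t y k) * du eta t y (w t y k)) by lra. ring.
      + symmetry. apply is_derive_unique.
        apply (comp_graph_partials D box w eta t y k HD Sw eta_smooth Hy (Dw _ _ _ Hy)).
    (* On x = x0 the second flow is at its initial time, so [w] coincides with [v] there, and [v]
       was built to satisfy the [t]-equation. *)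
    - pose proof (cube_s0 _ _ _ _ _ _ _ Hb) as Hb0. apply Rminus_diag_eq.
      rewrite (W0 t x0 k Hb0).
      transitivity (Derive (fun s => v s k) t).
      + apply Derive_ext_loc. generalize (open_slice_t box t x0 k HO' Hb0).
        apply filter_imp. intros s Hs. apply (W0 s x0 k Hs).
      + apply (P1 _ _ _ (I1 _ _ _ Hb0)). }
  exists d, w. split; trivial. split; trivial. split.
  - intros k Hk.
    assert (Hb : box (t0, x0, k)).
    { destruct (cube_center t0 x0 u0 d Hd) as (K1 & K2 & _). repeat split; trivial. }
    rewrite (W0 _ _ _ Hb). apply (P1 _ _ _ (I1 _ _ _ Hb)).
  - intros t x k Hb. split; [|split; [|split]]; auto.
Qed.

End Frobenius.

(** The parameter range is halved so that the closed interval of radius d/2 around [u0] stays inside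
    the domain of [w]. On it [w] is strictly increasing, and the open image lies between the two
    endpoint graphs: the intermediate value theorem gives surjectivity, monotonicity gives
    injectivity. *)
Lemma local_hodograph (t0 x0 u0 d : R) (w : R -> R -> R -> R) :
  0 < d -> smooth (cube t0 x0 u0 d) w ->
  (forall t x k, cube t0 x0 u0 d (t, x, k) -> 0 < du w t x k) ->
  (forall k, Rabs (k - u0) < d -> w t0 x0 k = k) ->
  exists (D' : R * R * R -> Prop) (Phi : R -> R -> R -> R),
    open D' /\ D' (t0, x0, u0) /\ hodograph D' (cube t0 x0 u0 (d / 2)) Phi w.
Proof.
  intros Hd Sw Uw W0. set (e := d / 2). assert (He : 0 < e < d) by (unfold e; lra).
  set (strip := fun p : R * R * R => Rabs (fst (fst p) - t0) < e /\ Rabs (snd (fst p) - x0) < e).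
  assert (Hs : open strip).
  { apply open_cubeP. intros t x u (H1 & H2); simpl in *.
    assert (Hc : cube t0 x0 u e (t, x, u)).
    { repeat split; simpl; trivial. rewrite Rminus_diag, Rabs_R0; lra. }
    destruct (proj1 (open_cubeP _) (open_cube t0 x0 u e) t x u Hc) as (r & Hr & Hin).
    exists r. split; trivial. intros t' x' u' H. destruct (Hin _ _ _ H) as (K1 & K2 & _).
    split; trivial. }
  assert (Hin : forall t x u k, strip (t, x, u) -> u0 - e <= k <= u0 + e ->
    cube t0 x0 u0 d (t, x, k)).
  { intros t x u k (H1 & H2) Hk; simpl in *. repeat split; simpl; try lra.
    apply Rabs_def1; lra. }
  assert (Dw : forall t x u k, strip (t, x, u) -> u0 - e <= k <= u0 + e ->
    ex_derive (fun z => w t x z) k).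
  { intros t x u k H1 H2. apply (Sw 1%nat _ _ _ (Hin _ _ _ _ H1 H2)). }
  assert (Mw : forall t x u k k', strip (t, x, u) -> u0 - e <= k -> k < k' -> k' <= u0 + e ->
    w t x k < w t x k').
  { intros t x u k k' H1 H2 H3 H4. apply (deriv_pos_increasing (fun z => w t x z)); trivial.
    intros z Hz. split. apply (Dw t x u); trivial; lra.
    apply Uw. apply (Hin t x u); trivial; lra. }
  (* The region strictly between the graphs of [w] at the two extreme parameters; it is open because
     [w] is jointly continuous. *)
  set (D' := fun p : R * R * R => strip p /\ w (fst (fst p)) (snd (fst p)) (u0 - e) < snd p
     /\ snd p < w (fst (fst p)) (snd (fst p)) (u0 + e)).
  assert (HD' : open D').
  { apply open_cubeP. intros t x u (H1 & H2 & H3); simpl in H2, H3.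
    assert (Cw : forall k, u0 - e <= k <= u0 + e -> cont3 (fun t x _ => w t x k) t x u).
    { intros k Hk. apply (cont3_comp w (fun t _ _ => t) (fun _ x _ => x) (fun _ _ _ => k)).
      apply cont3_t. apply cont3_x. apply cont3_const.
      apply (Sw 0%nat _ _ _ (Hin _ _ _ _ H1 Hk)). }
    destruct (cont3_pos_cube strip (fun t x u => u - w t x (u0 - e)) t x u)
      as (r1 & Hr1 & B1); trivial.
    { exact (continuous_minus (V := R_NormedModule) _ _ _ (cont3_u t x u)
        (Cw (u0 - e) ltac:(lra))). }
    { lra. }
    destruct (cont3_pos_cube strip (fun t x u => w t x (u0 + e) - u) t x u)
      as (r2 & Hr2 & B2); trivial.
    { exact (continuous_minus (V := R_NormedModule) _ _ _ (Cw (u0 + e) ltac:(lra))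
        (cont3_u t x u)). }
    { lra. }
    exists (Rmin r1 r2). split. apply Rmin_glb_lt; trivial.
    intros t' x' u' Hc.
    destruct (B1 t' x' u') as (K1 & K2). { eapply cube_mono; [|exact Hc]. apply Rmin_l. }
    destruct (B2 t' x' u') as (_ & K3). { eapply cube_mono; [|exact Hc]. apply Rmin_r. }
    split; [|split]; simpl; trivial; lra. }
  (* The inverse is selected by choice; outside [D'] its value is arbitrary. *)
  set (Phi := fun t x u => epsilon (inhabits 0) (fun k => Rabs (k - u0) < e /\ w t x k = u)).
  assert (HPhi : forall t x u, D' (t, x, u) -> Rabs (Phi t x u - u0) < e /\ w t x (Phi t x u) = u).
  { intros t x u (H1 & H2 & H3); simpl in H2, H3.
    apply (epsilon_spec (inhabits 0) (fun k => Rabs (k - u0) < e /\ w t x k = u)).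
    destruct (IVT_derivable (fun z => w t x z) (u0 - e) (u0 + e) u) as (k & Hk & Ek).
    - lra.
    - intros z Hz. apply (Dw t x u); trivial.
    - lra.
    - exists k. split; trivial. apply Rabs_def1; lra. }
  assert (Hct : strip (t0, x0, u0)).
  { split; simpl; rewrite Rminus_diag, Rabs_R0; lra. }
  exists D', Phi. split; trivial. split.
  (* The normalization of [w] at the base point makes the two bounding values exactly u0 - e and u0
     + e. *)
  - split; trivial. simpl. rewrite !W0. lra.
    replace (u0 + e - u0) with e by ring. rewrite Rabs_pos_eq; lra.
    replace (u0 - e - u0) with (- e) by ring. rewrite Rabs_Ropp, Rabs_pos_eq; lra.
  - intros t x u k. split.
    + intros (Hp & ->). destruct (HPhi t x u Hp) as (K1 & K2). split; [|congruence].
      destruct Hp as ((H1 & H2) & _). repeat split; trivial.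
    + intros ((H1 & H2 & H3) & ->); simpl in H1, H2, H3. apply Rabs_def2 in H3.
      assert (Hst : strip (t, x, w t x k)) by (split; trivial).
      assert (Hp : D' (t, x, w t x k)).
      { split; trivial. simpl. split; apply (Mw t x (w t x k)); trivial; lra. }
      split; trivial. destruct (HPhi _ _ _ Hp) as (K1 & K2). apply Rabs_def2 in K1.
      destruct (Rtotal_order k (Phi t x (w t x k))) as [L|[L|L]]; trivial; exfalso.
      * assert (w t x k < w t x (Phi t x (w t x k))).
        { apply (Mw t x (w t x k)); trivial; lra. } lra.
      * assert (w t x (Phi t x (w t x k)) < w t x k).
        { apply (Mw t x (w t x k)); trivial; lra. } lra.
Qed.

Theorem corollary7 (Omega : R * R -> Prop) (A B C : R -> R -> R)
  (Omega_open : open Omega)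
  (A_analytic : analytic Omega A)
  (B_analytic : analytic Omega B)
  (C_analytic : analytic Omega C)
  (A_neq0 : forall t x : R, Omega (t, x) -> A t x <> 0) :
  (forall (W D : R * R * R -> Prop) (w Phi : R -> R -> R -> R),
     open W -> open D -> lies_over Omega W ->
     linear_solution A B C W w ->
     (forall t x k : R, W (t, x, k) -> du w t x k <> 0) ->
     hodograph D W Phi w ->
     smooth D Phi /\
     (forall t x u : R, D (t, x, u) -> du Phi t x u <> 0) /\
     nonlinear_solution A B C D (nonlocal_subst Phi))
  /\
  (forall (D : R * R * R -> Prop) (eta : R -> R -> R -> R),
     open D -> lies_over Omega D ->
     nonlinear_solution A B C D eta ->
     forall t0 x0 u0 : R, D (t0, x0, u0) ->
     exists (D' W : R * R * R -> Prop) (w Phi : R -> R -> R -> R),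
       open D' /\ open W /\
       D' (t0, x0, u0) /\ (forall p : R * R * R, D' p -> D p) /\
       linear_solution A B C W w /\
       (forall t x k : R, W (t, x, k) -> du w t x k <> 0) /\
       hodograph D' W Phi w /\
       smooth D' Phi /\
       (forall t x u : R, D' (t, x, u) -> du Phi t x u <> 0) /\
       (forall t x u : R, D' (t, x, u) ->
          eta t x u = nonlocal_subst Phi t x u)).
Proof.
  split.
  - intros W D w Phi HW HD HO (Sw & Lw) Hn Hh. split; [|split].
    + exact (hodograph_smooth D W w Phi HW HD Sw Hn Hh).
    + exact (hodograph_du_neq0 D W w Phi HW HD Sw Hn Hh).
    + apply (hodograph_nonlinear D W w Phi HW HD Sw Hn Hh Omega A B C); trivial.
      intros t x Hp. split; [|split].
      * apply (analytic_props _ _ A_analytic), Hp.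
      * apply (analytic_props _ _ B_analytic), Hp.
      * apply (analytic_props _ _ C_analytic), Hp.
  - intros D eta HD HO Heta t0 x0 u0 Hp.
    destruct (frobenius Omega A B C D eta A_analytic B_analytic C_analytic HD HO Heta t0 x0 u0 Hp)
      as (d & w & Hd & Sw & W0 & Pw).
    destruct (local_hodograph t0 x0 u0 d w Hd Sw) as (D' & Phi & HD' & Hc & Hh); trivial.
    { intros t x k Hb. apply (Pw t x k Hb). }
    (* The bijection is available over the half cube only, so every property of [w] is restricted to
       it. *)
    set (W := cube t0 x0 u0 (d / 2)) in *.
    assert (HW : open W) by apply open_cube.
    assert (HWb : forall p, W p -> cube t0 x0 u0 d p) by (intros p; apply cube_mono; lra).
    assert (SW : smooth W w).
    { intros n t x k Hb. apply Sw, HWb, Hb. }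
    assert (Hn : forall t x k, W (t, x, k) -> du w t x k <> 0).
    { intros t x k Hb. apply Rgt_not_eq, (Pw t x k (HWb _ Hb)). }
    pose proof (hodograph_W D' W w Phi Hh) as HDW.
    exists D', W, w, Phi.
    split; [|split; [|split; [|split; [|split; [|split; [|split; [|split; [|split]]]]]]]]; trivial.
    + intros [[t x] u] Hp'. destruct (HDW t x u Hp') as (Hb & E). rewrite E.
      apply (Pw t x _ (HWb _ Hb)).
    (* Along the graph w_xx = eta_x + eta_u eta, so w_t = zeta(t,x,w) is L w = 0 solved for w_t. *)
    + split; trivial. intros t x k Hb.
      assert (Xw : forall t x k, W (t, x, k) -> dx w t x k = eta t x (w t x k)).
      { intros t' x' k' Hb'. apply (Pw _ _ _ (HWb _ Hb')). }
      destruct (Pw t x k (HWb _ Hb)) as (Dw & _ & E1 & E2).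
      unfold Lop.
      change (dt w t x k - A t x * dx (dx w) t x k - B t x * dx w t x k - C t x * w t x k = 0).
      rewrite (dx_ext W _ (fun t x k => eta t x (w t x k)) HW Xw t x k Hb).
      replace (dx (fun t x k => eta t x (w t x k)) t x k) with
        (dx eta t x (w t x k) + du eta t x (w t x k) * dx w t x k).
      2:{ symmetry. apply is_derive_unique.
          apply (comp_graph_partials D W w eta t x k HD SW (proj1 Heta) Hb Dw). }
      rewrite E2, E1. unfold zeta. ring.
    + exact (hodograph_smooth D' W w Phi HW HD' SW Hn Hh).
    + exact (hodograph_du_neq0 D' W w Phi HW HD' SW Hn Hh).
    + intros t x u Hp'. rewrite (hodograph_subst D' W w Phi HW HD' SW Hn Hh t x u Hp').
      destruct (HDW t x u Hp') as (Hb & E).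
      destruct (Pw _ _ _ (HWb _ Hb)) as (_ & _ & E1 & _). rewrite E1, <- E. reflexivity.
Qed.
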